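(* Let $\Lambda,V$ satisfy Assumption A (see context), in the exact matching model in dimension $d=1$. For $K,L\ge1$ with $M=KL$ an integer, let $\widehat P_1,\dots,\widehat P_n$ be the rank-window posterior approximations (see context) with locality parameter $M=KL$, and let $P_1,\dots,P_n$ be the true posterior marginals. Then there exists a constant $C>0$, depending on $\Lambda(\cdot),V(\cdot)$ but not on $K,L$, such that for any $\kappa>1$ there is $n_0(\kappa,K,L)$ such that for all $n\ge n_0(\kappa,K,L)$, with probability at least $1-\exp(-(\log n)^\kappa)$ over $(X,Y)$, $$\frac1n\sum_{i=1}^n\mathrm{TV}(P_i,\widehat P_i)\le CL^{-\delta}+C\left(1-e^{-CL\,g(4L/\Lambda_{\min})}\right)^{K/3}.$$
   Context: Assumption A (dimension $d=1$). (i) $\Lambda$ is a continuous probability density on $[0,1]$ with $0<\Lambda_{\min}\le\Lambda(x)\le\Lambda_{\max}$ for all $x\in[0,1]$. (ii) $V:\mathbb R\to\mathbb R$ satisfies $V(\varepsilon)=V(-\varepsilon)$, $\int_{\mathbb R}e^{-V(\varepsilon)}\,d\varepsilon=1$, and there are constants $C_0,c_0,\delta>0$, $V_{\min}\in\mathbb R$ and non-decreasing $f,g:[0,\infty)\to\mathbb R$ with $C_0(1+|\varepsilon|^{C_0})\ge g(|\varepsilon|)\ge V(\varepsilon)-V_{\min}\ge f(|\varepsilon|)\ge c_0|\varepsilon|^{1+\delta}$ for all $\varepsilon\in\mathbb R$. Both $\Lambda$ and $V$ do not depend on $n$. Exact matching model. For $n\ge1$, $p_n(x,y)=\mathcal Z_n^{-1}\sqrt{\Lambda(x)\Lambda(y)}\,e^{-V(n(x-y))}$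 is a probability density on $[0,1]^2$ ($\mathcal Z_n$ normalizes). Let $(\bar X_i,\bar Y_i)$, $i\in[n]$, be i.i.d. from $p_n$, and independently let $\pi^*$ be uniform on the set $\mathbb S_n$ of permutations of $[n]$. Observe $X_i=\bar X_{\pi^*(i)}$, $Y_i=\bar Y_i$, so that $X_i$ is truly matched to $Y_{\pi^*(i)}$. The posterior law of $\pi^*$ is $P(\pi\mid X,Y)\propto\exp(-\sum_{i=1}^nV(n(X_i-Y_{\pi(i)})))$, $\pi\in\mathbb S_n$, with marginals $P_i(j)=P(\pi(i)=j\mid X,Y)$. Rank-window approximation with integer parameter $M\ge1$. Let $s,t$ be the permutations of $[n]$ with $X_{s(1)}<\dots<X_{s(n)}$ and $Y_{t(1)}<\dots<Y_{t(n)}$. For each $i\in[n]$ let $i_-=\max(i-M,1)$, $i_+=\min(i+M,n)$, and let $P^{(i)}(\pi)\propto\exp(-\sum_{k=i_-}^{i_+}V(n(X_{s(k)}-Y_{t(\pi(k))})))$ over bijections $\pi$ of $\{i_-,\dots,i_+\}$ to itself. Let $\widehat P^{\mathrm{sort}}_i(j)=P^{(i)}(\pi(i)=j)$ for $j\in\{i_-,\dots,i_+\}$ and $0$ otherwise, and $\widehat P_i(j)=\widehat P^{\mathrm{sort}}_{s^{-1}(i)}(t^{-1}(j))$ for $i,j\in[n]$. $\mathrm{TV}(P,P')=\frac12\sum_j|P(j)-P'(j)|$. *)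

(* Defs.v *)
From HB Require Import structures.
From mathcomp Require Import all_boot all_order all_algebra all_fingroup.
From mathcomp Require Import all_classical all_reals all_analysis.

Set Implicit Arguments.
Unset Strict Implicit.
Unset Printing Implicit Defensive.

Import Order.TTheory GRing.Theory Num.Theory numFieldNormedType.Exports.

Local Open Scope classical_set_scope.
Local Open Scope ring_scope.

(* [measV] is what makes the integral of exp(-V) meaningful: the integral of
   MathComp-Analysis is total, also on non-measurable functions. *)
Record assumptionA (R : realType) (Lambda V : R -> R)
    (Lmin Lmax C0 c0 delta Vmin : R) (f g : R -> R) : Prop := AssumptionA {
  Lambda_cont : {within `[0, 1], continuous Lambda} ;
  Lambda_density :
    (\int[lebesgue_measure]_(x in `[0%R, 1%R]) (Lambda x)%:E = 1)%E ;
  Lmin_gt0 : 0 < Lmin ;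
  Lambda_bounds : forall x : R, 0 <= x <= 1 -> Lmin <= Lambda x <= Lmax ;
  measV : measurable_fun setT V ;
  V_even : forall e : R, V e = V (- e) ;
  V_density : (\int[lebesgue_measure]_(e in setT) (expR (- V e))%:E = 1)%E ;
  C0_gt0 : 0 < C0 ;
  c0_gt0 : 0 < c0 ;
  delta_gt0 : 0 < delta ;
  f_nondecreasing : forall a b : R, 0 <= a -> a <= b -> f a <= f b ;
  g_nondecreasing : forall a b : R, 0 <= a -> a <= b -> g a <= g b ;
  V_growth : forall e : R,
    [/\ g `|e| <= C0 * (1 + `|e| `^ C0),
        V e - Vmin <= g `|e|,
        f `|e| <= V e - Vmin
      & c0 * `|e| `^ (1 + delta) <= f `|e| ] }.

Notation lebesgue2 := (lebesgue_measure \x lebesgue_measure)%E (only parsing).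

Section MatchingDensity.
Context {R : realType}.
Implicit Types (Lambda V : R -> R) (n : nat).

Definition unit_square : set (R * R) := `[0, 1] `*` `[0, 1].

Definition unnorm_density Lambda V n (z : R * R) : R :=
  Num.sqrt (Lambda z.1 * Lambda z.2) * expR (- V (n%:R * (z.1 - z.2))).

Definition normalizer Lambda V n : R :=
  Rintegral lebesgue2 unit_square (unnorm_density Lambda V n).

Definition match_density Lambda V n (z : R * R) : R :=
  (normalizer Lambda V n)^-1 * unnorm_density Lambda V n z.

End MatchingDensity.

(* In [pairs_indep] and [pistar_indep], taking some [A i] equal to [setT] gives
   all subfamilies; as rectangles form a pi-system, this is mutual independence
   of the pairs, and independence of [pistar] from the whole family. *)
Record exact_matching_model (R : realType) (d : measure_display)
    (Omega : measurableType d) (P : probability Omega R)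
    (Lambda V : R -> R) (n : nat)
    (Xbar Ybar : 'I_n -> {RV P >-> R}) (pistar : Omega -> {perm 'I_n}) : Prop :=
  ExactMatchingModel {
  pair_law : forall (i : 'I_n) (A : set (R * R)), measurable A ->
    P [set w | A (Xbar i w, Ybar i w)] =
    (\int[lebesgue2]_(z in A `&` unit_square) (match_density Lambda V n z)%:E)%E ;
  pairs_indep : forall A : 'I_n -> set (R * R), (forall i, measurable (A i)) ->
    P [set w | forall i, A i (Xbar i w, Ybar i w)] =
    (\prod_(i < n) P [set w | A i (Xbar i w, Ybar i w)])%E ;
  pistar_measurable : forall sigma : {perm 'I_n},
    measurable [set w | pistar w = sigma] ;
  pistar_uniform : forall sigma : {perm 'I_n},
    P [set w | pistar w = sigma] = ((#|{perm 'I_n}|%:R)^-1)%:E ;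
  pistar_indep : forall (A : 'I_n -> set (R * R)) (sigma : {perm 'I_n}),
    (forall i, measurable (A i)) ->
    P ([set w | forall i, A i (Xbar i w, Ybar i w)]
       `&` [set w | pistar w = sigma]) =
    (P [set w | forall i, A i (Xbar i w, Ybar i w)]
     * P [set w | pistar w = sigma])%E }.

Definition observedX (R : realType) (Omega : Type) (n : nat)
    (Xbar : 'I_n -> Omega -> R) (pistar : Omega -> {perm 'I_n}) (w : Omega) :
  'I_n -> R := fun i => Xbar (pistar w i) w.

Definition observedY (R : realType) (Omega : Type) (n : nat)
    (Ybar : 'I_n -> Omega -> R) (w : Omega) : 'I_n -> R := fun i => Ybar i w.

Section Posterior.
Context {R : realType} {n : nat}.
Implicit Types (V : R -> R) (X Y : 'I_n -> R) (pi : {perm 'I_n}).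

Definition post_weight V X Y pi : R :=
  expR (- \sum_(i < n) V (n%:R * (X i - Y (pi i)))).

Definition posterior V X Y pi : R :=
  post_weight V X Y pi / \sum_(rho : {perm 'I_n}) post_weight V X Y rho.

Definition post_marginal V X Y (i j : 'I_n) : R :=
  \sum_(pi : {perm 'I_n} | pi i == j) posterior V X Y pi.

(* The permutation s with X_(s 0) < ... < X_(s n.-1). It is unique if it exists,
   i.e. if the X_i are pairwise distinct (almost sure in the model); the value
   in case of ties is arbitrary. *)
Definition sorting_perm X : {perm 'I_n} :=
  odflt 1%g [pick s : {perm 'I_n} |
    [forall i : 'I_n, forall j : 'I_n, (i < j)%N ==> (X (s i) < X (s j))]].

(* Ranks are counted from 0; truncated subtraction and the bound k < n provide
   the max and min in the definition of the window. *)
Definition window (M : nat) (i : 'I_n) : {set 'I_n} :=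
  [set k : 'I_n | (i - M <= k <= i + M)%N].

(* Bijections of the window W to itself are represented by the permutations of
   'I_n that are the identity outside W, i.e. those satisfying [perm_on W]. *)
Definition window_weight V X Y (W : {set 'I_n}) pi : R :=
  expR (- \sum_(k in W)
    V (n%:R * (X (sorting_perm X k) - Y (sorting_perm Y (pi k))))).

Definition window_law V X Y (W : {set 'I_n}) pi : R :=
  window_weight V X Y W pi /
  \sum_(rho : {perm 'I_n} | perm_on W rho) window_weight V X Y W rho.

Definition phat_sort V X Y (M : nat) (i j : 'I_n) : R :=
  if j \in window M i then
    \sum_(pi : {perm 'I_n} | perm_on (window M i) pi && (pi i == j))
      window_law V X Y (window M i) pi
  else 0.

Definition phat V X Y (M : nat) (i j : 'I_n) : R :=
  phat_sort V X Y M ((sorting_perm X)^-1%g i) ((sorting_perm Y)^-1%g j).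

Definition TV (p q : 'I_n -> R) : R := 2^-1 * \sum_(j < n) `|p j - q j|.

Definition mean_TV V X Y (M : nat) : R :=
  n%:R^-1 * \sum_(i < n) TV (post_marginal V X Y i) (phat V X Y M i).

End Posterior.

(* Main.v *)
(* In sorted and rescaled coordinates x_k = n X_(s k), y_l = n Y_(t l), both the
   posterior and its window version are Gibbs laws of permutations with energy
   sum_k V (x_k - y_(p k)). Two independent permutations, one from each law, that
   have a common cut (an m with k < m iff p k < m) in each of the rank intervals
   [i - M, i] and ]i, i + M] can be swapped between these cuts; the swap preserves
   the product law, so TV at i is at most the probability that some common cut is
   missing.

   Group the points into cells of length h of order L. The expected energy is
   O(n), since half its exponential moment is a quotient of permanents and a
   permanent is at most a product of row sums. As V grows like |e| ^ (1 + delta),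
   Markov's inequality shows that all but a fraction O(L ^ - delta) of the cells
   see only edges too short to cross both their center and their boundary. In a
   cell with at most L / 24 points the remaining crossings of the center involve
   few points, hence they can be removed at a cost in weight of at most
   k! exp (k g): conditionally on everything outside, the cell is cut with
   probability at least exp (- C L g). Since a rank interval of length M = K L
   meets about 24 K sparse cells, either of order K of them are good and the
   chance that none is cut for both laws is (1 - exp (- C L g)) ^ (K / 3), or
   many are bad, which Markov's inequality controls on average over i.

   These bounds only need two facts about the data: sums of powers of the
   distances |x - y| over the pairs and the occupation entropy of the unit cells
   are O(n), and few points lie in dense cells. All are functions of the integer
   parts of n X, n Y, so they are tail bounds for n independent pairs from a law
   on a finite set, whose weights decay geometrically in the distance. *)

(* Cells are not independent under a Gibbs law. Surgery replaces independence: rearranging points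
   inside one cell changes neither the cut at another center nor the locality of its crossings, so
   cells can be peeled off one by one, each costing a mean factor of at most 1 - r. For this, the
   points outside a cell must be on the same side of its center in rank as in space, for [x] and for
   [y]; alignment of the two orders provides it.

   Origin of the rate L ^ - delta: by the growth of V, an edge of energy E spoils at most Q E cells,
   with Q of order L ^ - (1 + delta). A cell is seen from O(M) ranks, and Markov's inequality
   divides by the number N of required cells, of order K. As the energy is O(n), the average is of
   order Q M / N, where M / N <= L.

   Every power kappa is allowed because the exceptional probability is of order n exp (- c n ^ s)
   for some s > 0: displacements have exponential tails, and truncating them at n ^ (1 / (2 q))
   gives a Chernoff bound for their q-th powers. *)
Require Import Defs.
From HB Require Import structures.
From mathcomp Require Import all_boot all_order all_algebra all_fingroup.
From mathcomp Require Import all_classical all_reals all_analysis.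
From mathcomp Require Import measurable_realfun lra ring zify.
Import Order.TTheory GRing.Theory Num.Theory numFieldNormedType.Exports.
Set Implicit Arguments.
Unset Strict Implicit.
Unset Printing Implicit Defensive.
Local Open Scope ring_scope.

(** * Gibbs laws of permutations *)

Section Gibbs.
Context {R : realType} {n : nat}.
Implicit Types (c : 'I_n -> 'I_n -> R) (W : {set 'I_n}) (p t : {perm 'I_n}).

(** One family covers both laws: [W = setT] gives the posterior, a window gives its
    approximation. *)
Definition gibbs_weight c W p : R := expR (- \sum_(k in W) c k (p k)).

Definition gibbs_mass c W : R := \sum_(p | perm_on W p) gibbs_weight c W p.

Definition gibbs c W p : R := gibbs_weight c W p / gibbs_mass c W.

Lemma gibbs_mass_gt0 c W : 0 < gibbs_mass c W.
Proof.
rewrite /gibbs_mass (bigD1 1%g) ?perm_on1 //=.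
by apply: ltr_pwDl; rewrite ?expR_gt0 // sumr_ge0 // => p _; apply: expR_ge0.
Qed.

Lemma gibbs_ge0 c W p : 0 <= gibbs c W p.
Proof. by rewrite divr_ge0 ?expR_ge0 // ltW ?gibbs_mass_gt0. Qed.

Lemma sum_gibbs c W : \sum_(p | perm_on W p) gibbs c W p = 1.
Proof. by rewrite -mulr_suml divff // gt_eqF ?gibbs_mass_gt0. Qed.

(** Expanding the product of row sums gives a sum of nonnegative terms over all functions, and
    permutations are among these. *)
Lemma sum_perm_on_le_prod (h : 'I_n -> 'I_n -> R) W :
  (forall k l, 0 <= h k l) ->
  \sum_(p | perm_on W p) \prod_(k in W) h k (p k)
    <= \prod_(k in W) \sum_l h k l.
Proof.
(* Outside [W] the row becomes the unit mass on the diagonal, so that functions on the whole of 'I_n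
   can be used. *)
move=> h0; pose h' k l : R := if k \in W then h k l else (l == k)%:R.
have h'0 k l : 0 <= h' k l by rewrite /h'; case: ifP => // _; rewrite ler0n.
have -> : \prod_(k in W) \sum_l h k l = \prod_k \sum_l h' k l.
  rewrite [RHS](bigID (mem W)) /= [X in _ * X]big1 ?mulr1.
    by apply: eq_bigr => k kW; apply: eq_bigr => l _; rewrite /h' kW.
  move=> k kW; rewrite (bigD1 k) //= big1 /h' ?(negbTE kW) ?eqxx ?addr0 //.
  by move=> l lk; rewrite /h' ?(negbTE kW) (negbTE lk).
rewrite bigA_distr_bigA /=.
have -> : \sum_(p | perm_on W p) \prod_(k in W) h k (p k) =
    \sum_(p | perm_on W p) \prod_k h' k (pval p k).
  apply: eq_bigr => p pW; rewrite [RHS](bigID (mem W)) /= [X in _ * X]big1 ?mulr1.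
    by apply: eq_bigr => k kW; rewrite /h' kW pvalE.
  by move=> k kW; rewrite /h' (negbTE kW) pvalE (out_perm pW kW) eqxx.
pose D := [set pval p | p : {perm 'I_n} & perm_on W p].
rewrite [leLHS](_ : _ = \sum_(f in D) \prod_k h' k (f k)); last first.
  rewrite big_imset /=; last by move=> p q _ _; apply: val_inj.
  by apply: eq_bigl => p; rewrite inE.
rewrite [leRHS](bigID (mem D)) /= lerDl; apply: sumr_ge0 => f _.
by apply: prodr_ge0.
Qed.

(* Since z <= A + e^(z - A) - 1, an exponential moment bounds the mean energy;
   the exponential moment of half the energy is a quotient of permanents. *)
Lemma gibbs_energy c W : (forall k l, 0 <= c k l) ->
  \sum_(p | perm_on W p) gibbs c W p * \sum_(k in W) c k (p k)
  <= 2 * \sum_(k in W) (ln (1 + \sum_l expR (- (c k l / 2))) + c k k).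
Proof.
move=> c0; set A := \sum_(k in W) (_ + _).
have r0 k : 0 <= \sum_l expR (- (c k l / 2)).
  by apply: sumr_ge0 => l _; apply: expR_ge0.
have half : \sum_(p | perm_on W p)
    gibbs c W p * expR ((\sum_(k in W) c k (p k)) / 2) <= expR A.
  have -> : \sum_(p | perm_on W p)
      gibbs c W p * expR ((\sum_(k in W) c k (p k)) / 2) =
      (\sum_(p | perm_on W p) \prod_(k in W) expR (- (c k (p k) / 2)))
        / gibbs_mass c W.
    rewrite mulr_suml; apply: eq_bigr => p _.
    rewrite /gibbs mulrAC /gibbs_weight -expRD -expR_sum sumrN -mulr_suml.
    by congr (expR _ / _); lra.
  rewrite ler_pdivrMr ?gibbs_mass_gt0 //.
  apply: (le_trans (@sum_perm_on_le_prod (fun k l => expR (- (c k l / 2))) W _)).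
    by move=> k l; apply: expR_ge0.
  (* The identity alone bounds the mass from below; this is the source of the diagonal costs
     [c k k]. *)
  have Zge : expR (- \sum_(k in W) c k k) <= gibbs_mass c W.
    rewrite /gibbs_mass (bigD1 1%g) ?perm_on1 //= /gibbs_weight.
    have -> : \sum_(k in W) c k ((1%g : {perm 'I_n}) k) = \sum_(k in W) c k k.
      by apply: eq_bigr => k _; rewrite perm1.
    by rewrite lerDl sumr_ge0 // => p _; apply: expR_ge0.
  apply: le_trans (ler_wpM2l (expR_ge0 _) Zge).
  rewrite -expRD /A big_split /= addrK expR_sum.
  apply: ler_prod => k kW; rewrite r0 /= lnK ?posrE; first by rewrite lerDr.
  by have := r0 k; lra.
have -> : 2 * A = \sum_(p | perm_on W p) gibbs c W p * (2 * (A - 1)) + 2.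
  by rewrite -mulr_suml sum_gibbs; lra.
apply: (@le_trans _ _ (\sum_(p | perm_on W p) gibbs c W p * (2 * (A - 1)) +
  2 / expR A * \sum_(p | perm_on W p)
    gibbs c W p * expR ((\sum_(k in W) c k (p k)) / 2))).
  rewrite mulr_sumr -big_split /=; apply: ler_sum => p _.
  set E := \sum_(k in W) _.
  rewrite [X in _ <= _ + X]mulrCA -mulrDr ler_wpM2l ?gibbs_ge0 //.
  have := expR_ge1Dx (E / 2 - A); rewrite expRD expRN => h.
  have -> : 2 / expR A * expR (E / 2) = 2 * (expR (E / 2) / expR A).
    by rewrite mulrAC mulrA.
  lra.
rewrite lerD2l -mulrA -[leRHS]mulr1 ler_pM2l // mulrC.
by rewrite ler_pdivrMr ?expR_gt0 // mul1r.
Qed.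

End Gibbs.

(** * Swapping two samples between common cuts *)

Section Swap.
Context {R : realType} {n : nat}.
Implicit Types (c : 'I_n -> 'I_n -> R) (W S : {set 'I_n}) (p q t : {perm 'I_n}).

(** The default [p] is reached only if the glued map is not injective, which cannot happen when [p]
    and [q] both preserve [S]. *)
Definition swap_on S p q : {perm 'I_n} :=
  insubd p [ffun k => if k \in S then q k else p k].

Lemma swap_onE S p q k :
  (forall j, (p j \in S) = (j \in S)) -> (forall j, (q j \in S) = (j \in S)) ->
  swap_on S p q k = if k \in S then q k else p k.
Proof.
move=> pS qS; rewrite -pvalE /swap_on.
have inj : injectiveb [ffun j => if j \in S then q j else p j].
  apply/injectiveP => j l; rewrite !ffunE.
  have [jS|jS] := boolP (j \in S); have [lS|lS] := boolP (l \in S).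
  - exact: perm_inj.
  - by move=> e; move: lS; rewrite -pS -e qS jS.
  - by move=> e; move: jS; rewrite -pS e qS lS.
  - exact: perm_inj.
by rewrite (val_insubd p) inj ffunE.
Qed.

Definition marginal c W (i j : 'I_n) : R :=
  \sum_(p | perm_on W p && (p i == j)) gibbs c W p.

(** Exchanging [p] and [q] on [S p q] is an involution, because [S] is unchanged by it, and it
    preserves the product law, because [S] lies in both windows and the total energy of the pair is
    the same. It turns [p i] into [q i] whenever [i] is in [S], so only the pairs with [i] outside
    [S] separate the marginals. *)
Lemma TV_swap c W1 W2 (S : {perm 'I_n} -> {perm 'I_n} -> {set 'I_n}) i :
  (forall p q, S p q \subset W1 :&: W2) ->
  (forall p q k, (p k \in S p q) = (k \in S p q)) ->
  (forall p q k, (q k \in S p q) = (k \in S p q)) ->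
  (forall p q, S (swap_on (S p q) p q) (swap_on (S p q) q p) = S p q) ->
  TV (marginal c W1 i) (marginal c W2 i) <=
  \sum_(p | perm_on W1 p) \sum_(q | perm_on W2 q)
    gibbs c W1 p * gibbs c W2 q * (i \notin S p q)%:R.
Proof.
move=> SW Sp Sq Sinv.
pose T := ({perm 'I_n} * {perm 'I_n})%type.
pose phi (u : T) : T :=
  (swap_on (S u.1 u.2) u.1 u.2, swap_on (S u.1 u.2) u.2 u.1).
have phi1 u k : (phi u).1 k = if k \in S u.1 u.2 then u.2 k else u.1 k.
  by rewrite swap_onE.
have phi2 u k : (phi u).2 k = if k \in S u.1 u.2 then u.1 k else u.2 k.
  by rewrite swap_onE.
have phiK : involutive phi.
  move=> [p q]; rewrite /phi /= Sinv.
  have h1 j : (swap_on (S p q) p q j \in S p q) = (j \in S p q).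
    by rewrite swap_onE //; case: ifP => jS; rewrite ?Sp ?Sq jS.
  have h2 j : (swap_on (S p q) q p j \in S p q) = (j \in S p q).
    by rewrite swap_onE //; case: ifP => jS; rewrite ?Sp ?Sq jS.
  congr pair; apply/permP => k; rewrite !swap_onE //;
    by case: ifP => kS; rewrite ?kS.
pose on (u : T) := perm_on W1 u.1 && perm_on W2 u.2.
have SW1 u k : k \in S u.1 u.2 -> k \in W1.
  by move=> /(fintype.subsetP (SW _ _)); rewrite inE => /andP[].
have SW2 u k : k \in S u.1 u.2 -> k \in W2.
  by move=> /(fintype.subsetP (SW _ _)); rewrite inE => /andP[].
have onphi u : on u -> on (phi u).
  move=> /andP[p1 p2]; apply/andP; split; apply/fintype.subsetP => k.
    rewrite inE phi1; case: ifP => [kS _|_]; first exact: SW1 kS.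
    by move=> pk; apply: (fintype.subsetP p1); rewrite inE.
  rewrite inE phi2; case: ifP => [kS _|_]; first exact: SW2 kS.
  by move=> pk; apply: (fintype.subsetP p2); rewrite inE.
have {}onphi u : on (phi u) = on u.
  by apply/idP/idP => /onphi; rewrite ?phiK.
pose mu u : R := (on u)%:R * (gibbs c W1 u.1 * gibbs c W2 u.2).
have muphi u : mu (phi u) = mu u.
  rewrite /mu onphi /gibbs !mulf_div; congr (_ * (_ / _)).
  rewrite /gibbs_weight -!expRD -!opprD; congr (expR (- _)).
  rewrite (bigID (mem (S u.1 u.2))) [X in _ + X = _](bigID (mem (S u.1 u.2))) /=.
  rewrite [in RHS](bigID (mem (S u.1 u.2))) /= [X in _ = _ + X](bigID (mem (S u.1 u.2))) /=.
  have inW1 F : \sum_(k in W1 | k \in S u.1 u.2) F k = \sum_(k in S u.1 u.2) F k :> R.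
    apply: eq_bigl => k; have [kS|] := boolP (k \in S u.1 u.2); last by rewrite andbF.
    by rewrite (SW1 _ _ kS).
  have inW2 F : \sum_(k in W2 | k \in S u.1 u.2) F k = \sum_(k in S u.1 u.2) F k :> R.
    apply: eq_bigl => k; have [kS|] := boolP (k \in S u.1 u.2); last by rewrite andbF.
    by rewrite (SW2 _ _ kS).
  rewrite !inW1 !inW2.
  have -> : \sum_(k in S u.1 u.2) c k ((phi u).1 k) = \sum_(k in S u.1 u.2) c k (u.2 k).
    by apply: eq_bigr => k kS; rewrite phi1 kS.
  have -> : \sum_(k in S u.1 u.2) c k ((phi u).2 k) = \sum_(k in S u.1 u.2) c k (u.1 k).
    by apply: eq_bigr => k kS; rewrite phi2 kS.
  have -> : \sum_(k in W1 | k \notin S u.1 u.2) c k ((phi u).1 k) =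
            \sum_(k in W1 | k \notin S u.1 u.2) c k (u.1 k).
    by apply: eq_bigr => k /andP[_ /negbTE kS]; rewrite phi1 kS.
  have -> : \sum_(k in W2 | k \notin S u.1 u.2) c k ((phi u).2 k) =
            \sum_(k in W2 | k \notin S u.1 u.2) c k (u.2 k).
    by apply: eq_bigr => k /andP[_ /negbTE kS]; rewrite phi2 kS.
  ring.
have mu0 u : 0 <= mu u.
  by apply: mulr_ge0; [exact: ler0n|apply: mulr_ge0; exact: gibbs_ge0].
have sum_mu (F : T -> R) : \sum_u mu u * F u =
    \sum_(p | perm_on W1 p) \sum_(q | perm_on W2 q)
      gibbs c W1 p * gibbs c W2 q * F (p, q).
  rewrite pair_big /= [RHS]big_mkcond /=; apply: eq_bigr => -[p q] _.
  by rewrite /mu /on /=; case: ifP => _; rewrite ?mul1r ?mul0r.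
have marg1 j : marginal c W1 i j = \sum_u mu u * (u.1 i == j)%:R.
  rewrite sum_mu /marginal big_mkcondr /=; apply: eq_bigr => p _.
  rewrite -mulr_suml -mulr_sumr sum_gibbs mulr1.
  by case: eqP; rewrite ?mulr1 ?mulr0.
have marg2 j : marginal c W2 i j = \sum_u mu u * (u.2 i == j)%:R.
  rewrite sum_mu /marginal exchange_big big_mkcondr /=; apply: eq_bigr => q _.
  rewrite -mulr_suml -mulr_suml sum_gibbs mul1r.
  by case: eqP; rewrite ?mulr1 ?mulr0.
(* After reindexing the first marginal by the swap, the terms with [i] in [S] cancel exactly. *)
have diff j : marginal c W1 i j - marginal c W2 i j =
    \sum_u mu u * (i \notin S u.1 u.2)%:R * ((u.1 i == j)%:R - (u.2 i == j)%:R).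
  rewrite marg1 marg2 (reindex_inj (inv_inj phiK)) /= -sumrB; apply: eq_bigr => u _.
  rewrite muphi phi1; case: ifP => _ /=; last by rewrite mulr1 mulrBr.
  by rewrite subrr mulr0 mul0r.
have mu0i u : 0 <= mu u * (i \notin S u.1 u.2)%:R.
  by apply: mulr_ge0; [exact: mu0|exact: ler0n].
rewrite /TV -(sum_mu (fun u => (i \notin S u.1 u.2)%:R)).
rewrite ler_pdivrMl //.
apply: (@le_trans _ _ (\sum_j \sum_u mu u * (i \notin S u.1 u.2)%:R *
    ((u.1 i == j)%:R + (u.2 i == j)%:R))).
  apply: ler_sum => j _; rewrite diff; apply: (le_trans (ler_norm_sum _ _ _)).
  apply: ler_sum => u _; rewrite normrM ger0_norm ?mu0i //.
  rewrite ler_wpM2l ?mu0i //.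
  rewrite ler_norml; case: (u.1 i == j); case: (u.2 i == j) => /=;
    by apply/andP; split; lra.
rewrite exchange_big mulr_sumr /=; apply: ler_sum => u _.
rewrite -mulr_sumr mulrC ler_wpM2r ?mu0i //.
rewrite big_split /=.
have sum1 (a : 'I_n) : \sum_j (a == j)%:R = 1 :> R.
  rewrite (bigD1 a) //= eqxx big1 ?addr0 // => j /negbTE.
  by rewrite eq_sym => ->.
by rewrite !sum1; lra.
Qed.

Definition cut p (m : nat) : bool := [forall k : 'I_n, (k < m)%N == (p k < m)%N].

Lemma cutP p m : reflect (forall k : 'I_n, (k < m)%N = (p k < m)%N) (cut p m).
Proof.
apply: (iffP forallP) => h k.
  exact: (eqP (h k)).
exact/eqP/h.
Qed.

(** Take for [S] all ranks lying between some common cut in [L] and some common cut in [U].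
    Membership depends only on the side of common cuts, which [p] and [q] preserve, and the swapped
    pair has the same common cuts; so [S] qualifies for [TV_swap] without a choice of cuts. *)
Lemma TV_common_cut c W1 W2 (L U : pred 'I_n.+1) (i : 'I_n) :
  (forall m, L m -> (m <= i)%N) -> (forall m, U m -> (i < m)%N) ->
  (forall m m' (k : 'I_n), L m -> U m' -> (m <= k < m')%N -> k \in W1 :&: W2) ->
  TV (marginal c W1 i) (marginal c W2 i) <=
  \sum_(p | perm_on W1 p) \sum_(q | perm_on W2 q) gibbs c W1 p * gibbs c W2 q *
      [forall m, L m ==> ~~ (cut p m && cut q m)]%:R +
  \sum_(p | perm_on W1 p) \sum_(q | perm_on W2 q) gibbs c W1 p * gibbs c W2 q *
      [forall m, U m ==> ~~ (cut p m && cut q m)]%:R.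
Proof.
move=> Li Ui LUW.
pose S p q := [set k : 'I_n |
  [exists m, [&& L m, cut p m, cut q m & (m <= k)%N]] &&
  [exists m, [&& U m, cut p m, cut q m & (k < m)%N]]].
have Scut p q (k l : 'I_n) : (forall m : nat, cut p m -> cut q m -> (k < m)%N = (l < m)%N) ->
    (k \in S p q) = (l \in S p q).
  move=> h; rewrite !inE; congr (_ && _); apply: eq_existsb => m;
    case: (L m) => //=; case: (U m) => //=; case pm: (cut p m) => //=;
    case qm: (cut q m) => //=; first [exact: h|by rewrite ![(m <= _)%N]leqNgt h].
have Sp p q (k : 'I_n) : (p k \in S p q) = (k \in S p q).
  by apply: Scut => m /cutP h _; rewrite -h.
have Sq p q (k : 'I_n) : (q k \in S p q) = (k \in S p q).
  by apply: Scut => m _ /cutP h; rewrite -h.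
have SW p q : S p q \subset W1 :&: W2.
  apply/fintype.subsetP => k; rewrite [k \in S p q]inE.
  case/andP=> /existsP[m /and4P[Lm _ _ mk]] /existsP[m' /and4P[Um _ _ km]].
  by apply: (LUW m m') => //; rewrite mk km.
have cutS p q p' q' (m : nat) :
    (forall k : 'I_n, p' k = p k \/ p' k = q k) -> (forall k : 'I_n, q' k = p k \/ q' k = q k) ->
    cut p m -> cut q m -> cut p' m /\ cut q' m.
  move=> h h' /cutP pm /cutP qm; split; apply/cutP => k.
    by case: (h k) => ->; rewrite -?pm -?qm.
  by case: (h' k) => ->; rewrite -?pm -?qm.
have Sinv p q : S (swap_on (S p q) p q) (swap_on (S p q) q p) = S p q.
  have e m : (cut (swap_on (S p q) p q) m && cut (swap_on (S p q) q p) m) =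
      (cut p m && cut q m).
    apply/andP/andP => -[pm qm].
      apply: cutS pm qm => k; rewrite !swap_onE //; case: ifP => _; tauto.
    by apply: cutS pm qm => k; rewrite swap_onE //; case: ifP => _; tauto.
  apply/setP => k; rewrite [LHS]inE [RHS]inE; congr (_ && _); apply: eq_existsb => m;
    by congr (_ && _); rewrite !andbA e.
apply: (le_trans (TV_swap c i SW Sp Sq Sinv)).
rewrite -big_split /=; apply: ler_sum => p _; rewrite -big_split /=.
apply: ler_sum => q _; rewrite -mulrDr.
apply: ler_wpM2l; first by apply: mulr_ge0; exact: gibbs_ge0.
have [_|/forallPn[m]] := boolP [forall m, L m ==> ~~ (cut p m && cut q m)].
  by case: (i \notin S p q); case: [forall m, U m ==> _] => /=; lra.
have [_ _|/forallPn[m']] := boolP [forall m, U m ==> ~~ (cut p m && cut q m)].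
  by rewrite add0r ler_nat leq_b1.
rewrite negb_imply negbK => /andP[Um' /andP[pm' qm']].
rewrite negb_imply negbK => /andP[Lm /andP[pm qm]].
suff -> : i \in S p q by rewrite /= addr0.
rewrite inE; apply/andP; split; apply/existsP; [exists m|exists m'].
  by rewrite Lm pm qm Li.
by rewrite Um' pm' qm' Ui.
Qed.

End Swap.

(** * Uncrossing surgery *)

Section Surgery.
Context {R : realType} {n : nat}.
Implicit Types (c : 'I_n -> 'I_n -> R) (W : {set 'I_n}) (p q t : {perm 'I_n}).

Definition crosses p (m : nat) (k : 'I_n) : bool := (k < m)%N != (p k < m)%N.

Lemma card_perm_lt p (m : nat) :
  #|[set k | (p k < m)%N]| = #|[set k : 'I_n | (k < m)%N]|.
Proof.
have -> : [set k | (p k < m)%N] = p^-1%g @: [set k : 'I_n | (k < m)%N].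
  by rewrite im_permV; apply/setP => k; rewrite !inE.
by rewrite card_imset //; apply: perm_inj.
Qed.

(** The ranks below m and their preimage have the same cardinality, so an inclusion between them is
    an equality. *)
Lemma cut_of_up p (m : nat) :
  (forall k : 'I_n, (k < m)%N -> (p k < m)%N) -> cut p m.
Proof.
move=> h; have e : [set k : 'I_n | (k < m)%N] = [set k | (p k < m)%N].
  apply/eqP; rewrite eqEcard card_perm_lt leqnn andbT.
  by apply/fintype.subsetP => k; rewrite !inE; exact: h.
by apply/cutP => k; move/setP/(_ k): e; rewrite !inE.
Qed.

Lemma cut_of_down p (m : nat) :
  (forall k : 'I_n, (p k < m)%N -> (k < m)%N) -> cut p m.
Proof.
move=> h; have e : [set k | (p k < m)%N] = [set k : 'I_n | (k < m)%N].
  apply/eqP; rewrite eqEcard card_perm_lt leqnn andbT.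
  by apply/fintype.subsetP => k; rewrite !inE; exact: h.
by apply/cutP => k; move/setP/(_ k): e; rewrite !inE.
Qed.

(* The transposition of an upward and a downward crossing point removes both
   crossings. *)
Lemma uncross p (m : nat) :
  exists t, cut (t * p)%g m /\ forall k, t k != k -> crosses p m k.
Proof.
have [N] := ubnP #|[set k | crosses p m k]|; elim: N p => // N IH p ltN.
have [pm|npm] := boolP (cut p m).
  by exists 1%g; rewrite mul1g; split=> // k; rewrite perm1 eqxx.
have [u um pum] : exists2 u : 'I_n, (u < m)%N & ~~ (p u < m)%N.
  have [/existsP[u /andP[]]|/existsPn h] :=
    boolP [exists u : 'I_n, (u < m)%N && ~~ (p u < m)%N]; first by exists u.
  by case/negP: npm; apply: cut_of_up => k km; move: (h k); rewrite km negbK.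
have [v pvm vm] : exists2 v : 'I_n, (p v < m)%N & ~~ (v < m)%N.
  have [/existsP[u' /andP[]]|/existsPn h] :=
    boolP [exists u : 'I_n, (p u < m)%N && ~~ (u < m)%N]; first by exists u'.
  by case/negP: npm; apply: cut_of_down => k km; move: (h k); rewrite km negbK.
pose p' := (tperm u v * p)%g.
have p'u : p' u = p v by rewrite permM tpermL.
have p'v : p' v = p u by rewrite permM tpermR.
have p'k k : k != u -> k != v -> p' k = p k.
  by move=> ku kv; rewrite permM tpermD // eq_sym.
have cu : crosses p m u by rewrite /crosses um (negbTE pum).
have cv : crosses p m v by rewrite /crosses pvm (negbTE vm).
have cu' : ~~ crosses p' m u by rewrite /crosses p'u um pvm.
have cv' : ~~ crosses p' m v by rewrite /crosses p'v (negbTE vm) (negbTE pum).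
have sub k : crosses p' m k -> crosses p m k.
  have [->|ku] := eqVneq k u; first by rewrite (negbTE cu').
  have [->|kv] := eqVneq k v; first by rewrite (negbTE cv').
  by rewrite /crosses p'k.
have [|t [tp' tk]] := IH p'.
  rewrite -ltnS (leq_trans _ ltN) // ltnS; apply: proper_card.
  apply/fintype.properP; split; first by apply/fintype.subsetP => k; rewrite !inE; exact: sub.
  by exists u; rewrite inE.
exists (t * tperm u v)%g; rewrite -mulgA; split=> // k.
have [tkk|tkk _] := eqVneq (t k) k; last exact/sub/tk.
rewrite permM tkk; have [->|ku] := eqVneq k u; first by rewrite cu.
have [->|kv] := eqVneq k v; first by rewrite cv.
by rewrite tpermD 1?eq_sym // eqxx.
Qed.

(** The event that the crossings at m can be repaired without touching anything outside the cell. *)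
Definition local_crossings p (m : nat) (Sx Sy : {set 'I_n}) : bool :=
  [forall k, crosses p m k ==> (k \in Sx) && (p k \in Sy)].

Lemma local_crossingsP p (m : nat) (Sx Sy : {set 'I_n}) :
  reflect (forall k : 'I_n, crosses p m k -> k \in Sx /\ p k \in Sy)
    (local_crossings p m Sx Sy).
Proof.
apply: (iffP forallP) => h k; first by move=> ck; apply/andP/(implyP (h k)).
by apply/implyP => /h/andP.
Qed.

Lemma cut_local p (m : nat) (Sx Sy : {set 'I_n}) : cut p m -> local_crossings p m Sx Sy.
Proof.
by move=> /cutP pm; apply/local_crossingsP => k; rewrite /crosses -pm eqxx.
Qed.

(** The edges before and after the change join [Sx] to [Sy]. So each new edge has bounded cost, and
    the change is invisible from the centers of other cells. *)
Definition inner_change (Sx Sy : {set 'I_n}) p t : Prop :=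
  forall k, t k != k -> [/\ k \in Sx, p k \in Sy & p (t k) \in Sy].

(** Uncrossing maps a permutation with local crossings to one that is cut. At most #|Sx| edges
    change, each for a cost at most G, and a permutation has at most #|Sx|! preimages, since the
    change is a permutation of [Sx]. The observable [F] does not see the surgery, so the estimate
    holds conditionally on the other cells. *)
Lemma gibbs_surgery c W (m : nat) (Sx Sy : {set 'I_n}) (G : R)
    (F : {perm 'I_n} -> R) :
  (forall k l, 0 <= c k l) -> 0 <= G ->
  (forall k l, k \in Sx -> l \in Sy -> c k l <= G) ->
  (forall p, 0 <= F p) ->
  (forall p t, inner_change Sx Sy p t -> F (t * p)%g = F p) ->
  \sum_(p | perm_on W p) gibbs c W p * F p * (local_crossings p m Sx Sy)%:R <=
  (#|Sx|)`!%:R * expR (#|Sx|%:R * G) *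
    \sum_(p | perm_on W p) gibbs c W p * F p * (cut p m)%:R.
Proof.
move=> c0 G0 cG F0 Finv.
pose A p := (perm_on W p)%:R * (gibbs c W p * F p * (cut p m)%:R).
have A0 p : 0 <= A p.
  by rewrite /A !(gibbs_ge0, ler0n, mulr_ge0).
have -> : \sum_(p | perm_on W p) gibbs c W p * F p * (cut p m)%:R = \sum_p A p.
  rewrite big_mkcond; apply: eq_bigr => p _; rewrite /A.
  by case: ifP; rewrite ?mul1r ?mul0r.
(* The change [t] depends on [p]; bounding by the sum over all [t] supported in [Sx] replaces the
   count of preimages. *)
have step p : perm_on W p ->
    gibbs c W p * F p * (local_crossings p m Sx Sy)%:R <=
    expR (#|Sx|%:R * G) * \sum_(t | perm_on Sx t) A (t * p)%g.
  move=> pW; have [/local_crossingsP good|_] := boolP (local_crossings _ _ _ _);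
    last by rewrite mulr0 mulr_ge0 ?expR_ge0 // sumr_ge0.
  have [t [tcut tcr]] := uncross p m.
  have tin : inner_change Sx Sy p t.
    move=> k tk; have [kS pkS] := good _ (tcr _ tk).
    (* If [t] moves [k], it also moves [t k], whose edge is therefore a crossing and ends in
       [Sy]. *)
    split=> //; have [|_ ->//] := good (t k).
    by apply: tcr; apply: contra_neq tk => /perm_inj.
  have tS : perm_on Sx t.
    by apply/fintype.subsetP => k; rewrite inE => /tin[].
  have tW : perm_on W t.
    apply/fintype.subsetP => k; rewrite inE => /tcr; apply: contraLR => kW.
    by rewrite /crosses (out_perm pW kW) eqxx.
  rewrite (bigD1 t) //=; apply: (@le_trans _ _ (expR (#|Sx|%:R * G) * A (t * p)%g));
    last by rewrite ler_wpM2l ?expR_ge0 // lerDl sumr_ge0.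
  rewrite /A tcut (perm_onM tW pW) mul1r !mulr1 (Finv _ _ tin) mulrA.
  rewrite ler_wpM2r // /gibbs mulrA ler_wpM2r ?invr_ge0 ?(ltW (gibbs_mass_gt0 _ _)) //.
  rewrite /gibbs_weight -expRD ler_expR.
  suff : \sum_(k in W) c k ((t * p)%g k) <= \sum_(k in W) c k (p k) + #|Sx|%:R * G.
    by lra.
  apply: (@le_trans _ _ (\sum_(k in W) (c k (p k) + (k \in Sx)%:R * G))).
    apply: ler_sum => k kW; rewrite permM.
    have [->|/tin[kS pkS ptS]] := eqVneq (t k) k.
      by rewrite lerDl mulr_ge0.
    by rewrite kS mul1r (le_trans (cG _ _ kS ptS)) // lerDr.
  rewrite big_split /= lerD2l -mulr_suml ler_wpM2r // -natr_sum ler_nat.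
  rewrite -sum1_card [leqRHS]big_mkcond [leqLHS]big_mkcond /=; apply: leq_sum => k _.
  by case: (k \in W); case: (k \in Sx).
apply: (@le_trans _ _ (\sum_(p | perm_on W p)
    expR (#|Sx|%:R * G) * \sum_(t | perm_on Sx t) A (t * p)%g)); first exact: ler_sum.
rewrite -mulr_sumr mulrAC -[leRHS]mulrA [leRHS]mulrCA; rewrite mulrA.
rewrite [leRHS](_ : _ = expR (#|Sx|%:R * G) * ((#|Sx|)`!%:R * \sum_p A p)); last by ring.
rewrite ler_wpM2l ?expR_ge0 //.
apply: (@le_trans _ _ (\sum_p \sum_(t | perm_on Sx t) A (t * p)%g)).
  rewrite [leRHS](bigID (perm_on W)) /= lerDl; apply: sumr_ge0 => p _.
  by apply: sumr_ge0.
rewrite exchange_big /= (eq_bigr (fun=> \sum_p A p)) => [|t _]; last first.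
  by rewrite [RHS](reindex_inj (mulgI t)).
rewrite sumr_const -[leLHS]mulr_natl.
by rewrite (_ : #|_| = (#|Sx|)`!) //; exact: card_perm.
Qed.

End Surgery.

(** * Common cuts in many blocks *)

Section Blocks.
Context {R : realType} {n : nat} {B : eqType}.
Variables (c : 'I_n -> 'I_n -> R) (W1 W2 : {set 'I_n}).
Variables (m : B -> nat) (Sx Sy : B -> {set 'I_n}) (G r : R).
Implicit Types (p q t : {perm 'I_n}) (b : B) (s : seq B).

Let good p b := local_crossings p (m b) (Sx b) (Sy b).
Let good2 p q b := good p b && good q b.
Let cut2 p q b := cut p (m b) && cut q (m b).

(** Where both samples can be repaired, this indicates a missing common cut; elsewhere it is the
    constant 1 - r, so that every block costs at most 1 - r in mean, repairable or not. *)
Let factor p q b : R := if good2 p q b then (~~ cut2 p q b)%:R else 1 - r.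

Hypotheses (c0 : forall k l, 0 <= c k l) (G0 : 0 <= G).
Hypotheses (r0 : 0 < r) (r1 : r < 1).

(** The cost is squared because both samples are repaired. The last clause makes the edges of one
    block invisible at the centers of the others. *)
Let block_ok s := forall b, b \in s ->
  [/\ forall k l, k \in Sx b -> l \in Sy b -> c k l <= G,
      r * ((#|Sx b|)`!%:R * expR (#|Sx b|%:R * G)) ^+ 2 <= 1 &
      forall b', b' \in s -> b' != b ->
        forall k l : 'I_n, k \in Sx b -> l \in Sy b -> (k < m b')%N = (l < m b')%N].

Lemma inner_change_cut s b b' p t : block_ok s -> b \in s -> b' \in s -> b' != b ->
  inner_change (Sx b) (Sy b) p t ->
  good (t * p)%g b' = good p b' /\ cut (t * p)%g (m b') = cut p (m b').
Proof.
move=> ok bs b's bb tin; have [_ _ /(_ _ b's bb) nc] := ok b bs.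
have e (k : 'I_n) : (t * p)%g k = p k \/
    ((k < m b')%N = (p k < m b')%N /\ (k < m b')%N = ((t * p)%g k < m b')%N).
  rewrite permM; have [->|/tin[kS pkS ptS]] := eqVneq (t k) k; [by left|right].
  by split; apply: nc.
split.
  apply: eq_forallb => k; rewrite /crosses.
  by case: (e k) => [->//|[<- <-]]; rewrite !eqxx.
by apply: eq_forallb => k; case: (e k) => [->//|[<- <-]]; rewrite !eqxx.
Qed.

(** Induction on the blocks: a surgery in the first block does not change the product [H] of the
    other factors, which is then the observable of [gibbs_surgery]. *)
Lemma sum_factor_le s : uniq s -> block_ok s ->
  \sum_(p | perm_on W1 p) \sum_(q | perm_on W2 q)
    gibbs c W1 p * gibbs c W2 q * \prod_(b <- s) factor p q b
  <= (1 - r) ^+ size s.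
Proof.
elim: s => [_ _|b s IH /= /andP[bs us] ok].
  rewrite expr0 [leLHS](_ : _ = 1) //.
  rewrite (eq_bigr (gibbs c W1)) ?sum_gibbs // => p _.
  rewrite (eq_bigr (fun q => gibbs c W1 p * gibbs c W2 q)) => [|q _].
    by rewrite -mulr_sumr sum_gibbs mulr1.
  by rewrite big_nil mulr1.
have {IH} := IH us; have oks : block_ok s.
  move=> b1 b1s; have [h1 h2 h3] := ok b1 (mem_behead (s := b :: s) b1s).
  by split=> // b' b's; apply: h3; rewrite inE b's orbT.
move=> /(_ oks); set H := fun p q => \prod_(b <- s) factor p q b.
have r1' : 0 <= 1 - r by rewrite subr_ge0 ltW.
have f0 p q b' : 0 <= factor p q b' by rewrite /factor; case: ifP.
have H0 p q : 0 <= H p q by apply: prodr_ge0.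
have [cG rG _] := ok b (mem_head _ _).
set K := (#|Sx b|)`!%:R * expR (#|Sx b|%:R * G) in rG.
have K0 : 0 <= K by rewrite mulr_ge0 ?ler0n ?expR_ge0.
have finv p q t u : inner_change (Sx b) (Sy b) p t ->
    inner_change (Sx b) (Sy b) q u ->
    H (t * p)%g (u * q)%g = H p q.
  move=> tin uin; rewrite /H !big_seq; apply: eq_bigr => b' b's.
  have b'n : b' != b by apply: contraNneq bs => <-.
  have b'in : b' \in b :: s by rewrite inE b's orbT.
  have [e1 e2] := inner_change_cut ok (mem_head _ _) b'in b'n tin.
  have [e3 e4] := inner_change_cut ok (mem_head _ _) b'in b'n uin.
  by rewrite /factor /good2 /cut2 e1 e2 e3 e4.
have id_in p : inner_change (Sx b) (Sy b) p 1%g by move=> k; rewrite perm1 eqxx.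
pose E (F : {perm 'I_n} -> {perm 'I_n} -> R) :=
  \sum_(p | perm_on W1 p) \sum_(q | perm_on W2 q) gibbs c W1 p * gibbs c W2 q * F p q.
have ED a F1 F2 : E (fun p q => a * F1 p q + F2 p q) = a * E F1 + E F2.
  rewrite /E mulr_sumr -big_split; apply: eq_bigr => p _ /=.
  by rewrite mulr_sumr -big_split; apply: eq_bigr => q _ /=; ring.
(* First [q] is repaired with [p] fixed, then [p] with [q] already cut; each repair costs a factor
   [K]. *)
have two : E (fun p q => H p q * (good2 p q b)%:R) <=
    K ^+ 2 * E (fun p q => H p q * (cut2 p q b)%:R).
  apply: (@le_trans _ _ (K * E (fun p q => H p q * (good p b)%:R * (cut q (m b))%:R))).
    rewrite /E mulr_sumr; apply: ler_sum => p pW.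
    have := @gibbs_surgery _ _ c W2 (m b) (Sx b) (Sy b) G
      (fun q => gibbs c W1 p * (H p q * (good p b)%:R)) c0 G0 cG.
    rewrite -/K => hs.
    apply: le_trans (le_trans (hs _ _) _).
    - apply: ler_sum => q _; rewrite /good2 /good -mulnb natrM.
      rewrite le_eqVlt; apply/orP; left; apply/eqP; ring.
    - by move=> q; rewrite !(gibbs_ge0, ler0n, mulr_ge0).
    - by move=> q t tin; rewrite -(finv p q 1%g t) // mul1g.
    - rewrite le_eqVlt; apply/orP; left; apply/eqP; congr (_ * _).
      by apply: eq_bigr => q _; ring.
  rewrite expr2 -mulrA ler_wpM2l // /E exchange_big [X in _ * X]exchange_big /=.
  rewrite mulr_sumr; apply: ler_sum => q qW.
  have := @gibbs_surgery _ _ c W1 (m b) (Sx b) (Sy b) G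
      (fun p => gibbs c W2 q * (H p q * (cut q (m b))%:R)) c0 G0 cG.
  rewrite -/K => hs.
  apply: le_trans (le_trans (hs _ _) _).
  - apply: ler_sum => p _; rewrite /good.
    rewrite le_eqVlt; apply/orP; left; apply/eqP; ring.
  - by move=> p; rewrite !(gibbs_ge0, ler0n, mulr_ge0).
  - by move=> p t tin; rewrite -(finv p q t 1%g) // mul1g.
  - rewrite le_eqVlt; apply/orP; left; apply/eqP; congr (_ * _).
    by apply: eq_bigr => p _; rewrite /cut2 -mulnb natrM; ring.
move=> IH; rewrite -/(E _).
(* Since a cut has no crossings at all, [cut2] implies [good2], and the factor is 1 - r + r [good2]
   - [cut2]. *)
have -> : E (fun p q => \prod_(b <- b :: s) factor p q b) =
    (1 - r) * E H + (r * E (fun p q => H p q * (good2 p q b)%:R)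
                     + (-1 * E (fun p q => H p q * (cut2 p q b)%:R) + 0)).
  have -> : 0 = E (fun _ _ => 0).
    by rewrite /E big1 // => p _; rewrite big1 // => q _; rewrite mulr0.
  rewrite -!ED; apply: eq_bigr => p _; apply: eq_bigr => q _; congr (_ * _).
  rewrite big_cons -/(H p q) /factor /cut2 /good2.
  have [pm|pm] := boolP (cut p (m b)); have [qm|qm] := boolP (cut q (m b)) => /=;
    rewrite ?/good ?(cut_local _ _ pm) ?(cut_local _ _ qm) /=;
    try (case: (local_crossings _ _ _ _)); try (case: (local_crossings _ _ _ _));
    rewrite /=; ring.
have : r * E (fun p q => H p q * (good2 p q b)%:R) <=
       E (fun p q => H p q * (cut2 p q b)%:R).
  apply: (le_trans (ler_wpM2l (ltW r0) two)).
  rewrite mulrA ler_piMl //.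
  apply: sumr_ge0 => p _; apply: sumr_ge0 => q _.
  by rewrite !(gibbs_ge0, ler0n, mulr_ge0).
have : (1 - r) * E H <= (1 - r) * (1 - r) ^+ size s by rewrite ler_wpM2l.
rewrite exprS; lra.
Qed.

(** Markov's inequality covers the event of at least N bad blocks. Otherwise, if no block has a
    common cut, the product of the factors is at least z ^ N, with z = 1 - r, whereas its mean is at
    most z ^ size s; as 2 N <= size s, comparing the two leaves z ^ N. *)
Lemma no_common_cut_le s (N : nat) : uniq s -> block_ok s ->
  (0 < N)%N -> (2 * N <= size s)%N ->
  \sum_(p | perm_on W1 p) \sum_(q | perm_on W2 q)
    gibbs c W1 p * gibbs c W2 q * (all (fun b => ~~ cut2 p q b) s)%:R
  <= (1 - r) ^+ N + N%:R^-1 * \sum_(b <- s)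
      (\sum_(p | perm_on W1 p) gibbs c W1 p * (~~ good p b)%:R +
       \sum_(q | perm_on W2 q) gibbs c W2 q * (~~ good q b)%:R).
Proof.
move=> us ok N0 N2; set z := 1 - r.
have z0 : 0 < z by rewrite subr_gt0.
have z1 : z <= 1 by rewrite lerBlDr lerDl ltW.
pose bad p := \sum_(b <- s) (~~ good p b)%:R : R.
have badE W : \sum_(b <- s) \sum_(p | perm_on W p) gibbs c W p * (~~ good p b)%:R =
    \sum_(p | perm_on W p) gibbs c W p * bad p.
  rewrite exchange_big /=; apply: eq_bigr => p _.
  by rewrite mulr_sumr.
rewrite big_split /= !badE.
have badcount p : bad p = (count (fun b => ~~ good p b) s)%:R.
  rewrite /bad -natr_sum -sum1_count [in RHS]big_mkcond /=.
  by congr (_%:R).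
have pt p q : (all (fun b => ~~ cut2 p q b) s)%:R <=
    z ^+ N * (z ^+ size s)^-1 * \prod_(b <- s) factor p q b
    + N%:R^-1 * (bad p + bad q).
  have f0 b' : 0 <= factor p q b' by rewrite /factor; case: ifP => // _; rewrite ltW.
  have P0 : 0 <= z ^+ N / z ^+ size s * \prod_(b <- s) factor p q b.
    by rewrite mulr_ge0 ?prodr_ge0 // divr_ge0 // exprn_ge0 // ltW.
  have b0 p' : 0 <= bad p' by rewrite badcount.
  have [big|small] := leP N%:R (bad p + bad q).
    apply: (@le_trans _ _ 1); first by rewrite lern1 leq_b1.
    apply: (@le_trans _ _ (N%:R^-1 * (bad p + bad q))); last by rewrite lerDr.
    by rewrite ler_pdivlMl ?ltr0n // mulr1.
  have [nc|_] := boolP (all _ _); last by rewrite addr_ge0 // mulr_ge0 ?invr_ge0 ?addr_ge0.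
  apply: (@le_trans _ _ (z ^+ N / z ^+ size s * \prod_(b <- s) factor p q b));
    last by rewrite lerDl mulr_ge0 ?invr_ge0 ?addr_ge0.
  have Pge : z ^+ N <= \prod_(b <- s) factor p q b.
    have -> : \prod_(b <- s) factor p q b = z ^+ count (fun b => ~~ good2 p q b) s.
      elim: (s) nc => [_|b s' IHs /= /andP[bc nc]]; first by rewrite big_nil.
      rewrite big_cons IHs // /factor bc; case: (good2 p q b) => /=; first by rewrite mul1r add0n.
      by rewrite add1n exprS.
    apply: ler_wiXn2l => //; first exact: ltW.
    move: small; rewrite !badcount -natrD ltr_nat => small.
    apply: leq_trans (ltnW small).
    elim: (s) => //= b s' IHs; rewrite addnACA leq_add // /good2.
    by case: (good p b); case: (good q b).
  rewrite mulrAC ler_pdivlMr ?exprn_gt0 // mul1r.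
  apply: (@le_trans _ _ (z ^+ N * z ^+ N)); last by rewrite ler_wpM2l // exprn_ge0 // ltW.
  by rewrite -exprD ler_wiXn2l ?(ltW z0) //; lia.
have EDl (F1 F2 : {perm 'I_n} -> {perm 'I_n} -> R) a :
  \sum_(p | perm_on W1 p) \sum_(q | perm_on W2 q)
    gibbs c W1 p * gibbs c W2 q * (a * F1 p q + F2 p q) =
  a * (\sum_(p | perm_on W1 p) \sum_(q | perm_on W2 q)
    gibbs c W1 p * gibbs c W2 q * F1 p q) +
  \sum_(p | perm_on W1 p) \sum_(q | perm_on W2 q)
    gibbs c W1 p * gibbs c W2 q * F2 p q.
  rewrite mulr_sumr -big_split; apply: eq_bigr => p _ /=.
  by rewrite mulr_sumr -big_split; apply: eq_bigr => q _ /=; ring.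
apply: (@le_trans _ _ (\sum_(p | perm_on W1 p) \sum_(q | perm_on W2 q)
    gibbs c W1 p * gibbs c W2 q * (z ^+ N / z ^+ size s *
      \prod_(b <- s) factor p q b + N%:R^-1 * (bad p + bad q)))).
  apply: ler_sum => p _; apply: ler_sum => q _.
  by rewrite ler_wpM2l // !(gibbs_ge0, mulr_ge0).
rewrite EDl; apply: lerD.
  apply: (@le_trans _ _ (z ^+ N / z ^+ size s * z ^+ size s)).
    rewrite ler_wpM2l ?sum_factor_le //.
    by rewrite divr_ge0 // exprn_ge0 // ltW.
  by rewrite divfK // expf_neq0 // gt_eqF.
rewrite le_eqVlt; apply/orP; left; apply/eqP.
rewrite mulrDr !mulr_sumr.
have -> : \sum_(q | perm_on W2 q) N%:R^-1 * (gibbs c W2 q * bad q) =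
   \sum_(p | perm_on W1 p) \sum_(q | perm_on W2 q)
      gibbs c W1 p * (N%:R^-1 * (gibbs c W2 q * bad q)).
  by rewrite exchange_big /=; apply: eq_bigr => q _; rewrite -mulr_suml sum_gibbs mul1r.
rewrite -big_split /=; apply: eq_bigr => p _.
have -> : N%:R^-1 * (gibbs c W1 p * bad p) = \sum_(q | perm_on W2 q)
   gibbs c W2 q * (N%:R^-1 * (gibbs c W1 p * bad p)).
  by rewrite -mulr_suml sum_gibbs mul1r.
by rewrite -big_split /=; apply: eq_bigr => q _; ring.
Qed.


End Blocks.

(** * Spatial cells *)

Lemma card_ord_nat_itv (N lo len : nat) (S : {set 'I_N}) :
  (forall b, b \in S -> (lo <= b < lo + len)%N) -> (#|S| <= len)%N.
Proof.
move=> h; rewrite cardE -(size_map val) -[leqRHS](size_iota lo).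
apply: uniq_leq_size; first by rewrite map_inj_uniq ?enum_uniq //; exact: val_inj.
by move=> _ /mapP[b + ->]; rewrite mem_enum mem_iota => /h.
Qed.

Lemma card_ord_real_itv (R : realType) (N : nat) (S : {set 'I_N}) (a b : R) :
  a <= b -> (forall i, i \in S -> a <= i%:R <= b) -> #|S|%:R <= b - a + 1.
Proof.
move=> ab h; have [->|/finset.set0Pn[i0 i0S]] := eqVneq S finset.set0; first by rewrite cards0; lra.
case: (arg_minnP (fun i : 'I_N => i : nat) i0S) => i iS imin.
case: (arg_maxnP (fun i : 'I_N => i : nat) i0S) => j jS jmax.
have ij : (i <= j)%N by exact: imin.
have le : (#|S| <= (j - i).+1)%N.
  apply: (@card_ord_nat_itv _ i) => k kS.
  rewrite addnS ltnS subnKC //; apply/andP; split; first exact: imin.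
  exact: jmax.
have /andP[ai _] := h _ iS; have /andP[_ jb] := h _ jS.
apply: (@le_trans _ _ (j - i).+1%:R); first by rewrite ler_nat.
by rewrite -natr1 natrB //; lra.
Qed.

Lemma card_ord_lt (N m : nat) : (m <= N)%N -> #|[set k : 'I_N | (k < m)%N]| = m.
Proof.
move=> mN; have inj : injective (widen_ord mN).
  by move=> i j /(congr1 val) /= /val_inj.
rewrite -[RHS](card_ord m) -(card_imset _ inj).
apply: eq_card => k; rewrite inE; apply/idP/imsetP => [km|[i _ ->]]; last exact: (ltn_ord i).
by exists (Ordinal km) => //; apply: val_inj.
Qed.

Section Geometry.
Context {R : realType} {n : nat}.
Variables (x y : 'I_n -> R) (h : nat) (a : R).
Hypotheses (x_incr : forall k l : 'I_n, (k < l)%N -> x k < x l).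
Hypotheses (x_ge0 : forall k, 0 <= x k) (x_len : forall k, x k <= n%:R).
Hypotheses (h_gt0 : (0 < h)%N) (a_ge1 : 1 <= a).
Implicit Types (k l : 'I_n) (b : 'I_n.+1) (p : {perm 'I_n}).

Let H : R := h%:R.

Lemma H_gt0 : 0 < H. Proof. by rewrite ltr0n. Qed.
Hint Resolve H_gt0 : core.

Lemma x_le k l : (k <= l)%N -> x k <= x l.
Proof.
rewrite leq_eqVlt => /orP[/eqP/val_inj->//|/x_incr/ltW//].
Qed.

(** Using the integer part of [x k] makes each cell a union of unit cells, so that its occupation is
    a function of the discretized data. *)
Definition cell_of k : 'I_n.+1 := inord (Num.truncn (x k) %/ h).

Definition cell_x b : {set 'I_n} := [set k | cell_of k == b].

Definition cell_y b : {set 'I_n} :=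
  [set l | b%:R * H <= y l < b.+1%:R * H].

Definition center b : R := b%:R * H + H / 2.

(** The rank at which a cut separates the x-points left of the center from the others. *)
Definition center_rank b : nat := #|[set k | x k < center b]|.

Lemma cell_ofE k : cell_of k = (Num.truncn (x k) %/ h)%N :> nat.
Proof.
rewrite /cell_of inordK // ltnS (leq_trans (leq_div _ _)) //.
rewrite -(ler_nat R); apply: le_trans (x_len k).
by have /andP[] := truncn_itv (x_ge0 k).
Qed.

Lemma cell_xP k b : k \in cell_x b -> b%:R * H <= x k < b.+1%:R * H.
Proof.
rewrite inE => /eqP <-; rewrite cell_ofE; set u := Num.truncn (x k).
have /andP[ux xu] := truncn_itv (x_ge0 k); apply/andP; split.
  by apply: le_trans ux; rewrite -natrM ler_nat leq_divM.
apply: (lt_le_trans xu); rewrite -natrM ler_nat.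
exact: ltn_ceil.
Qed.

Lemma cell_x_of k b : b%:R * H <= x k < b.+1%:R * H -> k \in cell_x b.
Proof.
move=> /andP[lo hi]; have /cell_xP/andP[] : k \in cell_x (cell_of k) by rewrite inE.
set b' := cell_of k => lo' hi'; rewrite inE -/b'; apply/eqP/val_inj/eqP => /=.
have := le_lt_trans lo hi'; have := le_lt_trans lo' hi.
by rewrite !ltr_pM2r // !ltr_nat !ltnS eqn_leq => -> ->.
Qed.

Lemma center_rankE b k : (k < center_rank b)%N = (x k < center b).
Proof.
set D := [set k | x k < center b]; have downD k' l : (k' <= l)%N -> l \in D -> k' \in D.
  by rewrite !inE => /x_le; exact: le_lt_trans.
have [kD|kD] := boolP (k \in D).
  have -> : x k < center b by move: kD; rewrite inE.
  have : (#|[set l : 'I_n | (l < k.+1)%N]| <= #|D|)%N.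
    apply: subset_leq_card; apply/fintype.subsetP => l.
    by rewrite inE ltnS => /downD; apply.
  by rewrite card_ord_lt.
have -> : x k < center b = false by apply/negbTE; move: kD; rewrite inE.
apply/negbTE; rewrite -leqNgt.
have : (#|D| <= #|[set l : 'I_n | (l < k)%N]|)%N.
  apply: subset_leq_card; apply/fintype.subsetP => l lD; rewrite inE ltnNge.
  by apply: contra kD => /downD; apply.
by rewrite card_ord_lt // ltnW.
Qed.

Lemma center_rank_le b : (center_rank b <= n)%N.
Proof. by rewrite /center_rank (leq_trans (max_card _)) // card_ord. Qed.

(** A cut acts on ranks, and [center_rank] is read off [x] only. Alignment says that the y-points of
    lower and higher rank also lie on the expected sides of the center, up to H / 4. *)
Definition aligned b : bool :=
  [forall l : 'I_n, ((l < center_rank b)%N ==> (y l < center b + H / 4)) &&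
    ((center_rank b <= l)%N ==> (center b - H / 4 <= y l))].

Lemma alignedP b : aligned b -> forall l,
  ((l < center_rank b)%N -> y l < center b + H / 4) /\
  ((center_rank b <= l)%N -> center b - H / 4 <= y l).
Proof. by move=> /forallP h' l; have /andP[/implyP ? /implyP] := h' l. Qed.

(** Points of another cell are at distance at least H / 2 from the center of [b'], more than the
    error H / 4 left by alignment. *)
Lemma cell_nocross b b' k l : aligned b' -> b' != b ->
  k \in cell_x b -> l \in cell_y b ->
  (k < center_rank b')%N = (l < center_rank b')%N.
Proof.
move=> /alignedP al bb /cell_xP/andP[kl ku]; rewrite inE => /andP[ll lu].
rewrite center_rankE; have [al1 al2] := al l.
have := H_gt0; rewrite /center in al1 al2 *.
move: bb; rewrite -val_eqE neq_ltn => /orP[] /= blt H0.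
  have e : b'.+1%:R * H <= b%:R * H by rewrite ler_pM2r // ler_nat.
  rewrite -natr1 mulrDl mul1r in e.
  have -> : x k < b'%:R * H + H / 2 = false by apply/negbTE; rewrite -leNgt; lra.
  by apply/esym/negbTE/negP => /al1; lra.
have e : b.+1%:R * H <= b'%:R * H by rewrite ler_pM2r // ler_nat.
have -> : x k < b'%:R * H + H / 2 by lra.
by apply/esym; rewrite ltnNge; apply/negP => /al2; lra.
Qed.

Lemma cell_dist b k l : k \in cell_x b -> l \in cell_y b -> `|x k - y l| <= H.
Proof.
move=> /cell_xP/andP[kl ku]; rewrite inE => /andP[ll lu].
by move: ku lu; rewrite -natr1 mulrDl mul1r => ku lu; rewrite ler_norml; lra.
Qed.

(** A bound for the number of cells that an edge from u to v can spoil. Only edges of length at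
    least H / 4 spoil any, so a power a >= 1 may be put on the rescaled length; it will be the
    growth exponent of V. *)
Definition stretch (u v : R) : R := 2 * (4 * `|u - v| / H) `^ a.

(** Centers are H apart, so with D = |u - v| at most 2 D / H + 3 / 2 of them are this close to u; D
    >= H / 4 absorbs the constant. *)
Lemma card_near_centers (P : pred 'I_n.+1) (u v : R) :
  (forall b, P b -> H / 4 <= `|u - v| /\ `|center b - u| <= `|u - v| + H / 4) ->
  \sum_b (P b)%:R <= stretch u v.
Proof.
move=> hP; have H0 := H_gt0; set D := `|u - v| in hP *.
have [/existsP[b0 Pb0]|/existsPn noP] := boolP [exists b, P b]; last first.
  rewrite big1 ?mulr_ge0 ?powR_ge0 // => b _; by rewrite (negbTE (noP b)).
have [D4 _] := hP _ Pb0.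
have -> : \sum_b (P b)%:R = #|[set b | P b]|%:R :> R.
  rewrite -natr_sum -sum1_card big_mkcond [in RHS]big_mkcond /=; congr (_%:R).
  by apply: eq_bigr => b _; rewrite inE; case: (P b).
have D1 : 1 <= 4 * D / H by rewrite ler_pdivlMr //; lra.
apply: (@le_trans _ _ (2 * (4 * D / H))); last by rewrite /stretch ler_pM2l // le1r_powR.
have := @card_ord_real_itv R n.+1 [set b | P b] ((u - H / 2 - D - H / 4) / H)
  ((u - H / 2 + D + H / 4) / H).
set q := #|_|%:R => /(_ _ _)/le_trans; apply.
- by rewrite ler_pM2r ?invr_gt0 //; lra.
- move=> b; rewrite inE => /hP[_]; rewrite ler_norml /center => /andP[b1 b2].
  by rewrite ler_pdivrMr // ler_pdivlMr //; apply/andP; split; lra.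
- rewrite -mulrBl [X in X / H](_ : _ = 2 * D + H / 2); last by lra.
  have -> : (2 * D + H / 2) / H = 2 * (D / H) + 1 / 2.
    by field; rewrite gt_eqF.
  by move: D1; rewrite -mulrA; lra.
Qed.

(** A point that violates alignment has an edge of the sorted matching, from [x k] to [y k], running
    from one side of the center to H / 4 beyond it. *)
Lemma sum_misaligned : \sum_b (~~ aligned b)%:R <= \sum_k stretch (x k) (y k).
Proof.
have H0 := H_gt0.
pose P k b := ((k < center_rank b)%N && (center b + H / 4 <= y k)) ||
  ((center_rank b <= k)%N && (y k < center b - H / 4)).
apply: (@le_trans _ _ (\sum_b \sum_k (P k b)%:R)).
  apply: ler_sum => b _; have [_|/forallPn[k hk]] := boolP (aligned b).
    by rewrite sumr_ge0.
  rewrite (bigD1 k) //=.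
  suff -> : P k b by rewrite lerDl sumr_ge0.
  move: hk; rewrite negb_and !negb_imply -leNgt -ltNge /P.
  by case: (k < _)%N => //=; case: (_ <= k)%N.
rewrite exchange_big /=; apply: ler_sum => k _; apply: card_near_centers => b.
rewrite /P => /orP[/andP[]|/andP[]].
  rewrite center_rankE => kc yk; rewrite ler_norml.
  by have [d|d] := ger0P (x k - y k); split; try apply/andP; try split; lra.
rewrite leqNgt center_rankE -leNgt => kc yk; rewrite ler_norml.
by have [d|d] := ger0P (x k - y k); split; try apply/andP; try split; lra.
Qed.

(** In an aligned cell an edge crossing the center in rank has its y-end at most H / 4 on the wrong
    side. If one of its ends leaves the cell, at H / 2 from the center, its length is at least H /
    4. *)
Lemma sum_nonlocal W p : perm_on W p ->
  \sum_b (aligned b && ~~ local_crossings p (center_rank b) (cell_x b) (cell_y b))%:R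
  <= \sum_(k in W) stretch (x k) (y (p k)).
Proof.
move=> pW; have H0 := H_gt0.
pose P k b := [&& aligned b, crosses p (center_rank b) k &
  ~~ ((k \in cell_x b) && (p k \in cell_y b))].
apply: (@le_trans _ _ (\sum_b \sum_(k in W) (P k b)%:R)).
  apply: ler_sum => b _; have [ab|] /= := boolP (aligned b); last by rewrite sumr_ge0.
  have [|/forallPn[k]] /= := boolP (local_crossings _ _ _ _); first by rewrite sumr_ge0.
  rewrite negb_imply => /andP[ck nk].
  have kW : k \in W.
    by apply: contraLR ck => kW; rewrite /crosses (out_perm pW kW) eqxx.
  rewrite (bigD1 k) //=; suff -> : P k b by rewrite lerDl sumr_ge0.
  by rewrite /P ab ck nk.
rewrite exchange_big /=; apply: ler_sum => k _; apply: card_near_centers => b.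
move=> /and3P[/alignedP/(_ (p k))[al1 al2]]; rewrite /crosses center_rankE => ck.
rewrite negb_and => nin.
have nin' : ~~ (b%:R * H <= x k < b.+1%:R * H) || (p k \notin cell_y b).
  case/orP: nin => [nin|->]; last by rewrite orbT.
  by apply/orP; left; apply: contra nin; exact: cell_x_of.
move: nin' ck; rewrite inE !negb_and -!ltNge -!leNgt -natr1 mulrDl mul1r.
rewrite /center in al1 al2 *.
have [pk|pk] := boolP (p k < center_rank b)%N.
  move: (al1 pk) => {}al1; rewrite eqb_id -leNgt => ny xk.
  rewrite ler_norml; have [d|d] := ger0P (x k - y (p k)).
    by case/orP: ny => [/orP[]|/orP[]]; lra.
  by case/orP: ny => [/orP[]|/orP[]] ?; split; try apply/andP; try split; lra.
move: (pk); rewrite -leqNgt => /al2 {}al2; rewrite eqbF_neg negbK => ny xk.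
rewrite ler_norml; have [d|d] := ger0P (x k - y (p k)).
  by case/orP: ny => [/orP[]|/orP[]] ?; split; try apply/andP; try split; lra.
by case/orP: ny => [/orP[]|/orP[]]; lra.
Qed.

End Geometry.

(** * From cells to the mean total variation *)

Lemma TV_marginal_le1 (R : realType) (n : nat) (c : 'I_n -> 'I_n -> R)
    (W1 W2 : {set 'I_n}) (i : 'I_n) :
  TV (marginal c W1 i) (marginal c W2 i) <= 1.
Proof.
apply: (le_trans (@TV_swap _ _ c W1 W2 (fun _ _ => finset.set0) i _ _ _ _)) => //.
- by move=> p q; rewrite finset.sub0set.
- by move=> p q k; rewrite !inE.
- by move=> p q k; rewrite !inE.
rewrite -[leRHS](sum_gibbs c W1); apply: ler_sum => p _.
rewrite -[leRHS]mulr1 -[X in _ <= _ * X](sum_gibbs c W2) mulr_sumr.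
by apply: ler_sum => q _; rewrite finset.in_set0 mulr1.
Qed.

Section Assembly.
Context {R : realType} {n : nat}.
Variables (x y : 'I_n -> R) (h : nat) (a : R) (c : 'I_n -> 'I_n -> R).
Variables (M N : nat) (w G Q r : R).
Hypotheses (x_incr : forall k l : 'I_n, (k < l)%N -> x k < x l).
Hypotheses (x_ge0 : forall k, 0 <= x k) (x_len : forall k, x k <= n%:R).
Hypotheses (h_gt0 : (0 < h)%N) (a_ge1 : 1 <= a).
Hypotheses (c_ge0 : forall k l, 0 <= c k l).
Hypotheses (cQ : forall k l, stretch h a (x k) (y l) <= Q * c k l).
Hypotheses (cG : forall k l, `|x k - y l| <= h%:R -> c k l <= G).
Hypotheses (G_ge0 : 0 <= G) (Q_ge0 : 0 <= Q) (r_gt0 : 0 < r) (r_lt1 : r < 1).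
Hypotheses (rG : forall s : nat, s%:R <= w ->
  r * (s`!%:R * expR (s%:R * G)) ^+ 2 <= 1).
Hypotheses (N_gt0 : (0 < N)%N) (M_gt0 : (0 < M)%N) (w_ge0 : 0 <= w).
Hypotheses (NwM : 6 * N%:R * w <= M%:R).
Implicit Types (k l i : 'I_n) (b : 'I_n.+1) (p q : {perm 'I_n}) (W : {set 'I_n}).

Local Notation cell_of := (cell_of x h).
Local Notation cell_x := (cell_x x h).
Local Notation cell_y := (cell_y y h).
Local Notation center_rank := (center_rank x h).
Local Notation aligned := (aligned x y h).

Definition dense k : bool := w < #|cell_x (cell_of k)|%:R.

Let sparse b : bool := #|cell_x b|%:R <= w.

Let nonlocal W b : R := \sum_(p | perm_on W p) gibbs c W p *
  (aligned b && ~~ local_crossings p (center_rank b) (cell_x b) (cell_y b))%:R.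

Lemma nonlocal_ge0 W b : 0 <= nonlocal W b.
Proof. by apply: sumr_ge0 => p _; rewrite !(gibbs_ge0, ler0n, mulr_ge0). Qed.

(** The row sum runs over all [l] and not only over [W], so one quantity bounds the mean energies of
    all windows, up to the factor 2, and can be summed over windows. *)
Definition energy k : R := ln (1 + \sum_l expR (- (c k l / 2))) + c k k.

Lemma energy_ge k : c k k <= energy k.
Proof.
rewrite /energy lerDr ln_ge0 // lerDl sumr_ge0 // => l _; exact: expR_ge0.
Qed.

Lemma sum_nonlocal_le W : \sum_b nonlocal W b <= 2 * Q * \sum_(k in W) energy k.
Proof.
rewrite /nonlocal exchange_big /=.
apply: (@le_trans _ _ (\sum_(p | perm_on W p)
   gibbs c W p * (Q * \sum_(k in W) c k (p k)))).
  apply: ler_sum => p pW; rewrite -mulr_sumr ler_wpM2l ?gibbs_ge0 //.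
  apply: (le_trans (sum_nonlocal y x_incr x_ge0 x_len h_gt0 a_ge1 pW)).
  by rewrite mulr_sumr; apply: ler_sum => k _; exact: cQ.
have -> : \sum_(p | perm_on W p) gibbs c W p * (Q * \sum_(k in W) c k (p k)) =
    Q * \sum_(p | perm_on W p) gibbs c W p * \sum_(k in W) c k (p k).
  by rewrite mulr_sumr; apply: eq_bigr => p _; rewrite mulrCA.
by rewrite mulrAC [2 * _ * Q]mulrC ler_wpM2l //; exact: gibbs_energy.
Qed.

(* A sparse cell meeting the rank interval has its central rank in it, unless it
   contains the first or the last point of the interval. *)
Lemma rank_interval_cover (lo : nat) : (lo + M <= n)%N ->
  M%:R <= \sum_(k : 'I_n | (lo <= k < lo + M)%N) (dense k)%:R +
    (#|[set b | (lo <= center_rank b <= lo + M)%N && sparse b]|%:R + 2) * w.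
Proof.
move=> loM; set T := [set b | _].
have lo_lt : (lo < n)%N by apply: leq_trans loM; rewrite -addn1 leq_add2l.
have hi_lt : ((lo + M).-1 < n)%N by rewrite prednK // addn_gt0 M_gt0 orbT.
pose k1 : 'I_n := Ordinal lo_lt; pose k2 : 'I_n := Ordinal hi_lt.
pose A : {set 'I_n} := [set k : 'I_n | (lo <= k < lo + M)%N].
have MA : M%:R <= #|A|%:R :> R.
  rewrite ler_nat -(leq_add2l lo) -{1}(@card_ord_lt n (lo + M)) //.
  rewrite -[X in (_ <= X + _)%N](@card_ord_lt n lo) ?(ltnW lo_lt) //.
  apply: leq_trans (leq_card_setU _ _); apply: subset_leq_card.
  by apply/fintype.subsetP => k; rewrite !inE => ->; rewrite andbT ltnNge orNb.
apply: (le_trans MA).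
have -> : #|A|%:R = \sum_(k : 'I_n | (lo <= k < lo + M)%N) (1 : R).
  by rewrite sumr_const; congr (_%:R); apply: eq_card => k; rewrite !inE.
pose f b k : R := (k \in cell_x b)%:R * (sparse b)%:R.
have f0 b k : 0 <= f b k by rewrite mulr_ge0.
have fsum b : \sum_k f b k <= w.
  rewrite /f -mulr_suml; case sb: (sparse b); last by rewrite mulr0.
  rewrite mulr1 -natr_sum (_ : (\sum_k _)%N = #|cell_x b|) //.
  by rewrite -sum1_card [RHS]big_mkcond.
(* Each rank of the interval is dense, or lies in a cell of [T], or shares its cell with the first
   or the last rank. *)
apply: (@le_trans _ _ (\sum_(k : 'I_n | (lo <= k < lo + M)%N) (dense k)%:R +
   \sum_k (\sum_(b in T) f b k + (f (cell_of k1) k + f (cell_of k2) k)))); last first.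
  rewrite lerD2l big_split /= mulrDl lerD //.
    have -> : #|T|%:R * w = \sum_(b in T) w by rewrite sumr_const mulr_natl.
    by rewrite exchange_big /=; apply: ler_sum.
  by rewrite big_split /= mulrDl mul1r lerD.
have le0 k : 0 <= \sum_(b in T) f b k + (f (cell_of k1) k + f (cell_of k2) k).
  by rewrite !addr_ge0 // sumr_ge0.
apply: (@le_trans _ _ (\sum_(k : 'I_n | (lo <= k < lo + M)%N) ((dense k)%:R +
   (\sum_(b in T) f b k + (f (cell_of k1) k + f (cell_of k2) k))))); last first.
  by rewrite big_split /= lerD2l [leRHS](bigID (fun k : 'I_n => (lo <= k < lo + M)%N)) /=
    lerDl sumr_ge0.
apply: ler_sum => k /andP[lok khi].
have [_|] /= := boolP (dense k); first by rewrite lerDl le0.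
rewrite /dense -leNgt => sp; rewrite add0r; set b := cell_of k in sp.
have kb : k \in cell_x b by rewrite inE.
have fb : f b k = 1 by rewrite /f kb /sparse sp mulr1.
have [lo' hi'] := andP (cell_xP x_ge0 x_len h_gt0 kb).
have [bT|] := boolP (b \in T).
  by rewrite (bigD1 b) //= fb -addrA lerDl !addr_ge0 // sumr_ge0.
rewrite inE /sparse sp andbT negb_and -!ltnNge.
have e k' : b%:R * h%:R <= x k' < b.+1%:R * h%:R -> cell_of k' = b.
  by move=> /(cell_x_of x_ge0 x_len h_gt0); rewrite inE => /eqP.
have sumT0 : 0 <= \sum_(b in T) f b k by rewrite sumr_ge0.
have H0 : 0 < h%:R :> R by rewrite ltr0n.
case/orP => out.
  suff -> : cell_of k1 = b by rewrite fb; have := f0 (cell_of k2) k; lra.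
  apply: e; apply/andP; split.
    have : ~~ (k1 < center_rank b)%N by rewrite -leqNgt ltnW.
    by rewrite (center_rankE h x_incr) -leNgt /center; lra.
  by apply: le_lt_trans hi'; apply: (x_le x_incr).
suff -> : cell_of k2 = b by rewrite fb; have := f0 (cell_of k1) k; lra.
apply: e; apply/andP; split.
  apply: (le_trans lo'); apply: (x_le x_incr) => /=.
  by rewrite -ltnS prednK // addn_gt0 M_gt0 orbT.
have : (k2 < center_rank b)%N by exact: leq_ltn_trans (leq_pred _) out.
have -> : b.+1%:R * h%:R = b%:R * h%:R + h%:R :> R by rewrite -natr1 mulrDl mul1r.
by rewrite (center_rankE h x_incr) /center; lra.
Qed.

(** One term for each case. With 2 N sparse aligned cells, [no_common_cut_le] applies. With N
    misaligned cells, the last term is at least 1. Otherwise too few cells are sparse to cover the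
    interval, half of its points are dense, and the middle term is at least 1. *)
Lemma no_common_cut_in_interval W1 W2 (lo : nat) : (lo + M <= n)%N ->
  \sum_(p | perm_on W1 p) \sum_(q | perm_on W2 q) gibbs c W1 p * gibbs c W2 q *
    [forall m : 'I_n.+1, (lo <= m <= lo + M)%N ==> ~~ (cut p m && cut q m)]%:R
  <= (1 - r) ^+ N + 2 / M%:R * \sum_(k : 'I_n | (lo <= k < lo + M)%N) (dense k)%:R +
    N%:R^-1 * \sum_(b | (lo <= center_rank b <= lo + M)%N)
      ((~~ aligned b)%:R + nonlocal W1 b + nonlocal W2 b).
Proof.
move=> loM; set Lhs := (X in X <= _).
have r1' : 0 <= 1 - r by rewrite subr_ge0 ltW.
have M0 : 0 < M%:R :> R by rewrite ltr0n.
have N0 : 0 < N%:R :> R by rewrite ltr0n.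
pose inT b := (lo <= center_rank b <= lo + M)%N.
have t0 b : 0 <= (~~ aligned b)%:R + nonlocal W1 b + nonlocal W2 b.
  by rewrite !addr_ge0 ?nonlocal_ge0.
have term1 : 0 <= (1 - r) ^+ N by rewrite exprn_ge0.
have term2 : 0 <= 2 / M%:R * \sum_(k : 'I_n | (lo <= k < lo + M)%N) (dense k)%:R :> R.
  by rewrite mulr_ge0 ?divr_ge0 ?(ltW M0) ?sumr_ge0.
have term3 : 0 <= N%:R^-1 * \sum_(b | inT b)
    ((~~ aligned b)%:R + nonlocal W1 b + nonlocal W2 b).
  by rewrite mulr_ge0 ?invr_ge0 ?(ltW N0) ?sumr_ge0.
have Lhs1 : Lhs <= 1.
  apply: (@le_trans _ _ (\sum_(p | perm_on W1 p) gibbs c W1 p)); last by rewrite sum_gibbs.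
  apply: ler_sum => p _.
  rewrite -[leRHS]mulr1 -[X in _ <= _ * X](sum_gibbs c W2) mulr_sumr.
  apply: ler_sum => q _; rewrite -[leRHS]mulr1.
  by rewrite ler_wpM2l ?lern1 ?leq_b1 // mulr_ge0 ?gibbs_ge0.
pose s := [seq b <- enum 'I_n.+1 | [&& inT b, sparse b & aligned b]].
have us : uniq s by rewrite filter_uniq ?enum_uniq.
have sP b : b \in s -> [/\ inT b, sparse b & aligned b].
  by rewrite mem_filter => /andP[/and3P].
have [s_big|s_small] := leqP (2 * N) (size s).
  have := @no_common_cut_le R n 'I_n.+1 c W1 W2 center_rank cell_x cell_y G r
    c_ge0 G_ge0 r_gt0 r_lt1 s N us _ N_gt0 s_big.
  set Rhs := (X in _ <= X) => hc; apply: (@le_trans _ _ Rhs).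
    apply: le_trans (hc _).
      apply: ler_sum => p _; apply: ler_sum => q _.
      rewrite ler_wpM2l ?(gibbs_ge0, mulr_ge0) // ler_nat.
      case: forallP => //= hall; rewrite lt0b; apply/allP => b /sP[Tb _ _].
      have := hall (inord (center_rank b)).
      by rewrite inordK ?ltnS ?center_rank_le // -/(inT b) Tb.
    move=> b /sP[Tb sb ab]; split.
    - by move=> k l kb lb; apply: cG; apply: (cell_dist x_ge0 x_len h_gt0 kb lb).
    - exact: rG.
    - move=> b' /sP[_ _ ab'] bb k l.
      by apply: (cell_nocross x_incr x_ge0 x_len h_gt0 ab' bb).
  rewrite -addrA lerD2l; apply: ler_wpDl => //.
  rewrite ler_wpM2l ?invr_ge0 ?(ltW N0) //.
  rewrite big_filter big_enum_cond /= big_mkcond [leRHS]big_mkcond /=.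
  apply: ler_sum => b _; rewrite -/(inT b); case: (inT b) => //=.
  case: ifP => [/andP[_ ab]|_]; last exact: t0.
  rewrite ab /= add0r /nonlocal ab lexx //.
apply: (le_trans Lhs1).
set T := [set b | inT b && sparse b].
have [un|un] := leqP N #|[set b | inT b && ~~ aligned b]|.
  have : 1 <= N%:R^-1 * \sum_(b | inT b)
      ((~~ aligned b)%:R + nonlocal W1 b + nonlocal W2 b).
    rewrite ler_pdivlMl // mulr1; apply: (@le_trans _ _ #|[set b | inT b && ~~ aligned b]|%:R).
      by rewrite ler_nat.
    rewrite -sum1_card natr_sum big_mkcond [leRHS]big_mkcond /=; apply: ler_sum => b _.
    rewrite inE; case: (inT b) => //=; case: (aligned b) => //=.
      by rewrite add0r addr_ge0 ?nonlocal_ge0.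
    by rewrite -addrA lerDl addr_ge0 ?nonlocal_ge0.
  lra.
have Ts : (#|T| <= size s + #|[set b | inT b && ~~ aligned b]|)%N.
  have -> : size s = #|[set b in s]| by rewrite cardsE; apply/esym/card_uniqP.
  apply: leq_trans (leq_card_setU _ _); apply: subset_leq_card.
  apply/fintype.subsetP => b; rewrite !inE mem_filter mem_enum inE => /andP[-> ->] /=.
  by case: (aligned b).
pose D : R := \sum_(k : 'I_n | (lo <= k < lo + M)%N) (dense k)%:R.
have cover : M%:R <= D + (#|T|%:R + 2) * w by exact: rank_interval_cover.
(* Here [T] has at most (2 N - 1) + (N - 1) cells, which leaves room for the two end cells; and 3 N
   w <= M / 2. *)
have T3 : (#|T|%:R + 2) * w <= 3 * N%:R * w.
  rewrite ler_wpM2r // -natrM -[2]/(2%:R) -natrD ler_nat.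
  move: Ts s_small un; move: #|T| (size s) #|_| => t0' t1' t2'.
  by clear; lia.
have D2 : M%:R <= 2 * D by move: NwM; lra.
have : 1 <= 2 / M%:R * D.
  by rewrite mulrAC ler_pdivlMr // mul1r.
rewrite /D => le1; apply: (le_trans le1).
by rewrite -addrA addrCA lerDl addr_ge0.
Qed.

Lemma sum_window (F : 'I_n -> R) : (forall k, 0 <= F k) ->
  \sum_i \sum_(k in window M i) F k <= (2 * M + 1)%:R * \sum_k F k.
Proof.
move=> F0; rewrite (exchange_big_dep predT) //= mulr_sumr; apply: ler_sum => k _.
rewrite (eq_bigl [in [set i | k \in window M i]]) => [|i]; last by rewrite inE.
rewrite sumr_const -[leLHS]mulr_natl ler_wpM2r // ler_nat.
apply: (@card_ord_nat_itv _ (k - M)) => i.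
by rewrite /window !inE; clear; lia.
Qed.

Lemma TV_interior_le i : (M <= i)%N -> (i + M < n)%N ->
  TV (marginal c finset.setT i) (marginal c (window M i) i) <=
  2 * (1 - r) ^+ N + 2 / M%:R * \sum_(k in window M i) (dense k)%:R +
  N%:R^-1 * \sum_(b | (i <= center_rank b + M)%N && (center_rank b <= i + M + 1)%N)
    ((~~ aligned b)%:R + nonlocal finset.setT b + nonlocal (window M i) b).
Proof.
move=> Mi iM; set W := window M i.
have M0 : 0 < M%:R :> R by rewrite ltr0n.
have N0 : 0 < N%:R :> R by rewrite ltr0n.
have t0 b : 0 <= (~~ aligned b)%:R + nonlocal finset.setT b + nonlocal W b.
  by rewrite !addr_ge0 ?nonlocal_ge0.
have lo1 : (i - M + M <= n)%N by rewrite subnK // ltnW.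
have lo2 : (i.+1 + M <= n)%N by [].
pose f b := (~~ aligned b)%:R + nonlocal finset.setT b + nonlocal W b.
pose d1 : R := \sum_(k : 'I_n | (i - M <= k < i - M + M)%N) (dense k)%:R.
pose d2 : R := \sum_(k : 'I_n | (i.+1 <= k < i.+1 + M)%N) (dense k)%:R.
pose d : R := \sum_(k in W) (dense k)%:R.
pose e1 := \sum_(b | (i - M <= center_rank b <= i - M + M)%N) f b.
pose e2 := \sum_(b | (i.+1 <= center_rank b <= i.+1 + M)%N) f b.
pose e := \sum_(b | (i <= center_rank b + M)%N && (center_rank b <= i + M + 1)%N) f b.
have h1 := no_common_cut_in_interval finset.setT W lo1; rewrite -/d1 -/e1 in h1.
have h2 := no_common_cut_in_interval finset.setT W lo2; rewrite -/d2 -/e2 in h2.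
(* A cut at m lies between the ranks m - 1 and m. The extreme cuts i - M and i + 1 + M therefore
   enclose exactly the ranks i - M to i + M of the window. *)
have hTV := @TV_common_cut R n c finset.setT W
  (fun m => (i - M <= m <= i - M + M)%N) (fun m => (i.+1 <= m <= i.+1 + M)%N) i.
rewrite -/d -/e.
move: h1 h2 hTV; set t1 := (X in X <= _ -> _) => h1; set t2 := (X in X <= _ -> _) => h2 hTV.
have {}hTV : TV (marginal c finset.setT i) (marginal c W i) <= t1 + t2.
  apply: hTV => [m|m|m m' k]; rewrite /W /window ?inE; move: Mi iM; clear; lia.
have dd : d1 + d2 <= d.
  rewrite /d1 /d2 /d big_mkcond [X in _ + X]big_mkcond [leRHS]big_mkcond -big_split /=.
  apply: ler_sum => k _; rewrite /W /window inE.
  have : ((i - M <= k < i - M + M) + (i.+1 <= k < i.+1 + M) <=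
      (i - M <= k <= i + M))%N by move: Mi iM; clear; lia.
  have := ler0n R (dense k); move: (dense k)%:R => z z0.
  case: (i - M <= k < i - M + M)%N; case: (i.+1 <= k < i.+1 + M)%N;
    by case: (i - M <= k <= i + M)%N => //= _; rewrite ?addr0 ?add0r.
have ee : e1 + e2 <= e.
  rewrite /e1 /e2 /e big_mkcond [X in _ + X]big_mkcond [leRHS]big_mkcond -big_split /=.
  apply: ler_sum => b _; have := t0 b; rewrite -/(f b); move: (f b) => z z0.
  set m := center_rank b.
  have : ((i - M <= m <= i - M + M) + (i.+1 <= m <= i.+1 + M) <=
      ((i <= m + M) && (m <= i + M + 1)))%N by move: Mi iM; clear; lia.
  case: (i - M <= m <= i - M + M)%N; case: (i.+1 <= m <= i.+1 + M)%N;
    by case: (_ && _) => //= _; rewrite ?addr0 ?add0r.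
have dd' : 2 / M%:R * (d1 + d2) <= 2 / M%:R * d by rewrite ler_wpM2l // divr_ge0 // ltW.
have ee' : N%:R^-1 * (e1 + e2) <= N%:R^-1 * e by rewrite ler_wpM2l // invr_ge0 ltW.
by rewrite !mulrDr in dd' ee'; lra.
Qed.

(** At most 2 M ranks are too close to an end and are charged the trivial bound 1. For the others
    the sums are exchanged: a cell is near at most 2 M + 2 ranks, and a rank belongs to at most 2 M
    + 1 windows, each paying for its own energy. *)
Lemma sum_TV_le :
  \sum_i TV (marginal c finset.setT i) (marginal c (window M i) i) <=
  2 * M%:R + 2 * n%:R * (1 - r) ^+ N + 6 * \sum_k (dense k)%:R +
  20 * (M%:R / N%:R) * Q * \sum_k energy k.
Proof.
have M0 : 0 < M%:R :> R by rewrite ltr0n.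
have M1 : 1 <= M%:R :> R by rewrite ler1n.
have N0 : 0 < N%:R :> R by rewrite ltr0n.
have r1' : 0 <= 1 - r by rewrite subr_ge0 ltW.
set S := \sum_k energy k; set D := \sum_k (dense k)%:R.
have en0 k : 0 <= energy k by exact: le_trans (c_ge0 k k) (energy_ge k).
have S0 : 0 <= S by rewrite sumr_ge0.
pose near i b := (i <= center_rank b + M)%N && (center_rank b <= i + M + 1)%N.
pose t i b := (~~ aligned b)%:R + nonlocal finset.setT b + nonlocal (window M i) b.
have t0 i b : 0 <= t i b by rewrite !addr_ge0 ?nonlocal_ge0.
pose bnd i := (i < M)%N || (n <= i + M)%N.
apply: (@le_trans _ _ (\sum_i ((bnd i)%:R + (2 * (1 - r) ^+ N +
    2 / M%:R * \sum_(k in window M i) (dense k)%:R +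
    N%:R^-1 * \sum_(b | near i b) t i b)))).
  apply: ler_sum => i _; have [bi|] := boolP (bnd i).
    apply: (le_trans (TV_marginal_le1 _ _ _ _)); rewrite lerDl !addr_ge0 //.
    - by rewrite mulr_ge0 ?exprn_ge0.
    - by rewrite mulr_ge0 ?divr_ge0 ?sumr_ge0 // ltW.
    - by rewrite mulr_ge0 ?invr_ge0 ?sumr_ge0 // ltW.
  by rewrite negb_or -leqNgt -ltnNge add0r => /andP[Mi iM]; exact: TV_interior_le.
rewrite !big_split /= -!mulr_sumr sumr_const card_ord.
have hb : \sum_i (bnd i)%:R <= 2 * M%:R :> R.
  apply: (@le_trans _ _ (\sum_(i : 'I_n) ((i < M)%N%:R + (n - M <= i)%N%:R))).
    apply: ler_sum => i _; rewrite /bnd leq_subLR addnC.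
    by case: (i < M)%N; case: (n <= _)%N => /=; lra.
  have cnt (P : pred 'I_n) lo len : (forall i, P i -> (lo <= i < lo + len)%N) ->
      \sum_i (P i)%:R <= len%:R :> R.
    move=> hP; rewrite -natr_sum ler_nat.
    apply: leq_trans (@card_ord_nat_itv n lo len [set i | P i] _); last first.
      by move=> i; rewrite inE; exact: hP.
    rewrite -sum1_card [leqRHS]big_mkcond /=; apply: leq_sum => i _.
    by rewrite inE; case: (P i).
  rewrite big_split /= mulrDl mul1r lerD //; first by apply: (cnt _ 0%N) => i.
  by apply: (cnt _ (n - M)%N) => i h'; move: h' (ltn_ord i); clear; lia.
have hd : \sum_i \sum_(k in window M i) (dense k)%:R <= (2 * M + 1)%:R * D.
  by apply: sum_window => k; rewrite ler0n.
have he : \sum_i \sum_(b | near i b) t i b <= 20 * M%:R * Q * S.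
  have u0 b : 0 <= (~~ aligned b)%:R + nonlocal finset.setT b.
    by rewrite addr_ge0 ?nonlocal_ge0.
  have part1 : \sum_i \sum_(b | near i b) ((~~ aligned b)%:R + nonlocal finset.setT b)
     <= (2 * M + 2)%:R * (3 * Q * S).
    rewrite (exchange_big_dep predT) //=.
    apply: (@le_trans _ _ ((2 * M + 2)%:R *
        \sum_b ((~~ aligned b)%:R + nonlocal finset.setT b))).
      rewrite mulr_sumr; apply: ler_sum => b _.
      rewrite (eq_bigl [in [set i | near i b]]) => [|i]; last by rewrite inE.
      rewrite sumr_const -[leLHS]mulr_natl ler_wpM2r // ler_nat.
      apply: (@card_ord_nat_itv _ (center_rank b - M.+1)) => i.
      by rewrite inE /near; clear; lia.
    rewrite ler_wpM2l // big_split /=.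
    have : \sum_b nonlocal finset.setT b <= 2 * Q * S.
      apply: (le_trans (sum_nonlocal_le _)).
      rewrite le_eqVlt; apply/orP; left; apply/eqP; congr (_ * _).
      by apply: eq_bigl => k; rewrite inE.
    have : \sum_b (~~ aligned b)%:R <= Q * S.
      apply: (le_trans (sum_misaligned y x_incr h_gt0 a_ge1)).
      rewrite mulr_sumr; apply: ler_sum => k _; apply: (le_trans (cQ _ _)).
      by rewrite ler_wpM2l // energy_ge.
    lra.
  have part2 : \sum_i \sum_(b | near i b) nonlocal (window M i) b
     <= 2 * Q * ((2 * M + 1)%:R * S).
    apply: (@le_trans _ _ (\sum_i 2 * Q * \sum_(k in window M i) energy k)).
      apply: ler_sum => i _; apply: le_trans (sum_nonlocal_le _).
      rewrite [leRHS](bigID (near i)) /= lerDl sumr_ge0 // => b _.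
      exact: nonlocal_ge0.
    by rewrite -mulr_sumr ler_wpM2l ?mulr_ge0 // sum_window.
  have -> : \sum_i \sum_(b | near i b) t i b =
      \sum_i \sum_(b | near i b) ((~~ aligned b)%:R + nonlocal finset.setT b) +
      \sum_i \sum_(b | near i b) nonlocal (window M i) b.
    by rewrite -big_split /=; apply: eq_bigr => i _; rewrite -big_split.
  (* The coefficient is 3 (2 M + 2) + 2 (2 M + 1) = 10 M + 8, at most 20 M. *)
  apply: (le_trans (lerD part1 part2)).
  have -> : (2 * M + 2)%:R = 2 * M%:R + 2 :> R by rewrite natrD natrM.
  have -> : (2 * M + 1)%:R = 2 * M%:R + 1 :> R by rewrite natrD natrM.
  rewrite -subr_ge0.
  have -> : 20 * M%:R * Q * S - ((2 * M%:R + 2) * (3 * Q * S) +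
      2 * Q * ((2 * M%:R + 1) * S)) = (10 * M%:R - 8) * (Q * S) by ring.
  by rewrite mulr_ge0 ?mulr_ge0 //; lra.
have hd' : 2 / M%:R * \sum_i \sum_(k in window M i) (dense k)%:R <= 6 * D.
  have D0 : 0 <= D by rewrite sumr_ge0.
  apply: (@le_trans _ _ (2 / M%:R * ((2 * M + 1)%:R * D))).
    by rewrite ler_wpM2l // divr_ge0 // ltW.
  rewrite mulrA ler_wpM2r // mulrAC ler_pdivrMr //.
  have -> : (2 * M + 1)%:R = 2 * M%:R + 1 :> R by rewrite natrD natrM.
  lra.
have he' : N%:R^-1 * \sum_i \sum_(b | near i b) t i b <= 20 * (M%:R / N%:R) * Q * S.
  rewrite ler_pdivrMl //; apply: (le_trans he).
  rewrite le_eqVlt; apply/orP; left; apply/eqP; field.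
  by rewrite gt_eqF.
rewrite -mulr_natr; lra.
Qed.

End Assembly.

(** * Sorted matchings *)

(** Let k be the smallest moved index and j its preimage under p. Then k < j and k < p k, and the
    Monge inequality shows that letting p fix k by a transposition does not raise the cost; the
    number of moved indices drops. *)
Lemma sum_monge_le (R : realType) (n : nat) (c : 'I_n -> 'I_n -> R)
    (p : {perm 'I_n}) :
  (forall k k' l l' : 'I_n, (k < k')%N -> (l < l')%N ->
    c k l + c k' l' <= c k l' + c k' l) ->
  \sum_k c k k <= \sum_k c k (p k).
Proof.
move=> monge; have [N] := ubnP #|[set k | p k != k]|; elim: N p => // N IH p ltN.
have [/existsP[k0 pk0]|/existsPn fix_p] := boolP [exists k, p k != k]; last first.
  rewrite le_eqVlt; apply/orP; left; apply/eqP; apply: eq_bigr => k _.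
  by have := fix_p k; rewrite negbK => /eqP ->.
case: (@arg_minnP 'I_n k0 (fun k => p k != k) val pk0) => k pk kmin {k0 pk0}.
have fix_lt (j : 'I_n) : (j < k)%N -> p j = j.
  by move=> jk; apply/eqP; apply: contraLR jk => /kmin; rewrite -leqNgt.
have kpk : (k < p k)%N.
  case: (ltngtP k (p k)) => // [/fix_lt/perm_inj e|/val_inj e].
    by rewrite e eqxx in pk.
  by rewrite -e eqxx in pk.
pose j := p^-1%g k; have pj : p j = k by rewrite permKV.
have jk : j != k by apply: contraNneq pk => e; rewrite -{1}e pj.
have kj : (k < j)%N.
  case: (ltngtP k j) => // [/fix_lt e|/val_inj e].
    by rewrite -e pj eqxx in jk.
  by rewrite -e eqxx in jk.
pose p' := (tperm k j * p)%g.
have p'k : p' k = k by rewrite permM tpermL.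
have p'j : p' j = p k by rewrite permM tpermR.
have p'E (i : 'I_n) : i != k -> i != j -> p' i = p i.
  by move=> ik ij; rewrite permM tpermD // eq_sym.
apply: (@le_trans _ _ (\sum_i c i (p' i))).
  apply: IH; rewrite -ltnS (leq_trans _ ltN) // ltnS; apply: proper_card.
  apply/fintype.properP; split; last by exists k; rewrite inE ?p'k ?eqxx.
  apply/fintype.subsetP => i; rewrite !inE.
  have [->|ik] := eqVneq i k; first by rewrite p'k eqxx.
  have [->|ij] := eqVneq i j; first by move=> _; rewrite pj eq_sym jk.
  by rewrite p'E.
rewrite (bigD1 k) // (bigD1 j) //= [leRHS](bigD1 k) // [in leRHS](bigD1 j) //=.
rewrite p'k p'j pj !addrA; apply: lerD; first by rewrite monge.
by apply: ler_sum => i /andP[ij ik]; rewrite p'E.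
Qed.

(** The defect of the induction step is t (1 - t) (u - v) (u ^ (q+1) - v ^ (q+1)), whose last two
    factors have the same sign. *)
Lemma convex_exprn (R : realType) (q : nat) (t u v : R) :
  0 <= t <= 1 -> 0 <= u -> 0 <= v -> (0 < q)%N ->
  (t * u + (1 - t) * v) ^+ q <= t * u ^+ q + (1 - t) * v ^+ q.
Proof.
move=> /andP[t0 t1] u0 v0; elim: q => // -[_ _|q IH _]; first by rewrite !expr1.
have t1' : 0 <= 1 - t by rewrite subr_ge0.
have m0 : 0 <= t * u + (1 - t) * v by rewrite addr_ge0 ?mulr_ge0.
rewrite exprS; apply: (le_trans (ler_wpM2l m0 (IH isT))).
rewrite -subr_ge0 [u ^+ q.+2]exprS [v ^+ q.+2]exprS.
set U := u ^+ q.+1; set W := v ^+ q.+1.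
have -> : t * (u * U) + (1 - t) * (v * W) -
    (t * u + (1 - t) * v) * (t * U + (1 - t) * W) =
    t * (1 - t) * ((u - v) * (U - W)) by ring.
apply: mulr_ge0; first exact: mulr_ge0.
have [uv|/ltW vu] := leP u v.
  by apply: mulr_le0; rewrite subr_le0 ?lerXn2r ?nnegrE.
by apply: mulr_ge0; rewrite subr_ge0 ?lerXn2r ?nnegrE.
Qed.

(** The sorted differences lie between the crossed ones, A and B, and have the same sum; they are
    convex combinations of A and B with exchanged weights, so convexity gives the Monge inequality.
    The lemma transfers bounds on the true matching to the sorted one. *)
Lemma sorted_matching_le (R : realType) (n q : nat) (x y : 'I_n -> R)
    (p : {perm 'I_n}) : (0 < q)%N ->
  (forall k l : 'I_n, (k < l)%N -> x k < x l) ->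
  (forall k l : 'I_n, (k < l)%N -> y k < y l) ->
  \sum_k `|x k - y k| ^+ q <= \sum_k `|x k - y (p k)| ^+ q.
Proof.
move=> q0 xi yi; apply: (@sum_monge_le _ _ (fun k l => `|x k - y l| ^+ q)).
move=> k k' l l' /xi xk /yi yl.
set A := x k - y l'; set B := x k' - y l.
have AB : 0 < B - A by rewrite /A /B; lra.
pose t := (B - (x k - y l)) / (B - A).
have t01 : 0 <= t <= 1.
  apply/andP; split; last by rewrite /t ler_pdivrMr // /A /B; lra.
  by apply: divr_ge0; [rewrite /B; lra|exact: ltW].
have t01' : 0 <= 1 - t <= 1 by move/andP: t01 => [? ?]; apply/andP; split; lra.
have tAB : t * (B - A) = B - (x k - y l) by rewrite divfK // gt_eqF.
have e1 : x k - y l = t * A + (1 - t) * B by lra.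
have e2 : x k' - y l' = (1 - t) * A + (1 - (1 - t)) * B.
  by move: tAB; rewrite /A /B => tAB; lra.
have cvx s : 0 <= s <= 1 ->
    `|s * A + (1 - s) * B| ^+ q <= s * `|A| ^+ q + (1 - s) * `|B| ^+ q.
  move=> s01; apply: le_trans (convex_exprn s01 (normr_ge0 A) (normr_ge0 B) q0).
  have /andP[s0 s1] := s01.
  rewrite lerXn2r ?nnegrE ?addr_ge0 ?mulr_ge0 ?subr_ge0 //.
  apply: (le_trans (ler_normD _ _)); rewrite !normrM (ger0_norm s0).
  by rewrite (@ger0_norm _ (1 - s)) ?subr_ge0.
rewrite e1 e2; have := cvx _ t01; have := cvx _ t01'; lra.
Qed.

(** * Row sums of a geometric kernel *)

Definition ndist (u v : nat) : nat := (u - v + (v - u))%N.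

Lemma ndistC u v : ndist u v = ndist v u.
Proof. by rewrite /ndist addnC. Qed.

(** A distance j from v is attained at most at v + j and v - j. *)
Lemma sum_ndist_le (R : realType) (F : nat -> R) (N v : nat) :
  (forall j, 0 <= F j) -> (v < N)%N ->
  \sum_(u < N) F (ndist u v) <= 2 * \sum_(j < N) F j.
Proof.
move=> F0 vN.
have dN (u : 'I_N) : (ndist u v < N)%N by have := ltn_ord u; rewrite /ndist; lia.
have -> : \sum_(u < N) F (ndist u v) =
    \sum_(u < N) \sum_(j < N) (ndist u v == j)%:R * F j.
  apply: eq_bigr => u _; rewrite (bigD1 (Ordinal (dN u))) //= eqxx mul1r.
  rewrite big1 ?addr0 // => j /eqP ju; case: eqP => e; last by rewrite mul0r.
  by case: ju; apply: val_inj.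
rewrite exchange_big mulr_sumr /=; apply: ler_sum => j _.
rewrite -mulr_suml ler_wpM2r //.
have cnt (m : nat) : \sum_(u < N) (u == m :> nat)%:R <= 1 :> R.
  have [mN|Nm] := ltnP m N.
    rewrite (bigD1 (Ordinal mN)) //= eqxx big1 ?addr0 // => u.
    by rewrite -val_eqE /= => /negbTE ->.
  rewrite big1 // => u _; suff -> : (u == m :> nat) = false by [].
  by apply/negbTE; rewrite neq_ltn (leq_trans (ltn_ord u) Nm).
apply: (@le_trans _ _ (\sum_(u < N) ((u == v + j :> nat)%N%:R + (u == v - j :> nat)%N%:R))).
  apply: ler_sum => u _; rewrite -natrD ler_nat /ndist.
  case: eqP => [e|//]; suff : (u == v + j :> nat)%N || (u == v - j :> nat)%N.
    by case: (_ == _ :> nat); case: (_ == _ :> nat).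
  by apply/orP; move: e; lia.
by rewrite big_split /=; have := cnt (v + j)%N; have := cnt (v - j)%N; lra.
Qed.

Lemma sum_geometric_le (R : realType) (z : R) (N : nat) :
  0 <= z < 1 -> \sum_(j < N) z ^+ j <= (1 - z)^-1.
Proof.
move=> /andP[z0 z1]; have z1' : 0 < 1 - z by rewrite subr_gt0.
rewrite -[leRHS]mul1r ler_pdivlMr //.
by have := subrX1 z N; have := exprn_ge0 N z0; lra.
Qed.

Section RowSums.
Context {R : realType} {n : nat}.
Variables (u v : 'I_n -> 'I_n.+1) (A z : R).
Hypotheses (A_ge0 : 0 <= A) (z01 : 0 <= z < 1).

(* Young's inequality, ln (1 + s) <= ln m + (1 + s) / m, where m is the
   occupation number of the cell. *)
Lemma sum_ln_row_le :
  \sum_k ln (1 + A * \sum_l z ^+ ndist (u k) (v l)) <=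
  \sum_k ln #|[set j | u j == u k]|%:R + n.+1%:R + A * (2 / (1 - z)) * n%:R.
Proof.
have /andP[z0 z1] := z01.
pose m (b : 'I_n.+1) : R := #|[set j | u j == b]|%:R.
pose rho (b : 'I_n.+1) : R := 1 + A * \sum_l z ^+ ndist b (v l).
have rho1 b : 1 <= rho b.
  by rewrite lerDl mulr_ge0 ?sumr_ge0 // => l _; rewrite exprn_ge0.
have m0 k : 0 < m (u k) by rewrite ltr0n card_gt0; apply/finset.set0Pn; exists k; rewrite inE.
apply: (@le_trans _ _ (\sum_k (ln (m (u k)) + rho (u k) / m (u k)))).
  apply: ler_sum => k _; rewrite -/(rho (u k)).
  have e : rho (u k) = m (u k) * (rho (u k) / m (u k)).
    by rewrite mulrC divfK // gt_eqF.
  have q0 : 0 < rho (u k) / m (u k).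
    by rewrite divr_gt0 // (lt_le_trans ltr01).
  by rewrite {1}e lnM ?posrE // lerD2l ltW // ln_sublinear.
rewrite big_split /= -[leRHS]addrA lerD2l.
apply: (@le_trans _ _ (\sum_b rho b)).
  have -> : \sum_k rho (u k) / m (u k) = \sum_b \sum_(k | u k == b) rho b / m b.
    rewrite (partition_big u predT) //=; apply: eq_bigr => b _.
    by apply: eq_bigr => k /eqP ->.
  apply: ler_sum => b _; rewrite sumr_const -mulr_natl.
  have [->|nz] := eqVneq #|[pred k | u k == b]| 0%N.
    by rewrite mul0r (le_trans ler01).
  have -> : m b = #|[pred k | u k == b]|%:R by rewrite /m; congr (_%:R); apply: eq_card => k; rewrite !inE.
  by rewrite mulrC divfK // pnatr_eq0.
rewrite big_split /= sumr_const card_ord lerD2l -mulr_sumr -mulrA ler_wpM2l //.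
rewrite exchange_big /=.
apply: (@le_trans _ _ (\sum_(l < n) 2 / (1 - z))).
  apply: ler_sum => l _; apply: (le_trans (sum_ndist_le _ _)) => //.
    by move=> j; rewrite exprn_ge0.
  by rewrite ler_pM2l // sum_geometric_le.
by rewrite sumr_const card_ord mulr_natr.
Qed.

End RowSums.

(** * Independent discrete pairs *)

Section ProductSpace.
Context {R : realType} {Z : finType}.
Variable p : Z -> R.
Hypotheses (p_ge0 : forall z, 0 <= p z) (sum_p : \sum_z p z = 1).

Lemma sum_prod_indep (n : nat) (F : 'I_n -> Z -> R) :
  \sum_(a : {ffun 'I_n -> Z}) (\prod_i p (a i)) * \prod_i F i (a i) =
  \prod_i \sum_z p z * F i z.
Proof. by rewrite bigA_distr_bigA; apply: eq_bigr => a _; rewrite -big_split. Qed.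

Lemma sum_prod_iid (n : nat) (F : Z -> R) :
  \sum_(a : {ffun 'I_n -> Z}) (\prod_i p (a i)) * \prod_i F (a i) =
  (\sum_z p z * F z) ^+ n.
Proof. by rewrite (sum_prod_indep (fun=> F)) prodr_const card_ord. Qed.

Lemma sum_prod_coord (n : nat) (F : Z -> R) :
  \sum_(a : {ffun 'I_n -> Z}) (\prod_i p (a i)) * \sum_i F (a i) =
  n%:R * \sum_z p z * F z.
Proof.
under eq_bigr do rewrite mulr_sumr.
have -> : n%:R * \sum_z p z * F z = \sum_(i < n) \sum_z p z * F z.
  by rewrite sumr_const card_ord mulr_natl.
rewrite exchange_big /=; apply: eq_bigr => i _.
have <- : \prod_j \sum_z p z * (if j == i then F z else 1) = \sum_z p z * F z.
  rewrite (bigD1 i) //= eqxx [X in _ * X]big1 ?mulr1 // => j /negbTE ->.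
  by under eq_bigr do rewrite mulr1.
rewrite -(sum_prod_indep (fun j z => if j == i then F z else 1)).
apply: eq_bigr => a _; congr (_ * _); rewrite [RHS](bigD1 i) //= eqxx [X in _ * X]big1 ?mulr1 //.
by move=> j /negbTE ->.
Qed.

Lemma prod_p_ge0 (n : nat) (a : {ffun 'I_n -> Z}) : 0 <= \prod_i p (a i).
Proof. exact: prodr_ge0. Qed.

(** From exp (- u / 2) >= 1 - u / 2 follows exp u <= (1 - u / 2) ^ -2, which is at most 1 + 3 u on
    [0, 1]. *)
Lemma expR_le_1D3 (u : R) : 0 <= u <= 1 -> expR u <= 1 + 3 * u.
Proof.
move=> /andP[u0 u1]; have h : 1 - u / 2 <= expR (- (u / 2)) by exact: expR_ge1Dx.
have e : expR u * (expR (- (u / 2)) * expR (- (u / 2))) = 1.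
  by rewrite -!expRD (_ : u + _ = 0) ?expR0 //; lra.
have h2 : (1 - u / 2) * (1 - u / 2) <= expR (- (u / 2)) * expR (- (u / 2)).
  by apply: ler_pM => //; lra.
have h3 : expR u * ((1 - u / 2) * (1 - u / 2)) <= 1.
  by rewrite -[X in _ <= X]e ler_wpM2l // expR_ge0.
have pos : 0 < (1 - u / 2) * (1 - u / 2) by apply: mulr_gt0; lra.
rewrite -(ler_pM2r pos); apply: (le_trans h3).
have : 0 <= u * (1 - u) * (2 - 3 / 4 * u) by rewrite !mulr_ge0 //; lra.
lra.
Qed.

(* Truncation at T: beyond T a union bound, below T a Chernoff bound with
   parameter 1 / T. *)
Lemma truncated_chernoff (n : nat) (psi : Z -> R) (T m : R) :
  0 < T -> (forall z, 0 <= psi z) -> \sum_z p z * psi z <= m ->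
  \sum_(a : {ffun 'I_n -> Z}) (\prod_i p (a i)) *
    (4 * m * n%:R < \sum_i psi (a i))%R%:R <=
  n%:R * \sum_z p z * (T < psi z)%R%:R + expR (- (n%:R * m / T)).
Proof.
move=> T0 psi0 psim; pose f z := Num.min (psi z) T / T.
have f01 z : 0 <= f z <= 1.
  rewrite /f divr_ge0 ?(ltW T0) ?le_min ?psi0 ?(ltW T0) //=.
  by rewrite ler_pdivrMr // mul1r ge_min lexx orbT.
have pt (a : {ffun 'I_n -> Z}) : (4 * m * n%:R < \sum_i psi (a i))%R%:R <=
    \sum_i (T < psi (a i))%R%:R +
    expR (- (4 * m * n%:R / T)) * \prod_i expR (f (a i)) :> R.
  have P0 : 0 <= expR (- (4 * m * n%:R / T)) * \prod_i expR (f (a i)).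
    by rewrite mulr_ge0 ?expR_ge0 // prodr_ge0 // => i _; exact: expR_ge0.
  have S0 : 0 <= \sum_i (T < psi (a i))%R%:R :> R by rewrite sumr_ge0.
  have [big|_] := ltP; last by rewrite addr_ge0.
  have [/existsP[i hi]|/existsPn small] := boolP [exists i, T < psi (a i)].
    by rewrite (bigD1 i) //= hi -addrA lerDl addr_ge0 // sumr_ge0.
  apply: ler_wpDl => //; rewrite -expR_sum -expRD -[leLHS]expR0 ler_expR.
  have -> : \sum_i f (a i) = (\sum_i psi (a i)) / T.
    rewrite mulr_suml; apply: eq_bigr => i _; rewrite /f; congr (_ / _).
    by apply/min_idPl; rewrite leNgt small.
  by rewrite addrC -mulrBl divr_ge0 ?(ltW T0) // subr_ge0 ltW.
apply: (@le_trans _ _ (\sum_(a : {ffun 'I_n -> Z}) (\prod_i p (a i)) *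
   (\sum_i (T < psi (a i))%R%:R +
    expR (- (4 * m * n%:R / T)) * \prod_i expR (f (a i))))).
  by apply: ler_sum => a _; rewrite ler_wpM2l ?prod_p_ge0.
under eq_bigr do rewrite mulrDr mulrCA.
rewrite big_split /= (sum_prod_coord n (fun z => (T < psi z)%R%:R)) lerD2l -mulr_sumr.
rewrite (sum_prod_iid n (fun z => expR (f z))).
(* The constant 3 is paid n times against the 4 of the threshold, which leaves - n m / T in the
   exponent. *)
have mgf : \sum_z p z * expR (f z) <= expR (3 * m / T).
  apply: (@le_trans _ _ (1 + 3 * m / T)); last exact: expR_ge1Dx.
  apply: (@le_trans _ _ (\sum_z (p z + 3 / T * (p z * psi z)))).
    apply: ler_sum => z _; rewrite mulrCA -[X in _ <= X + _]mulr1 -mulrDr.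
    rewrite ler_wpM2l //; apply: (le_trans (expR_le_1D3 (f01 z))).
    rewrite lerD2l /f mulrA [3 / T * _]mulrAC ler_wpM2r ?invr_ge0 ?(ltW T0) //.
    by rewrite ler_wpM2l // ge_min lexx.
  rewrite big_split /= sum_p lerD2l -mulr_sumr mulrAC.
  by rewrite ler_wpM2r ?invr_ge0 ?(ltW T0) // ler_wpM2l.
have mgf0 : 0 <= \sum_z p z * expR (f z).
  by apply: sumr_ge0 => z _; rewrite mulr_ge0 // expR_ge0.
apply: (@le_trans _ _ (expR (- (4 * m * n%:R / T)) * expR (3 * m / T) ^+ n)).
  by rewrite ler_wpM2l ?expR_ge0 // lerXn2r ?nnegrE ?expR_ge0.
rewrite -expRM_natl -expRD ler_expR le_eqVlt; apply/orP; left; apply/eqP; field.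
by rewrite gt_eqF.
Qed.

Section Occupation.
Context {U : finType}.
Variables (g : Z -> U) (beta : R).
Hypothesis g_le : forall u, \sum_(z | g z == u) p z <= beta.

Definition occupation (n : nat) (a : {ffun 'I_n -> Z}) (u : U) : nat :=
  #|[set j | g (a j) == u]|.

Lemma beta_ge0 (u : U) : 0 <= beta.
Proof. by apply: le_trans (g_le u); apply: sumr_ge0. Qed.

(* Expanding the product over cells turns it into exponential moments of the
   number of points in unions of cells. *)
Lemma dense_moment (n : nat) (w : R) :
  \sum_(a : {ffun 'I_n -> Z}) (\prod_i p (a i)) *
    expR (\sum_i (w < (occupation a (g (a i)))%:R)%R%:R) <=
  expR (#|U|%:R * expR (n%:R * (expR 2 - 1) * beta - w)).
Proof.
have e21 : 0 <= expR 2 - 1 :> R by rewrite subr_ge0 -[1]expR0 ler_expR.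
pose N (a : {ffun 'I_n -> Z}) u : R := (occupation a u)%:R.
have NE a u : N a u = \sum_i (g (a i) == u)%:R.
  rewrite /N /occupation -sum1_card natr_sum big_mkcond /=.
  by apply: eq_bigr => i _; rewrite inE; case: (_ == _).
(* A cell with N > w points contributes exp N <= exp (- w) exp (2 N), any other cell contributes 1;
   hence the factor 2. *)
have step1 (a : {ffun 'I_n -> Z}) :
    expR (\sum_i (w < (occupation a (g (a i)))%:R)%R%:R) <=
    \prod_u (1 + expR (- w) * expR (2 * N a u)).
  have -> : \sum_i (w < (occupation a (g (a i)))%:R)%R%:R =
      \sum_u N a u * (w < N a u)%R%:R.
    rewrite (partition_big (g \o a) predT) //=; apply: eq_bigr => u _.
    rewrite [X in _ = X * _]NE mulr_suml big_mkcond /=; apply: eq_bigr => i _.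
    by case: eqP => [->|_] /=; rewrite ?mul1r ?mul0r.
  rewrite expR_sum; apply: ler_prod => u _; rewrite expR_ge0 /=.
  have [wN|_] := ltP; last by rewrite mulr0 expR0 lerDl mulr_ge0 ?expR_ge0.
  by rewrite mulr1 -expRD ler_wpDl // ler_expR; lra.
apply: (@le_trans _ _ (\sum_(a : {ffun 'I_n -> Z}) (\prod_i p (a i)) *
    \prod_u (1 + expR (- w) * expR (2 * N a u)))).
  by apply: ler_sum => a _; rewrite ler_wpM2l ?prod_p_ge0.
have expand (b : U -> R) :
    \prod_u (1 + b u) = \sum_(S : {set U}) \prod_(u in S) b u.
  rewrite bigA_distr /= (reindex_inj (@finset.setC_inj U)) /=.
  apply: eq_bigr => S _; rewrite [RHS]big_mkcond /=; apply: eq_bigr => u _.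
  by rewrite inE; case: (u \in S).
under eq_bigr do rewrite expand mulr_sumr.
rewrite exchange_big /=.
have [noU|[u0 _]] : (#|U| = 0%N) \/ exists u : U, True.
  by case: (posnP #|U|) => [|/card_gt0P[u _]]; [left|right; exists u].
- have noZ (z : Z) : False by have := fintype0 (g z) noU.
  have : \sum_z p z = 0 by apply: big1 => z; case: (noZ z).
  by rewrite sum_p => /eqP; rewrite oner_eq0.
have b0 := beta_ge0 u0.
pose q := n%:R * (expR 2 - 1) * beta - w.
apply: (@le_trans _ _ (\sum_(S : {set U}) \prod_(u in S) expR q)).
  apply: ler_sum => S _.
  have -> : \sum_(a : {ffun 'I_n -> Z}) (\prod_i p (a i)) *
      \prod_(u in S) (expR (- w) * expR (2 * N a u)) =
      expR (- w * #|S|%:R) *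
      \sum_(a : {ffun 'I_n -> Z}) (\prod_i p (a i)) *
         \prod_i expR (2 * (g (a i) \in S)%:R).
    rewrite mulr_sumr; apply: eq_bigr => a _; rewrite mulrCA; congr (_ * _).
    rewrite big_split /= prodr_const -expRM_natl mulrC [_ * - w]mulrC mulrC.
    congr (_ * _); rewrite -!expR_sum -!mulr_sumr; congr (expR (2 * _)).
    under eq_bigr do rewrite NE.
    rewrite exchange_big /=; apply: eq_bigr => i _.
    have [gS|gS] := boolP (g (a i) \in S).
      by rewrite (bigD1 (g (a i))) //= eqxx big1 ?addr0 // => u /andP[_ /negbTE]; rewrite eq_sym => ->.
    by rewrite big1 // => u uS; case: eqP => // e; rewrite e uS in gS.
  rewrite (sum_prod_iid n (fun z => expR (2 * (g z \in S)%:R))).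
  rewrite prodr_const -expRM_natl.
  have mgf : \sum_z p z * expR (2 * (g z \in S)%:R) <= expR ((expR 2 - 1) * (#|S|%:R * beta)).
    apply: (@le_trans _ _ (1 + (expR 2 - 1) * (#|S|%:R * beta))); last exact: expR_ge1Dx.
    have -> : \sum_z p z * expR (2 * (g z \in S)%:R) =
        1 + (expR 2 - 1) * \sum_(z | g z \in S) p z.
      rewrite -[X in _ = X + _]sum_p mulr_sumr [X in _ + X]big_mkcond -big_split /=; apply: eq_bigr => z _.
      by case: (g z \in S); rewrite ?mulr1 ?mulr0 ?expR0; ring.
    rewrite lerD2l ler_wpM2l // (partition_big g [in S]) //=.
    have -> : #|S|%:R * beta = \sum_(u in S) beta by rewrite sumr_const mulr_natl.
    apply: ler_sum => u uS; apply: le_trans (g_le u).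
    rewrite le_eqVlt; apply/orP; left; apply/eqP; apply: eq_bigl => z.
    by case: eqP => [->|_]; rewrite ?uS ?andbF.
  have mgf0 : 0 <= \sum_z p z * expR (2 * (g z \in S)%:R).
    by apply: sumr_ge0 => z _; rewrite mulr_ge0 // expR_ge0.
  apply: (@le_trans _ _ (expR (- w * #|S|%:R) *
      expR ((expR 2 - 1) * (#|S|%:R * beta)) ^+ n)).
    by rewrite ler_wpM2l ?expR_ge0 // lerXn2r ?nnegrE ?expR_ge0.
  rewrite -expRM_natl -expRD ler_expR le_eqVlt; apply/orP; left; apply/eqP.
  by rewrite /q; ring.
rewrite -(expand (fun=> expR q)) prodr_const expRM_natl.
by rewrite lerXn2r ?nnegrE ?expR_ge0 ?expR_ge1Dx // addr_ge0 ?expR_ge0.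
Qed.

(* Adding one point to a cell with m points multiplies the product of the
   occupation numbers by (m + 1) (1 + 1 / m) ^ m <= e (m + 1). *)
Lemma occupation_moment (n : nat) :
  \sum_(a : {ffun 'I_n -> Z}) (\prod_i p (a i)) *
    \prod_i (occupation a (g (a i)))%:R <=
  (expR 1 * (1 + n%:R * beta)) ^+ n.
Proof.
(* The induction adds points one by one while the base of the power keeps the final n. *)
suff claim m : (m <= n)%N ->
    \sum_(a : {ffun 'I_m -> Z}) (\prod_i p (a i)) *
      \prod_i (occupation a (g (a i)))%:R <=
    (expR 1 * (1 + n%:R * beta)) ^+ m by exact: claim.
have [z0 _] : exists z : Z, True.
  case: (posnP #|Z|) => [Z0|/card_gt0P[z _]]; last by exists z.
  move: sum_p; rewrite big_pred0 => [/eqP|z]; last by have := fintype0 z Z0.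
  by rewrite eq_sym oner_eq0.
have b0 := beta_ge0 (g z0).
elim: m => [_|m IH mn].
  rewrite expr0 -[leRHS](expr0 (\sum_z p z * 1)) -(sum_prod_iid 0 (fun=> 1)).
  by apply: ler_sum => a _; rewrite !big_ord0.
have {IH} := IH (ltnW mn).
pose cons (u : Z * {ffun 'I_m -> Z}) : {ffun 'I_m.+1 -> Z} :=
  [ffun i => if unlift ord0 i is Some j then u.2 j else u.1].
have cons0 u : cons u ord0 = u.1 by rewrite ffunE unlift_none.
have consS u j : cons u (lift ord0 j) = u.2 j by rewrite ffunE liftK.
have occE k (a : {ffun 'I_k -> Z}) x : occupation a x = (\sum_i (g (a i) == x))%N.
  rewrite /occupation -sum1_card big_mkcond /=; apply: eq_bigr => i _.
  by rewrite inE; case: (_ == _).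
have occS u x : occupation (cons u) x = ((g u.1 == x) + occupation u.2 x)%N.
  rewrite !occE big_ord_recl cons0; congr (_ + _)%N.
  by apply: eq_bigr => j _; rewrite consS.
have bij : bijective cons.
  exists (fun b : {ffun 'I_m.+1 -> Z} => (b ord0, [ffun j => b (lift ord0 j)])).
    move=> [z a]; rewrite cons0; congr pair; apply/ffunP => j.
    by rewrite ffunE consS.
  move=> b; apply/ffunP => i; case: (unliftP ord0 i) => [j|] ->.
    by rewrite consS ffunE.
  by rewrite cons0.
have step u : \prod_i (occupation (cons u) (g (cons u i)))%:R <=
    (1 + (occupation u.2 (g u.1))%:R) * expR 1 *
    \prod_j (occupation u.2 (g (u.2 j)))%:R :> R.
  rewrite big_ord_recl cons0 occS eqxx natrD -mulrA ler_wpM2l ?addr_ge0 //.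
  set k := occupation u.2 (g u.1).
  apply: (@le_trans _ _ (\prod_j ((occupation u.2 (g (u.2 j)))%:R *
      expR ((g u.1 == g (u.2 j))%:R / k%:R)))).
    apply: ler_prod => j _; rewrite ler0n consS occS natrD /=.
    case: eqP => [e|_]; last by rewrite mul0r expR0 mulr1 add0r.
    rewrite -e -/k; have k0 : 0 < k%:R :> R.
      rewrite ltr0n card_gt0; apply/finset.set0Pn; exists j.
      by rewrite inE e.
    apply: (@le_trans _ _ (k%:R * (1 + 1 / k%:R))).
      by rewrite mulrDr mulr1 mul1r mulfV ?gt_eqF // addrC.
    by rewrite ler_wpM2l ?(ltW k0) // expR_ge1Dx.
  rewrite big_split /= mulrC ler_wpM2r ?prodr_ge0 // -expR_sum ler_expR.
  rewrite -mulr_suml -natr_sum.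
  have -> : (\sum_j (g u.1 == g (u.2 j)))%N = k.
    by rewrite /k occE; apply: eq_bigr => j _; rewrite eq_sym.
  have [->|k0] := eqVneq k 0%N; first by rewrite mul0r.
  by rewrite mulfV // pnatr_eq0.
rewrite (reindex cons) /=; last exact: onW_bij.
rewrite -(pair_bigA _ (fun z a => \prod_i p (cons (z, a) i) *
  \prod_i (occupation (cons (z, a)) (g (cons (z, a) i)))%:R)) /=.
rewrite exchange_big /= exprSr => IH.
apply: le_trans (ler_wpM2r _ IH); last first.
  by rewrite mulr_ge0 ?expR_ge0 // addr_ge0 // mulr_ge0.
rewrite mulr_suml; apply: ler_sum => a _.
set P := \prod_i p (a i); set O := \prod_i _.
have P0 : 0 <= P by exact: prod_p_ge0.
have O0 : 0 <= O by rewrite prodr_ge0.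
apply: (@le_trans _ _ (\sum_z P * O * expR 1 * (p z * (1 + (occupation a (g z))%:R)))).
  apply: ler_sum => z _; rewrite big_ord_recl cons0 /=.
  have -> : \prod_(i < m) p (cons (z, a) (lift ord0 i)) = P.
    by apply: eq_bigr => i _; rewrite consS.
  apply: (@le_trans _ _ (p z * P * ((1 + (occupation a (g z))%:R) * expR 1 * O))).
    by rewrite ler_wpM2l ?mulr_ge0 // (step (z, a)).
  by rewrite le_eqVlt; apply/orP; left; apply/eqP; ring.
rewrite -mulr_sumr -!mulrA; do 3 (apply: ler_wpM2l; rewrite ?expR_ge0 //).
under eq_bigr do rewrite mulrDr mulr1.
rewrite big_split /= sum_p lerD2l.
have -> : \sum_z p z * (occupation a (g z))%:R =
    \sum_(i < m) \sum_(z | g z == g (a i)) p z.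
  under eq_bigr do rewrite occE natr_sum mulr_sumr.
  rewrite exchange_big /=; apply: eq_bigr => i _.
  rewrite [RHS]big_mkcond /=; apply: eq_bigr => z _.
  by rewrite eq_sym; case: eqP; rewrite ?mulr1 ?mulr0.
apply: (@le_trans _ _ (\sum_(i < m) beta)); first by apply: ler_sum => i _.
by rewrite sumr_const card_ord -[leLHS]mulr_natl ler_wpM2r // ler_nat ltnW.
Qed.

End Occupation.

End ProductSpace.

(** * Sorted coordinates *)

Section Sorting.
Context {R : realType} {n : nat}.
Implicit Types (X Y : 'I_n -> R) (V : R -> R).

(** The search succeeds, so the default 1 is not reached: counting the smaller values is an
    injective rank map, and its inverse sorts X. *)
Lemma sorting_perm_lt X : injective X ->
  forall i j : 'I_n, (i < j)%N -> X (sorting_perm X i) < X (sorting_perm X j).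
Proof.
move=> injX; rewrite /sorting_perm; case: pickP => [s /forallP h /= i j ij|none].
  by have /forallP/(_ j)/implyP := h i; apply.
exfalso.
pose below i := [set j | X j < X i].
have rank_lt i : (#|below i| < n)%N.
  rewrite -[ltnRHS](card_ord n) -cardsT; apply: proper_card.
  apply/fintype.properP; split; first exact: finset.subsetT.
  by exists i; rewrite !inE ?ltxx.
pose rank i : 'I_n := Ordinal (rank_lt i).
have rank_mono i j : X i < X j -> (rank i < rank j)%N.
  move=> ij; apply: proper_card; apply/fintype.properP; split.
    by apply/fintype.subsetP => k; rewrite !inE => /lt_trans; apply.
  by exists i; rewrite !inE ?ltxx.
have rank_inj : injective rank.
  move=> i j e; apply: injX; case: (ltgtP (X i) (X j)) => // /rank_mono.
    by rewrite e ltnn.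
  by rewrite e ltnn.
move/negP: (none (perm rank_inj)^-1%g); apply.
apply/forallP => i; apply/forallP => j; apply/implyP => ij.
set s := (perm rank_inj)^-1%g.
have sE k : rank (s k) = k by rewrite -[LHS](permE rank_inj) permKV.
case: (ltgtP (X (s i)) (X (s j))) => // [/rank_mono|/injX/perm_inj e].
  by rewrite !sE ltnNge (ltnW ij).
by rewrite e ltnn in ij.
Qed.

Section Conversion.
Variables (V : R -> R) (X Y : 'I_n -> R) (Vmin : R).

Let s := sorting_perm X.
Let t := sorting_perm Y.

(** Subtracting Vmin makes the cost nonnegative and cancels in the normalized laws. *)
Definition sorted_cost (k l : 'I_n) : R := V (n%:R * (X (s k) - Y (t l))) - Vmin.

(** The change of variables q -> s^-1 q t multiplies all weights by the same constant exp (- n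
    Vmin). *)
Lemma post_marginal_sorted k l :
  post_marginal V X Y (s k) (t l) = marginal sorted_cost finset.setT k l.
Proof.
have on_setT (q : {perm 'I_n}) : perm_on finset.setT q.
  by apply/fintype.subsetP => i; rewrite inE.
pose f (q : {perm 'I_n}) := (s^-1 * q * t)%g.
have f_inj : injective f by move=> q q' /mulIg /mulgI.
have weight q : post_weight V X Y (f q) =
    expR (- (n%:R * Vmin)) * gibbs_weight sorted_cost finset.setT q.
  rewrite /post_weight /gibbs_weight -expRD -opprD; congr (expR (- _)).
  rewrite (reindex_inj (@perm_inj _ s)) /=.
  rewrite [in RHS](eq_bigl predT) => [|i]; last by rewrite inE.
  rewrite /sorted_cost sumrB sumr_const card_ord mulr_natl addrCA subrr addr0.
  by apply: eq_bigr => i _; rewrite !permM permK.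
have mass : \sum_(rho : {perm 'I_n}) post_weight V X Y rho =
    expR (- (n%:R * Vmin)) * gibbs_mass sorted_cost finset.setT.
  rewrite (reindex_inj f_inj) /= /gibbs_mass mulr_sumr.
  rewrite [RHS](eq_bigl predT) => [|q]; last by rewrite on_setT.
  by apply: eq_bigr => q _.
rewrite /post_marginal (reindex_inj f_inj) /= /marginal.
apply: eq_big => [q|q _].
  by rewrite on_setT /= /f !permM permK (inj_eq (@perm_inj _ t)).
rewrite /posterior mass weight /gibbs invfM mulrACA mulfV ?mul1r //.
by rewrite gt_eqF ?expR_gt0.
Qed.

Lemma phat_sorted M k l :
  phat V X Y M (s k) (t l) = marginal sorted_cost (window M k) k l.
Proof.
rewrite /phat /phat_sort -/s -/t !permK; set W := window M k.
have kW : k \in W by rewrite inE leq_subr leq_addr.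
have weight q : window_weight V X Y W q =
    expR (- (#|W|%:R * Vmin)) * gibbs_weight sorted_cost W q.
  rewrite /window_weight /gibbs_weight -expRD -opprD; congr (expR (- _)).
  by rewrite /sorted_cost sumrB sumr_const mulr_natl addrCA subrr addr0.
rewrite /marginal; case: ifPn => lW; last first.
  rewrite big_pred0 // => q; apply/negbTE/negP => /andP[qW /eqP ql].
  by move: lW; rewrite -ql (perm_closed k qW) kW.
apply: eq_bigr => q _; rewrite /window_law weight.
under eq_bigr do rewrite weight.
rewrite -mulr_sumr /gibbs invfM mulrACA mulfV ?mul1r //.
by rewrite gt_eqF ?expR_gt0.
Qed.

Lemma mean_TV_sorted M : mean_TV V X Y M = n%:R^-1 * \sum_k
  TV (marginal sorted_cost finset.setT k) (marginal sorted_cost (window M k) k).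
Proof.
rewrite /mean_TV (reindex_inj (@perm_inj _ s)) /=; congr (_ * _).
apply: eq_bigr => k _; rewrite /TV (reindex_inj (@perm_inj _ t)) /=; congr (_ * _).
by apply: eq_bigr => l _; rewrite post_marginal_sorted phat_sorted.
Qed.

Lemma mean_TV_le1 M : mean_TV V X Y M <= 1.
Proof.
rewrite mean_TV_sorted; have [n0|n0] := posnP n.
  have -> : n%:R^-1 = 0 :> R by rewrite n0 invr0.
  by rewrite mul0r.
rewrite ler_pdivrMl ?ltr0n // mulr1.
rewrite [leRHS](_ : _ = \sum_(k < n) (1 : R)); last by rewrite sumr_const card_ord.
by apply: ler_sum => k _; exact: TV_marginal_le1.
Qed.

End Conversion.

End Sorting.

(** * The discretized pair law *)

Section PairLaw.
Context {R : realType}.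
Variables (B beta : R).
Hypotheses (B_gt0 : 0 < B) (beta_gt0 : 0 < beta).

(** Over n, this bounds the mass of a unit cell for either coordinate: it sums B / n exp (- beta d)
    over the cells of the other one. *)
Definition marginal_density : R := 2 * B / (1 - expR (- beta)).

(** A bound for the mean of (1 + d) ^ q: the power is at most q! (2 / beta) ^ q exp (beta (1 + d) /
    2), and half of the decay is left for the sum over d. *)
Definition displacement_moment (q : nat) : R :=
  4 * B * (q`!%:R * (2 / beta) ^+ q * expR (beta / 2) / (1 - expR (- (beta / 2)))).

(** The growth rate in [occupation_moment] is 1 + ln (1 + [marginal_density]); the additional 1
    leaves the probability exp (- n). *)
Definition occupation_entropy : R := 2 + ln (1 + marginal_density).

Lemma expRN01 (b : R) : 0 < b -> 0 <= expR (- b) < 1.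
Proof. by move=> b0; rewrite expR_ge0 /= -expR0 ltr_expR oppr_lt0. Qed.

Lemma sum_expR_le (b : R) (N : nat) : 0 < b ->
  \sum_(d < N) expR (- (b * d%:R)) <= (1 - expR (- b))^-1.
Proof.
move=> b0; rewrite (eq_bigr (fun d : 'I_N => expR (- b) ^+ d)) => [|d _].
  by apply: sum_geometric_le; exact: expRN01.
by rewrite -expRM_natl mulrN mulrC.
Qed.

Lemma marginal_density_gt0 : 0 < marginal_density.
Proof.
by rewrite divr_gt0 ?mulr_gt0 // subr_gt0; case/andP: (expRN01 beta_gt0).
Qed.

Lemma displacement_moment_gt0 q : 0 < displacement_moment q.
Proof.
have b2 : 0 < beta / 2 by rewrite divr_gt0.
have d0 : 0 < 1 - expR (- (beta / 2)) by rewrite subr_gt0; case/andP: (expRN01 b2).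
apply: mulr_gt0; first exact: mulr_gt0.
apply: divr_gt0 => //; apply: mulr_gt0; last exact: expR_gt0.
by apply: mulr_gt0; rewrite ?ltr0n ?fact_gt0 // exprn_gt0 // divr_gt0.
Qed.

Lemma exprn_le_expR (x b : R) (q : nat) : 0 <= x -> 0 < b -> (0 < q)%N ->
  x ^+ q <= q`!%:R * b^-1 ^+ q * expR (b * x).
Proof.
move=> x0 b0; case: q => // q _.
have bx : 0 <= b * x by rewrite mulr_ge0 // ltW.
have := expR_ge1Dxn q bx => h.
have f0 : 0 < (q.+1)`!%:R :> R by rewrite ltr0n fact_gt0.
have h2 : (b * x) ^+ q.+1 <= (q.+1)`!%:R * expR (b * x).
  by rewrite -ler_pdivrMl // mulrC; lra.
have -> : x ^+ q.+1 = b^-1 ^+ q.+1 * (b * x) ^+ q.+1.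
  by rewrite -exprMn mulrA mulVf ?mul1r // gt_eqF.
rewrite [leRHS](_ : _ = b^-1 ^+ q.+1 * ((q.+1)`!%:R * expR (b * x))); last by ring.
by rewrite ler_wpM2l // exprn_ge0 // invr_ge0 ltW.
Qed.

Variable n : nat.
Hypothesis n_gt0 : (0 < n)%N.
Let Z : Type := ('I_n.+1 * 'I_n.+1)%type.
Variable p : 'I_n.+1 * 'I_n.+1 -> R.
Hypotheses (p_ge0 : forall z, 0 <= p z) (sum_p : \sum_z p z = 1).
Hypothesis p_decay : forall z,
  p z <= B / n%:R * expR (- (beta * (ndist z.1 z.2)%:R)).

Let n0 : 0 < n%:R :> R. Proof. by rewrite ltr0n. Qed.

(** One factor 2 for the two cells at a given distance, another from (n + 1) / n <= 2. *)
Lemma sum_pair_le (F : nat -> R) : (forall d, 0 <= F d) ->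
  \sum_z p z * F (ndist z.1 z.2) <=
  4 * B * \sum_(d < n.+1) expR (- (beta * d%:R)) * F d.
Proof.
move=> F0; set S := \sum_(d < n.+1) _.
have S0 : 0 <= S by apply: sumr_ge0 => d _; rewrite mulr_ge0 ?expR_ge0.
pose G d := expR (- (beta * d%:R)) * F d.
apply: (@le_trans _ _ (\sum_(z : 'I_n.+1 * 'I_n.+1) B / n%:R * G (ndist z.1 z.2))).
  by apply: ler_sum => z _; rewrite /G mulrA ler_wpM2r.
rewrite -mulr_sumr -(pair_bigA _ (fun i j : 'I_n.+1 => G (ndist i j))) /= exchange_big /=.
apply: (@le_trans _ _ (B / n%:R * \sum_(j < n.+1) 2 * S)).
  rewrite ler_wpM2l ?divr_ge0 ?(ltW B_gt0) ?(ltW n0) //; apply: ler_sum => j _.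
  by apply: sum_ndist_le => // d; rewrite /G mulr_ge0 ?expR_ge0.
rewrite sumr_const card_ord -[X in _ * X <= _]mulr_natl.
rewrite [leLHS](_ : _ = B * S * (2 * (n.+1%:R / n%:R))); last by ring.
rewrite [leRHS](_ : _ = B * S * 4); last by ring.
rewrite ler_wpM2l ?mulr_ge0 ?(ltW B_gt0) // mulrA ler_pdivrMr //.
have : 1 <= n%:R :> R by rewrite ler1n.
by rewrite -natr1; lra.
Qed.

Lemma marginal_le (u : 'I_n.+1) :
  \sum_(z | z.1 == u) p z <= marginal_density / n%:R.
Proof.
have -> : \sum_(z | z.1 == u) p z = \sum_(v < n.+1) p (u, v).
  transitivity (\sum_(i < n.+1) \sum_(v < n.+1) if i == u then p (i, v) else 0).
    by rewrite pair_bigA big_mkcond; apply: eq_bigr => -[i j] _.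
  rewrite (bigD1 u) //= eqxx [X in _ + X]big1 ?addr0 // => i /negbTE iu.
  by rewrite big1 // => j _; rewrite iu.
apply: (@le_trans _ _ (\sum_(v < n.+1) B / n%:R * expR (- (beta * (ndist v u)%:R)))).
  by apply: ler_sum => v _; rewrite ndistC; exact: p_decay.
rewrite -mulr_sumr.
apply: (@le_trans _ _ (B / n%:R * (2 * (1 - expR (- beta))^-1))).
  rewrite ler_wpM2l ?divr_ge0 ?(ltW B_gt0) ?(ltW n0) //.
  have := @sum_ndist_le R (fun d => expR (- (beta * d%:R))) _ _ _ (ltn_ord u).
  move=> /(_ (fun d => expR_ge0 _))/le_trans; apply.
  by rewrite ler_pM2l // sum_expR_le.
by rewrite le_eqVlt /marginal_density; apply/orP; left; apply/eqP; ring.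
Qed.

Lemma coarse_marginal_le (h : nat) (b : 'I_n.+1) : (0 < h)%N ->
  \sum_(z : 'I_n.+1 * 'I_n.+1 | inord (z.1 %/ h) == b) p z <= h%:R * marginal_density / n%:R.
Proof.
move=> h0; rewrite (partition_big (fun z : 'I_n.+1 * 'I_n.+1 => z.1)
    [in [set u : 'I_n.+1 | inord (u %/ h) == b]]) /=;
  last by move=> z; rewrite inE.
apply: (@le_trans _ _ (\sum_(u in [set u : 'I_n.+1 | inord (u %/ h) == b])
    marginal_density / n%:R)).
  apply: ler_sum => u; rewrite inE => ub; apply: le_trans (marginal_le u).
  rewrite le_eqVlt; apply/orP; left; apply/eqP; apply: eq_bigl => z.
  by have [->|_] := eqVneq z.1 u; rewrite ?ub ?andbF.
rewrite sumr_const -[leLHS]mulr_natl mulrA ler_wpM2r ?invr_ge0 ?(ltW n0) //.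
rewrite ler_wpM2r ?(ltW marginal_density_gt0) // ler_nat.
apply: (@card_ord_nat_itv _ (b * h)) => u; rewrite inE => /eqP/(congr1 val) /=.
have un : (u %/ h < n.+1)%N by apply: leq_ltn_trans (leq_div _ _) (ltn_ord u).
rewrite inordK // => <-; rewrite leq_divM /=.
by rewrite addnC -mulSn ltn_ceil.
Qed.

Lemma displacement_tail (q : nat) (tau : R) : (0 < q)%N -> 0 < tau ->
  \sum_(a : {ffun 'I_n -> 'I_n.+1 * 'I_n.+1}) (\prod_i p (a i)) *
    (4 * displacement_moment q * n%:R <
      \sum_i (1 + ndist (a i).1 (a i).2)%:R ^+ q)%R%:R <=
  n%:R * (4 * B * expR (beta / 2) / (1 - expR (- (beta / 2)))) *
    expR (- (beta / 2 * tau)) +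
  expR (- (n%:R * displacement_moment q / tau ^+ q)).
Proof.
move=> q0 tau0.
have b2 : 0 < beta / 2 by rewrite divr_gt0.
pose F d : R := (1 + d)%:R ^+ q.
(* Half of the decay compensates the growth of [G], the other half is summed. *)
have sum_half (K : R) (G : nat -> R) : (forall d, 0 <= G d) ->
    (forall d, G d <= K * expR (beta / 2 * d%:R)) -> 0 <= K ->
    \sum_z p z * G (ndist z.1 z.2) <= 4 * B * (K / (1 - expR (- (beta / 2)))).
  move=> G0 GK K0; apply: (le_trans (sum_pair_le G0)).
  rewrite ler_wpM2l ?mulr_ge0 ?(ltW B_gt0) //.
  apply: (@le_trans _ _ (\sum_(d < n.+1) K * expR (- (beta / 2 * d%:R)))).
    apply: ler_sum => d _.
    have -> : - (beta / 2 * d%:R) = - (beta * d%:R) + beta / 2 * d%:R by lra.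
    by rewrite expRD mulrCA ler_wpM2l ?expR_ge0.
  by rewrite -mulr_sumr ler_wpM2l // sum_expR_le.
apply: (le_trans (@truncated_chernoff R _ p p_ge0 sum_p n
  (fun z => F (ndist z.1 z.2)) (tau ^+ q) (displacement_moment q) _ _ _)).
- by rewrite exprn_gt0.
- by move=> z; rewrite exprn_ge0.
- apply: (le_trans (sum_half (q`!%:R * (2 / beta) ^+ q * expR (beta / 2)) F _ _ _)).
  + by move=> d; rewrite exprn_ge0.
  + move=> d; rewrite -[X in _ <= X]mulrA -expRD.
    have -> : beta / 2 + beta / 2 * d%:R = beta / 2 * (1 + d)%:R.
      by rewrite natrD mulrDr mulr1.
    by have := @exprn_le_expR (1 + d)%:R (beta / 2) q (ler0n _ _) b2 q0; rewrite invf_div.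
  + by rewrite !mulr_ge0 ?expR_ge0 ?exprn_ge0 ?divr_ge0 ?(ltW beta_gt0).
  + by [].
rewrite lerD2r -[leRHS]mulrA ler_wpM2l ?(ltW n0) //.
apply: (le_trans (sum_half (expR (beta / 2) * expR (- (beta / 2 * tau)))
  (fun d => (tau ^+ q < F d)%R%:R) _ _ _)).
- by move=> d; rewrite ler0n.
- move=> d; have [h|_] := ltP; last by rewrite !mulr_ge0 ?expR_ge0.
  have td : tau <= (1 + d)%:R.
    by rewrite leNgt; apply: contraTN h => h; rewrite -leNgt lerXn2r ?nnegrE ?ltW.
  rewrite -!expRD -[leLHS]expR0 ler_expR.
  have := ler_wpM2l (ltW b2) td; rewrite natrD mulrDr mulr1; lra.
- by rewrite mulr_ge0 ?expR_ge0.
- by rewrite le_eqVlt; apply/orP; left; apply/eqP; ring.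
Qed.

Lemma occupation_tail :
  \sum_(a : {ffun 'I_n -> 'I_n.+1 * 'I_n.+1}) (\prod_i p (a i)) *
    (occupation_entropy * n%:R <
      \sum_i ln (occupation fst a (a i).1)%:R)%R%:R <= expR (- n%:R).
Proof.
have mom := @occupation_moment R _ p p_ge0 sum_p _ fst _ marginal_le n.
have M0 := marginal_density_gt0.
have occ0 (a : {ffun 'I_n -> 'I_n.+1 * 'I_n.+1}) i : 0 < (occupation fst a (a i).1)%:R :> R.
  by rewrite ltr0n card_gt0; apply/finset.set0Pn; exists i; rewrite inE.
apply: (@le_trans _ _ (expR (- (occupation_entropy * n%:R)) *
   \sum_(a : {ffun 'I_n -> 'I_n.+1 * 'I_n.+1}) (\prod_i p (a i)) *
    \prod_i (occupation fst a (fst (a i)))%:R)).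
  rewrite mulr_sumr; apply: ler_sum => a _; rewrite mulrCA ler_wpM2l ?prod_p_ge0 //.
  have P0 : 0 <= \prod_i (occupation fst a (a i).1)%:R :> R by rewrite prodr_ge0.
  have [h|_] := ltP; last by rewrite mulr_ge0 ?expR_ge0.
  have -> : \prod_i (occupation fst a (a i).1)%:R =
      expR (\sum_i ln (occupation fst a (a i).1)%:R) :> R.
    by rewrite expR_sum; apply: eq_bigr => i _; rewrite lnK ?posrE.
  by rewrite -expRD -[leLHS]expR0 ler_expR; lra.
apply: (le_trans (ler_wpM2l (expR_ge0 _) mom)).
rewrite [n%:R * (_ / _)]mulrC divfK ?gt_eqF //.
rewrite -[X in expR 1 * X]lnK ?posrE ?addr_gt0 // -expRD -expRM_natl -expRD ler_expR.
by rewrite /occupation_entropy; lra.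
Qed.

(** The hypothesis on w brings the exponent of [dense_moment] below (n + 1) exp (- w / 2), half of
    the threshold, so Markov's inequality leaves the other half. *)
Lemma dense_tail (h : nat) (w : R) : (0 < h)%N ->
  (expR 2 - 1) * (h%:R * marginal_density) <= w / 2 ->
  \sum_(a : {ffun 'I_n -> 'I_n.+1 * 'I_n.+1}) (\prod_i p (a i)) *
    (2 * n.+1%:R * expR (- (w / 2)) <
      \sum_i (w < (occupation (fun z : 'I_n.+1 * 'I_n.+1 => inord (z.1 %/ h) : 'I_n.+1) a
                     (inord ((a i).1 %/ h)))%:R)%R%:R)%R%:R
    <= expR (- (n%:R * expR (- (w / 2)))).
Proof.
move=> h0 hw; set g := fun z : 'I_n.+1 * 'I_n.+1 => inord (z.1 %/ h) : 'I_n.+1.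
have mom := @dense_moment R _ p p_ge0 sum_p _ g _
  (fun b => coarse_marginal_le b h0) n w.
set D := fun a : {ffun 'I_n -> 'I_n.+1 * 'I_n.+1} =>
  \sum_i (w < (occupation g a (g (a i)))%:R)%R%:R : R.
rewrite -/(D _) in mom.
apply: (@le_trans _ _ (expR (- (2 * n.+1%:R * expR (- (w / 2)))) *
   \sum_(a : {ffun 'I_n -> 'I_n.+1 * 'I_n.+1}) (\prod_i p (a i)) * expR (D a))).
  rewrite mulr_sumr; apply: ler_sum => a _; rewrite mulrCA ler_wpM2l ?prod_p_ge0 //.
  rewrite -/(D a); have [hD|_] := ltP; last by rewrite mulr_ge0 ?expR_ge0.
  by rewrite -expRD -[leLHS]expR0 ler_expR; lra.
apply: (le_trans (ler_wpM2l (expR_ge0 _) mom)).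
rewrite card_ord -expRD ler_expR.
set E := expR (n%:R * _ * _ - w).
have EE : E <= expR (- (w / 2)).
  rewrite ler_expR; have -> : n%:R * (expR 2 - 1) * (h%:R * marginal_density / n%:R) =
    (expR 2 - 1) * (h%:R * marginal_density) by field; rewrite gt_eqF.
  lra.
have := ler_wpM2l (ler0n R n.+1) EE; have := expR_ge0 (- (w / 2)).
rewrite -natr1; move: (expR (- (w / 2))) E {EE} => e E; nra.
Qed.

End PairLaw.

(** * Probability of typical configurations *)

Lemma polylog_le (R : realType) (c s kappa D : R) :
  0 < c -> 0 < s -> 1 < kappa ->
  exists n0 : nat, forall n : nat, (0 < n)%N -> (n0 <= n)%N ->
    ln n%:R + D + ln n%:R `^ kappa <= c * n%:R `^ s.
Proof.
move=> c0 s0 k1; have k0 : 0 < kappa by exact: lt_trans k1.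
(* Write n ^ s = n ^ t n ^ t. One factor dominates each summand up to a constant, using ln n <= n ^
   e / e with e kappa = t for the last one; the other factor absorbs the constants. *)
pose t := s / 2; have t0 : 0 < t by rewrite divr_gt0.
pose e := t / kappa; have e0 : 0 < e by rewrite divr_gt0.
have ln_le (u : R) (n : nat) : 0 < u -> (0 < n)%N -> ln n%:R <= u^-1 * n%:R `^ u :> R.
  move=> u0 n0; rewrite ler_pdivlMl // -ln_powR ltW // ln_sublinear //.
  by rewrite powR_gt0 // ltr0n.
pose E := t^-1 + `|D| + e^-1 `^ kappa.
have E0 : 0 < E.
  by rewrite /E ltr_wpDr ?powR_ge0 // ltr_wpDr // invr_gt0.
exists (Num.truncn ((E / c) `^ t^-1)).+1 => n n0 nbig.
have nR : 1 <= n%:R :> R by rewrite ler1n.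
have nt1 : 1 <= n%:R `^ t by rewrite -[X in X <= _](powRr0 n%:R) ler_powR // ltW.
have ln0 : 0 <= ln n%:R :> R by rewrite ln_ge0.
have nt : E / c <= n%:R `^ t.
  have -> : E / c = ((E / c) `^ t^-1) `^ t.
    by rewrite -powRrM mulVf ?gt_eqF // powRr1 // divr_ge0 // ltW.
  apply: ge0_ler_powR; rewrite ?nnegrE ?powR_ge0 ?(ltW t0) //.
  by apply: ltW; apply: lt_le_trans (truncnS_gt _) _; rewrite ler_nat.
have st : n%:R `^ s = n%:R `^ t * n%:R `^ t.
  have -> : s = t + t by rewrite /t; lra.
  by rewrite powRD // [n%:R == 0]gt_eqF ?implybT // ltr0n.
apply: (@le_trans _ _ (E * n%:R `^ t)); last first.
  rewrite st mulrA ler_wpM2r ?powR_ge0 // mulrC -ler_pdivrMr //.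
rewrite /E 2!mulrDl; apply: lerD; first apply: lerD.
- exact: ln_le.
- by apply: (le_trans (ler_norm D)); rewrite ler_peMr.
- have := ln_le _ _ e0 n0; set z := e^-1 => hz.
  apply: (@le_trans _ _ ((z * n%:R `^ e) `^ kappa)).
    apply: ge0_ler_powR; rewrite ?nnegrE ?(ltW k0) //.
    by rewrite mulr_ge0 ?powR_ge0 // invr_ge0 ltW.
  rewrite powRM ?powR_ge0 ?invr_ge0 ?(ltW e0) // -powRrM.
  by rewrite /e divfK // gt_eqF.
Qed.

Section BadEvent.
Context {R : realType}.
Variables (B beta : R) (q n : nat).
Hypotheses (B_gt0 : 0 < B) (beta_gt0 : 0 < beta) (q_gt0 : (0 < q)%N).

Definition typical (h : nat) (w : R) (a : {ffun 'I_n -> 'I_n.+1 * 'I_n.+1}) : bool :=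
  [&& \sum_i (1 + ndist (a i).1 (a i).2)%:R ^+ q <= 4 * displacement_moment B beta q * n%:R,
      \sum_i ln (occupation fst a (a i).1)%:R <= occupation_entropy B beta * n%:R &
      \sum_i (w < (occupation (fun z : 'I_n.+1 * 'I_n.+1 => inord (z.1 %/ h) : 'I_n.+1) a
                     (inord ((a i).1 %/ h)))%:R)%R%:R <= 2 * n.+1%:R * expR (- (w / 2))].

End BadEvent.

Lemma typical_prob (R : realType) (B beta kappa w : R) (q : nat) :
  0 < B -> 0 < beta -> (0 < q)%N -> 1 < kappa ->
  exists n0 : nat, forall n : nat, (0 < n)%N -> (n0 <= n)%N ->
  forall (p : 'I_n.+1 * 'I_n.+1 -> R) (h : nat),
  (forall z, 0 <= p z) -> \sum_z p z = 1 ->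
  (forall z, p z <= B / n%:R * expR (- (beta * (ndist z.1 z.2)%:R))) ->
  (0 < h)%N -> (expR 2 - 1) * (h%:R * marginal_density B beta) <= w / 2 ->
  1 - expR (- ln n%:R `^ kappa) <=
    \sum_(a : {ffun 'I_n -> 'I_n.+1 * 'I_n.+1} | typical B beta q h w a) \prod_i p (a i).
Proof.
move=> B0 beta0 q0 k1.
have m0 := displacement_moment_gt0 B0 beta0 q; set m := displacement_moment _ _ _ in m0 *.
have b2 : 0 < beta / 2 by rewrite divr_gt0.
pose E1 := 4 * B * expR (beta / 2) / (1 - expR (- (beta / 2))).
have E10 : 0 < E1.
  by rewrite divr_gt0 ?mulr_gt0 ?expR_gt0 // subr_gt0; case/andP: (expRN01 b2).
have qR : 0 < q%:R :> R by rewrite ltr0n.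
have s1 : 0 < (2 * q%:R)^-1 :> R by rewrite invr_gt0 mulr_gt0.
have [n1 h1] := polylog_le (ln E1 + ln 4) b2 s1 k1.
have half0 : 0 < 2^-1 :> R by rewrite invr_gt0.
have [n2 h2] := polylog_le (ln 4) m0 half0 k1.
have [n3 h3] := polylog_le (ln 4) (@ltr01 R) (@ltr01 R) k1.
have [n4 h4] := polylog_le (ln 4) (expR_gt0 (- (w / 2))) (@ltr01 R) k1.
exists (maxn (maxn n1 n2) (maxn n3 n4)) => n n0.
rewrite !geq_max => /andP[/andP[/(h1 _ n0) {}h1 /(h2 _ n0) {}h2] /andP[/(h3 _ n0) {}h3 /(h4 _ n0) {}h4]].
move=> p h p0 sum_p decay h0 hw.
have nR : 0 < n%:R :> R by rewrite ltr0n.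
have ln0 : 0 <= ln n%:R :> R by rewrite ln_ge0 // ler1n.
(* This choice makes both terms of [displacement_tail] small: their exponents are of order n ^ (1 /
   (2 q)) and n ^ (1 / 2). *)
pose tau : R := n%:R `^ (2 * q%:R)^-1.
have tau0 : 0 < tau by rewrite powR_gt0.
have tauq : n%:R / tau ^+ q = n%:R `^ 2^-1 :> R.
  rewrite -powR_mulrn ?(ltW tau0) // /tau -powRrM invfM -mulrA mulVf ?gt_eqF // mulr1.
  have {1}-> : n%:R = n%:R `^ 2^-1 * n%:R `^ 2^-1 :> R.
    rewrite -powRD; last by rewrite [n%:R == 0]gt_eqF ?implybT.
    by rewrite (_ : 2^-1 + 2^-1 = 1) ?powRr1 ?(ltW nR) //; lra.
  by rewrite mulfK // gt_eqF // powR_gt0.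
have t1 := displacement_tail B0 beta0 n0 p0 sum_p decay q0 tau0.
have t2 := occupation_tail B0 beta0 n0 p0 sum_p decay.
have t3 := dense_tail B0 beta0 n0 p0 sum_p decay h0 hw.
set S1 := \sum_(a | _) _ in t1; set S2 := \sum_(a | _) _ in t2; set S3 := \sum_(a | _) _ in t3.
set e := expR (- _ `^ kappa).
(* Four error terms, two of them from the displacements, each allowed a quarter of the target. *)
have quarter x : x + ln 4 + ln n%:R `^ kappa <= 0 -> expR x <= e / 4.
  move=> hx; rewrite -[X in e / X]lnK ?posrE // -expRN -expRD ler_expR; lra.
have q1 : n%:R * E1 * expR (- (beta / 2 * tau)) <= e / 4.
  rewrite -[X in X * _ * _]lnK ?posrE // -[X in _ * X * _]lnK ?posrE // -!expRD.
  by apply: quarter; rewrite /tau; lra.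
have q2 : expR (- (n%:R * m / tau ^+ q)) <= e / 4.
  by apply: quarter; rewrite mulrAC tauq; lra.
have q3 : expR (- n%:R) <= e / 4.
  by apply: quarter; move: h3; rewrite mul1r powRr1 //; lra.
have q4 : expR (- (n%:R * expR (- (w / 2)))) <= e / 4.
  by apply: quarter; move: h4; rewrite powRr1 //; lra.
have total : \sum_(a : {ffun 'I_n -> 'I_n.+1 * 'I_n.+1}) \prod_i p (a i) = 1.
  by rewrite -(bigA_distr_bigA (fun _ z => p z)) prodr_const sum_p expr1n.
move: total; rewrite (bigID (@typical R B beta q n h w)) /=.
set G := \sum_(a | _) _; set U := \sum_(a | _) _ => total.
suff : U <= S1 + S2 + S3 by rewrite -/m -/E1 in t1; move: total t1 t2 t3 q1 q2 q3 q4; lra.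
rewrite /S1 /S2 /S3 -!big_split /= /U big_mkcond; apply: ler_sum => a _.
have P0 := prod_p_ge0 p0 a; rewrite -!mulrDr.
case: ifP => [|_]; last by rewrite mulr_ge0 // !addr_ge0.
rewrite -[leLHS]mulr1 => bad; rewrite ler_wpM2l //.
move: bad; rewrite /typical !negb_and -!ltNge => /orP[->|/orP[->|->]].
- by rewrite -addrA lerDl addr_ge0.
- by rewrite addrAC lerDr addr_ge0.
- by rewrite lerDr addr_ge0.
Qed.

(** * The bound on typical configurations *)

Lemma truncn_dist (R : realType) (x y : R) : 0 <= x -> 0 <= y ->
  (ndist (Num.truncn x) (Num.truncn y))%:R - 1 <= `|x - y|
    <= 1 + (ndist (Num.truncn x) (Num.truncn y))%:R.
Proof.
move=> /truncn_itv; move: (Num.truncn x) => u /andP[ux xu].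
move=> /truncn_itv; move: (Num.truncn y) => v /andP[vy yv].
rewrite -!natr1 in xu yv.
have e : (ndist u v)%:R = `|u%:R - v%:R| :> R.
  rewrite /ndist; have [uv|vu] := leqP u v.
    have -> : (u - v = 0)%N by apply/eqP; rewrite subn_eq0.
    by rewrite add0n natrB // distrC ger0_norm // subr_ge0 ler_nat.
  have -> : (v - u = 0)%N by apply/eqP; rewrite subn_eq0 ltnW.
  by rewrite addn0 natrB ?(ltnW vu) // ger0_norm // subr_ge0 ler_nat ltnW.
by rewrite e; have [?|?] := ger0P (x - y); have [?|?] := ger0P (u%:R - v%:R : R);
  apply/andP; split; lra.
Qed.

Lemma powR_ge_sub1 (R : realType) (x a : R) : 0 <= x -> 1 <= a -> x - 1 <= x `^ a.
Proof.
move=> x0 a1; have [x1|x1] := leP 1 x; first by have := le1r_powR x1 a1; lra.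
by apply: le_trans (powR_ge0 _ _); lra.
Qed.

Lemma powR_le_1Dexprn (R : realType) (x b : R) (q : nat) :
  0 <= x -> 0 <= b -> b <= q%:R -> x `^ b <= 1 + x ^+ q.
Proof.
move=> x0 b0 bq; have [x1|/ltW x1] := leP x 1.
  apply: (@le_trans _ _ 1); last by rewrite lerDl exprn_ge0.
  have <- : 1 `^ b = 1 :> R by rewrite powR1.
  by rewrite ge0_ler_powR ?nnegrE.
by rewrite -powR_mulrn //; apply: ler_wpDl => //; rewrite ler_powR.
Qed.

Lemma card_set_perm (T : finType) (P : pred T) (s : {perm T}) :
  #|[set j | P (s j)]| = #|[set j | P j]|.
Proof.
rewrite -(card_imset _ (@perm_inj _ s)); apply: eq_card => j; rewrite inE.
apply/imsetP/idP => [[i + ->]|Pj]; first by rewrite inE.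
by exists (s^-1%g j); rewrite ?inE permKV.
Qed.

Lemma fact_le_expR (R : realType) (k : nat) : k`!%:R <= expR (k%:R * k%:R) :> R.
Proof.
rewrite expRM_natl; apply: (@le_trans _ _ (k%:R ^+ k)).
  rewrite -natrX ler_nat; elim: k => // k IH; rewrite factS expnS leq_mul //.
  by apply: (leq_trans IH); case: k {IH} => // k; rewrite leq_exp2r.
rewrite lerXn2r ?nnegrE ?expR_ge0 //.
by apply: le_trans (expR_ge1Dx _); rewrite lerDr.
Qed.

(** This is ln u <= u at u = b L / delta, multiplied by delta. *)
Lemma powR_le_expR (R : realType) (L delta b : R) : 0 < L -> 0 < delta -> 0 < b ->
  expR (- (b * L)) <= expR (delta * ln (delta / b)) * L `^ (- delta).
Proof.
move=> L0 d0 b0; rewrite /powR gt_eqF // -expRD ler_expR.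
have u0 : 0 < L / (delta / b) by rewrite !divr_gt0.
have := ltW (ln_sublinear u0).
rewrite ln_div ?posrE ?divr_gt0 // => h.
have := ler_wpM2l (ltW d0) h.
rewrite mulrBr [X in _ <= X](_ : _ = b * L); last by field; rewrite !gt_eqF.
lra.
Qed.

Section Deterministic.
Context {R : realType}.
Variables (V : R -> R) (C0 c0 delta Vmin : R) (g : R -> R).
Hypotheses (C0_gt0 : 0 < C0) (c0_gt0 : 0 < c0) (delta_gt0 : 0 < delta).
Hypothesis g_incr : forall u v : R, 0 <= u -> u <= v -> g u <= g v.
Hypothesis g_poly : forall e : R, g `|e| <= C0 * (1 + `|e| `^ C0).
Hypothesis V_le : forall e : R, V e - Vmin <= g `|e|.
Hypothesis V_ge : forall e : R, c0 * `|e| `^ (1 + delta) <= V e - Vmin.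
Variables (n : nat) (Xb Yb : 'I_n -> R) (pi : {perm 'I_n}).
Variable (a : {ffun 'I_n -> 'I_n.+1 * 'I_n.+1}).
Hypotheses (n_gt0 : (0 < n)%N).
Hypotheses (Xb01 : forall i, 0 <= Xb i <= 1) (Yb01 : forall i, 0 <= Yb i <= 1).
Hypotheses (Xb_inj : injective Xb) (Yb_inj : injective Yb).
Hypothesis a_X : forall i, (a i).1 = Num.truncn (n%:R * Xb i) :> nat.
Hypothesis a_Y : forall i, (a i).2 = Num.truncn (n%:R * Yb i) :> nat.

Let X i := Xb (pi i).
Let s := sorting_perm X.
Let t := sorting_perm Yb.
Let x k := n%:R * X (s k).
Let y k := n%:R * Yb (t k).
Let c := sorted_cost V X Yb Vmin.
(** The index of the original pair whose X-point has rank k. *)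
Let sigma : {perm 'I_n} := (s * pi)%g.

Let n0 : 0 < n%:R :> R. Proof. by rewrite ltr0n. Qed.

Let X_inj : injective X. Proof. by move=> i j /Xb_inj/perm_inj. Qed.

Let xE k : x k = n%:R * Xb (sigma k). Proof. by rewrite /x /X permM. Qed.

Let x_incr (k l : 'I_n) : (k < l)%N -> x k < x l.
Proof. by move=> kl; rewrite ltr_pM2l // sorting_perm_lt. Qed.

Let y_incr (k l : 'I_n) : (k < l)%N -> y k < y l.
Proof. by move=> kl; rewrite ltr_pM2l // sorting_perm_lt. Qed.

Let x_ge0 k : 0 <= x k.
Proof. by rewrite xE mulr_ge0 //; case/andP: (Xb01 (sigma k)). Qed.

Let y_ge0 k : 0 <= y k.
Proof. by rewrite mulr_ge0 //; case/andP: (Yb01 (t k)). Qed.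

Let x_len k : x k <= n%:R.
Proof. by rewrite xE -[leRHS]mulr1 ler_wpM2l //; case/andP: (Xb01 (sigma k)). Qed.

Let y_len k : y k <= n%:R.
Proof. by rewrite -[leRHS]mulr1 ler_wpM2l //; case/andP: (Yb01 (t k)). Qed.

Let cE k l : c k l = V (x k - y l) - Vmin.
Proof. by rewrite /c /sorted_cost mulrBr. Qed.

Let ux k : 'I_n.+1 := inord (Num.truncn (x k)).
Let uy l : 'I_n.+1 := inord (Num.truncn (y l)).

Let truncn_ltn (z : R) : 0 <= z -> z <= n%:R -> (Num.truncn z < n.+1)%N.
Proof.
by move=> z0 zn; rewrite ltnS -(ler_nat R) (le_trans _ zn) // truncn_le.
Qed.

Let uxE k : ux k = (a (sigma k)).1.
Proof. by apply: val_inj; rewrite /= /ux inordK ?truncn_ltn // a_X xE. Qed.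

(** If the integer parts are d apart, the cost is at least c0 (d - 2), hence exp (- cost / 2) <= A z
    ^ d. *)
Let A : R := expR c0.
Let z : R := expR (- (c0 / 2)).

Let c_ge k l : c0 * (`|x k - y l| - 1) <= c k l.
Proof.
rewrite cE; apply: le_trans (V_ge _); rewrite ler_wpM2l ?(ltW c0_gt0) //.
by rewrite powR_ge_sub1 // lerDl ltW.
Qed.

Let c_ge0 k l : 0 <= c k l.
Proof.
by rewrite cE; apply: le_trans (V_ge _); rewrite mulr_ge0 ?powR_ge0 // ltW.
Qed.

Let kernel_le k l : expR (- (c k l / 2)) <= A * z ^+ ndist (ux k) (uy l).
Proof.
rewrite /A /z -expRM_natl -expRD ler_expR.
rewrite /ux /uy !inordK ?truncn_ltn //.
have /andP[d _] := truncn_dist (x_ge0 k) (y_ge0 l).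
have := ler_wpM2l (ltW c0_gt0) d; have := c_ge k l.
by move: (ndist _ _)%:R => D; lra.
Qed.

Let sum_ln_le : \sum_k ln (1 + \sum_l expR (- (c k l / 2))) <=
  \sum_i ln (occupation fst a (a i).1)%:R + n.+1%:R + A * (2 / (1 - z)) * n%:R.
Proof.
have z01 : 0 <= z < 1 by apply: expRN01; rewrite divr_gt0.
have A0 : 0 <= A by exact: expR_ge0.
apply: (@le_trans _ _ (\sum_k ln (1 + A * \sum_l z ^+ ndist (ux k) (uy l)))).
  apply: ler_sum => k _; rewrite ler_ln ?posrE.
  - by rewrite lerD2l mulr_sumr; apply: ler_sum => l _; exact: kernel_le.
  - by rewrite ltr_wpDr // sumr_ge0 // => l _; exact: expR_ge0.
  - rewrite ltr_wpDr // mulr_ge0 // sumr_ge0 // => l _.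
    by rewrite exprn_ge0 //; case/andP: z01.
apply: (le_trans (sum_ln_row_le _ _ A0 z01)); rewrite !lerD2r.
rewrite [leRHS](reindex_inj (@perm_inj _ sigma)) /=; apply: ler_sum => k _.
rewrite (_ : #|_| = occupation fst a (a (sigma k)).1) // /occupation.
rewrite -(card_set_perm (fun j => (a j).1 == (a (sigma k)).1) sigma).
by apply: eq_card => j; rewrite !inE !uxE.
Qed.

(** In rank coordinates the true matching is [sigma] followed by the inverse of [t]. The sorted
    matching has no larger sum of q-th powers, and the true one is bounded through the integer
    parts. *)
Let sum_diag_le (q : nat) : (0 < q)%N -> C0 <= q%:R ->
  \sum_k c k k <= C0 * (2 * n%:R +
    \sum_i (1 + ndist (a i).1 (a i).2)%:R ^+ q).
Proof.
move=> q0 C0q; apply: (@le_trans _ _ (C0 * \sum_k (2 + `|x k - y k| ^+ q))).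
  rewrite mulr_sumr; apply: ler_sum => k _; rewrite cE.
  apply: (le_trans (V_le _)); apply: (le_trans (g_poly _)).
  rewrite ler_wpM2l ?(ltW C0_gt0) //.
  have := powR_le_1Dexprn (normr_ge0 (x k - y k)) (ltW C0_gt0) C0q; lra.
rewrite ler_wpM2l ?(ltW C0_gt0) // big_split /= sumr_const card_ord mulr_natr lerD2l.
pose p : {perm 'I_n} := (sigma * t^-1)%g.
apply: (le_trans (sorted_matching_le p q0 x_incr y_incr)).
rewrite [leRHS](reindex_inj (@perm_inj _ sigma)) /=; apply: ler_sum => k _.
rewrite lerXn2r ?nnegrE //.
have -> : y (p k) = n%:R * Yb (sigma k) by rewrite /y /p [X in t X]permM permKV.
rewrite xE a_X a_Y natrD.
have xs : 0 <= n%:R * Xb (sigma k) by rewrite mulr_ge0 //; case/andP: (Xb01 (sigma k)).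
have ys : 0 <= n%:R * Yb (sigma k) by rewrite mulr_ge0 //; case/andP: (Yb01 (sigma k)).
by case/andP: (truncn_dist xs ys).
Qed.

Let sum_energy_le (q : nat) : (0 < q)%N -> C0 <= q%:R ->
  \sum_k energy c k <=
  \sum_i ln (occupation fst a (a i).1)%:R + n.+1%:R + A * (2 / (1 - z)) * n%:R +
  C0 * (2 * n%:R + \sum_i (1 + ndist (a i).1 (a i).2)%:R ^+ q).
Proof.
by move=> q0 C0q; rewrite big_split /= lerD ?sum_ln_le ?sum_diag_le.
Qed.

Let sum_dense_le (h : nat) (w : R) : \sum_k (dense x h w k)%:R =
  \sum_i (w < (occupation (fun z : 'I_n.+1 * 'I_n.+1 => inord (z.1 %/ h) : 'I_n.+1) a
                     (inord ((a i).1 %/ h)))%:R)%R%:R :> R.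
Proof.
rewrite [RHS](reindex_inj (@perm_inj _ sigma)) /=; apply: eq_bigr => k _.
have cellE j : cell_of x h j = inord ((a (sigma j)).1 %/ h).
  by rewrite /cell_of a_X -xE.
rewrite /dense cellE; congr ((_ < _%:R)%R%:R).
rewrite /occupation -(card_set_perm (fun j => inord ((a j).1 %/ h) == _) sigma).
by apply: eq_card => j; rewrite !inE cellE.
Qed.

(* [Q] comes from [stretch <= Q c] and [r] is the probability, up to the
   constant in the exponent, that a sparse cell is cut for both laws. *)
Lemma mean_TV_le_sum (q h M N : nat) (w G r : R) : (0 < q)%N -> C0 <= q%:R ->
  (0 < h)%N -> (0 < N)%N -> (0 < M)%N -> 0 <= w -> 6 * N%:R * w <= M%:R ->
  g h%:R <= G -> 0 < r < 1 ->
  (forall k : nat, k%:R <= w -> r * (k`!%:R * expR (k%:R * G)) ^+ 2 <= 1) ->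
  n%:R * mean_TV V X Yb M <=
  2 * M%:R + 2 * n%:R * (1 - r) ^+ N +
  6 * (\sum_i (w < (occupation (fun z : 'I_n.+1 * 'I_n.+1 => inord (z.1 %/ h) : 'I_n.+1) a
                     (inord ((a i).1 %/ h)))%:R)%R%:R) +
  20 * (M%:R / N%:R) * (2 * (4 / h%:R) `^ (1 + delta) / c0) *
  (\sum_i ln (occupation fst a (a i).1)%:R + n.+1%:R + A * (2 / (1 - z)) * n%:R +
   C0 * (2 * n%:R + \sum_i (1 + ndist (a i).1 (a i).2)%:R ^+ q)).
Proof.
move=> q0 C0q h0 N0 M0 w0 NwM gG /andP[r0 r1] rG.
have hR : 0 < h%:R :> R by rewrite ltr0n.
set Q := 2 * (4 / h%:R) `^ (1 + delta) / c0.
have Q0 : 0 <= Q by rewrite divr_ge0 ?mulr_ge0 ?powR_ge0 // ltW.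
have G0 : 0 <= G.
  apply: le_trans gG; apply: le_trans (g_incr (lexx 0) (ltW hR)).
  by have := le_trans (V_ge 0) (V_le 0); rewrite normr0; apply: le_trans; rewrite mulr_ge0 ?powR_ge0 // ltW.
have cQ k l : stretch h (1 + delta) (x k) (y l) <= Q * c k l.
  rewrite /stretch mulrAC powRM ?divr_ge0 ?(ltW hR) // /Q cE.
  rewrite [leRHS](_ : _ = 2 * (4 / h%:R) `^ (1 + delta) * ((V (x k - y l) - Vmin) / c0));
    last by ring.
  rewrite mulrA ler_wpM2l ?mulr_ge0 ?powR_ge0 //.
  by rewrite ler_pdivlMr // mulrC.
have cG k l : `|x k - y l| <= h%:R -> c k l <= G.
  by move=> d; rewrite cE (le_trans (V_le _)) // (le_trans _ gG) // g_incr.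
rewrite (mean_TV_sorted V X Yb Vmin M) [leLHS]mulVKf ?gt_eqF //.
have a1 : 1 <= 1 + delta by rewrite lerDl ltW.
apply: (le_trans (sum_TV_le x_incr x_ge0 x_len h0 a1 c_ge0 cQ cG G0 Q0 r0 r1 rG
  N0 M0 w0 NwM)).
rewrite sum_dense_le lerD2l ler_wpM2l ?sum_energy_le //.
by apply: mulr_ge0 => //; apply: mulr_ge0 => //; rewrite divr_ge0.
Qed.

End Deterministic.

(** Cells have length h, the integer part of L / H, which needs L >= H to be positive; for smaller L
    the constant C makes the bound at least 1. *)
Lemma mean_TV_typical (R : realType) (V : R -> R)
    (C0 c0 delta Vmin Lmin B : R) (g : R -> R) :
  0 < C0 -> 0 < c0 -> 0 < delta -> 0 < Lmin -> 0 < B ->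
  (forall u v : R, 0 <= u -> u <= v -> g u <= g v) ->
  (forall e : R, g `|e| <= C0 * (1 + `|e| `^ C0)) ->
  (forall e : R, V e - Vmin <= g `|e|) ->
  (forall e : R, c0 * `|e| `^ (1 + delta) <= V e - Vmin) ->
  exists C H : R, [/\ 0 < C, 0 < H,
    forall L : R, 1 <= L -> L < H -> 1 <= C * L `^ (- delta) &
    forall (K L : R) (M : nat), 1 <= K -> 1 <= L -> M%:R = K * L -> H <= L ->
    [/\ (0 < Num.truncn (L / H))%N,
      (expR 2 - 1) * ((Num.truncn (L / H))%:R * marginal_density B c0) <= L / 24 / 2 &
      exists n0 : nat, forall n : nat, (0 < n)%N -> (n0 <= n)%N ->
      forall (Xb Yb : 'I_n -> R) (pi : {perm 'I_n})
        (a : {ffun 'I_n -> 'I_n.+1 * 'I_n.+1}),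
      (forall i, 0 <= Xb i <= 1) -> (forall i, 0 <= Yb i <= 1) ->
      injective Xb -> injective Yb ->
      (forall i, (a i).1 = Num.truncn (n%:R * Xb i) :> nat) ->
      (forall i, (a i).2 = Num.truncn (n%:R * Yb i) :> nat) ->
      typical B c0 (Num.truncn C0).+1 (Num.truncn (L / H)) (L / 24) a ->
      mean_TV V (fun i => Xb (pi i)) Yb M <=
      C * L `^ (- delta) + C * (1 - expR (- (C * L * g (4 * L / Lmin)))) `^ (K / 3)]].
Proof.
move=> C0_gt0 c0_gt0 d_gt0 Lm_gt0 B_gt0 g_incr g_poly V_le V_ge.
set q := (Num.truncn C0).+1.
have C0q : C0 <= q%:R by apply: ltW; exact: truncnS_gt.
have B2_gt0 := marginal_density_gt0 B_gt0 c0_gt0.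
set B2 := marginal_density B c0 in B2_gt0 *.
have e21 : 0 <= expR 2 - 1 :> R by rewrite subr_ge0 -[X in X <= _]expR0 ler_expR.
(* The summand Lmin gives h <= 4 L / Lmin and Lmin <= L; the last one makes the mean occupation of a
   cell small against w = L / 24, as [dense_tail] requires. *)
pose H : R := 1 + Lmin + 48 * (expR 2 - 1) * B2.
have eB : 0 <= (expR 2 - 1) * B2 by rewrite mulr_ge0 // ltW.
have H_ge1 : 1 <= H by rewrite /H; lra.
have H_gt0 : 0 < H by exact: lt_le_trans H_ge1.
pose z : R := expR (- (c0 / 2)).
have z01 : 0 <= z < 1 by apply: expRN01; rewrite divr_gt0.
have m_gt0 := displacement_moment_gt0 B_gt0 c0_gt0 q.
set m := displacement_moment B c0 q in m_gt0 *.
set k2 := occupation_entropy B c0.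
have k2_ge0 : 0 <= k2.
  by rewrite addr_ge0 // ln_ge0 // lerDl ltW.
pose A2 : R := expR c0 * (2 / (1 - z)).
have A2_ge0 : 0 <= A2.
  by rewrite mulr_ge0 ?expR_ge0 // divr_ge0 // subr_ge0 ltW //; case/andP: z01.
pose CS := k2 + 2 + A2 + C0 * (2 + 4 * m).
have CS_ge0 : 0 <= CS.
  have : 0 <= C0 * (2 + 4 * m) by rewrite mulr_ge0 ?(ltW C0_gt0) //; lra.
  by rewrite /CS; lra.
(* The summand 1 pays for the energy exp (k G) of a surgery, the other one for the factorial. *)
pose C1 := 1 + Lmin / (4 * c0).
have C1_ge1 : 1 <= C1 by rewrite lerDl divr_ge0 ?mulr_ge0 // ltW.
pose CE := expR (delta * ln (delta / 48^-1)).
have CE_ge0 : 0 <= CE by exact: expR_ge0.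
pose CQ := 40 * (8 * H) `^ (1 + delta) / c0 * CS.
have CQ_ge0 : 0 <= CQ.
  by rewrite mulr_ge0 // divr_ge0 ?mulr_ge0 ?powR_ge0 // ltW.
have Hd_ge0 : 0 <= H `^ delta by exact: powR_ge0.
pose C := C1 + H `^ delta + 3 + 24 * CE + CQ.
have C_gt0 : 0 < C by rewrite /C; lra.
exists C, H; split=> // [L L1 LH|K L M K1 L1 MKL HL].
  have L0 : 0 < L by exact: lt_le_trans L1.
  rewrite powRN ler_pdivlMr ?powR_gt0 // mul1r.
  apply: (@le_trans _ _ (H `^ delta)); last by rewrite /C; lra.
  by apply: ge0_ler_powR; rewrite ?nnegrE ?(ltW L0) ?(ltW H_gt0) ?(ltW d_gt0) // ltW.
have L0 : 0 < L by exact: lt_le_trans L1.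
have K0 : 0 < K by exact: lt_le_trans K1.
have LH1 : 1 <= L / H by rewrite ler_pdivlMr // mul1r.
set h := Num.truncn (L / H).
have h_gt0 : (0 < h)%N by rewrite /h truncn_gt0.
have hR : 0 < h%:R :> R by rewrite ltr0n.
have /andP[h_le h_lt] : h%:R <= L / H < h.+1%:R by apply: truncn_itv; exact: le_trans LH1.
have h_ge : L / (2 * H) <= h%:R.
  have : 1 <= h%:R :> R by rewrite ler1n.
  have -> : L / (2 * H) = L / H / 2 by field; rewrite gt_eqF.
  by move: h_lt; rewrite -natr1; lra.
split=> //.
  have : h%:R * H <= L by rewrite -ler_pdivlMr.
  have hB : 0 <= h%:R * ((expR 2 - 1) * B2) by rewrite mulr_ge0.
  have hL : 0 <= h%:R * (1 + Lmin) by rewrite mulr_ge0 //; lra.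
  rewrite [h%:R * H](_ : _ = h%:R * (1 + Lmin) + 48 * (h%:R * ((expR 2 - 1) * B2)));
    last by rewrite /H; ring.
  by rewrite mulrCA; lra.
pose w : R := L / 24; have w_ge0 : 0 <= w by rewrite divr_ge0 // ltW.
(* From N <= 2 K follows 6 N w = N L / 4 <= M; from K <= N follow M / N <= L and N >= K / 3. *)
pose N := (Num.truncn K).+1.
have KN : K <= N%:R by apply: ltW; exact: truncnS_gt.
have N2K : N%:R <= 2 * K.
  have : (Num.truncn K)%:R <= K by rewrite truncn_le ltW.
  by rewrite /N -natr1; lra.
have N0 : 0 < N%:R :> R by rewrite ltr0n.
have M_gt0 : (0 < M)%N by rewrite -(ltr0n R) MKL mulr_gt0.
have NwM : 6 * N%:R * w <= M%:R.
  rewrite MKL /w [leLHS](_ : _ = N%:R * L / 4); last by lra.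
  have := ler_wpM2r (ltW L0) N2K; have := mulr_gt0 K0 L0; lra.
pose e := 4 * L / Lmin.
have LmL : Lmin <= L by apply: le_trans HL; rewrite /H; lra.
have e1 : 1 <= e by rewrite /e ler_pdivlMr // mul1r; lra.
have e0 : 0 <= e by exact: le_trans e1.
pose G := g e.
have G_ge : c0 * e <= G.
  have := le_trans (V_ge e) (V_le e); rewrite ger0_norm //; apply: le_trans.
  by rewrite ler_wpM2l ?(ltW c0_gt0) // le1r_powR // lerDl ltW.
have G_gt0 : 0 < G by apply: lt_le_trans G_ge; rewrite mulr_gt0 // (lt_le_trans ltr01).
have gG : g h%:R <= G.
  apply: g_incr; first exact: ltW.
  apply: (le_trans h_le); rewrite /e ler_pdivrMr //.
  have -> : 4 * L / Lmin * H = L * (4 * (H / Lmin)) by ring.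
  rewrite ler_peMr ?(ltW L0) //.
  have : 1 <= H / Lmin by rewrite ler_pdivlMr // mul1r /H; lra.
  by lra.
(* The crude bound k! <= exp (k ^ 2) costs order L ^ 2 in the exponent; as G grows at least linearly
   in L, this is again of order L G. *)
have LG : L * L <= Lmin / (4 * c0) * (L * G).
  have hh : 0 <= Lmin / (4 * c0) * L by rewrite mulr_ge0 ?divr_ge0 ?mulr_ge0 // ltW.
  have := ler_wpM2l hh G_ge.
  rewrite [leLHS](_ : _ = L * L); first by rewrite -[leRHS]mulrA.
  by rewrite /e; field; rewrite !gt_eqF.
pose r := expR (- (C1 * L * G)).
have C1LG : 0 < C1 * L * G by rewrite !mulr_gt0 // (lt_le_trans ltr01).
have r01 : 0 < r < 1 by rewrite expR_gt0 -[X in _ < X]expR0 ltr_expR oppr_lt0.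
have rG (k : nat) : k%:R <= w -> r * (k`!%:R * expR (k%:R * G)) ^+ 2 <= 1.
  move=> kw; have k0 : 0 <= k%:R :> R by [].
  apply: (@le_trans _ _ (r * (expR (k%:R * k%:R) * expR (k%:R * G)) ^+ 2)).
    rewrite ler_wpM2l ?expR_ge0 // lerXn2r ?nnegrE ?mulr_ge0 ?expR_ge0 //.
    by rewrite ler_wpM2r ?expR_ge0 // fact_le_expR.
  rewrite -expRD -expRM_natl -expRD -[leRHS]expR0 ler_expR /C1.
  have kk : k%:R * k%:R <= w * w by apply: ler_pM.
  have kG : k%:R * G <= w * G by rewrite ler_wpM2r // ltW.
  have LL : 0 <= L * L by rewrite mulr_ge0 // ltW.
  have LG0 : 0 <= L * G by rewrite mulr_ge0 // ltW.
  have -> : (1 + Lmin / (4 * c0)) * L * G = L * G + Lmin / (4 * c0) * (L * G) by ring.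
  have ww : w * w = L * L / 576 by rewrite /w; lra.
  have wG : w * G = L * G / 24 by rewrite /w; lra.
  by rewrite ww in kk; rewrite wG in kG; lra.
(* From here on the boundary ranks are negligible: 2 M <= n L ^ - delta. *)
exists (Num.truncn (2 * M%:R * L `^ delta)).+1 => n n_gt0 n_big.
move=> Xb Yb pi a Xb01 Yb01 Xinj Yinj aX aY /and3P[typ1 typ2 typ3].
have nR : 0 < n%:R :> R by rewrite ltr0n.
have nR1 : 1 <= n%:R :> R by rewrite ler1n.
pose T1 : R := \sum_i (1 + ndist (a i).1 (a i).2)%:R ^+ q.
pose T2 : R := \sum_i ln (occupation fst a (a i).1)%:R.
pose T3 : R := \sum_i (w < (occupation (fun z : 'I_n.+1 * 'I_n.+1 => inord (z.1 %/ h) : 'I_n.+1) a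
                     (inord ((a i).1 %/ h)))%:R)%R%:R.
rewrite -/T1 -/m in typ1; rewrite -/T2 -/k2 in typ2; rewrite -/w -/T3 in typ3.
pose Q := 2 * (4 / h%:R) `^ (1 + delta) / c0.
pose mTV := mean_TV V (fun i => Xb (pi i)) Yb M.
have main : n%:R * mTV <= 2 * M%:R + 2 * n%:R * (1 - r) ^+ N + 6 * T3 +
    20 * (M%:R / N%:R) * Q * (T2 + n.+1%:R + A2 * n%:R + C0 * (2 * n%:R + T1)).
  exact: (mean_TV_le_sum C0_gt0 c0_gt0 d_gt0 g_incr g_poly V_le V_ge pi n_gt0
    Xb01 Yb01 Xinj Yinj aX aY (ltn0Sn _) C0q h_gt0 (ltn0Sn _) M_gt0
    w_ge0 NwM gG r01 rG).
rewrite -/mTV -/e -/G.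
have Q_ge0 : 0 <= Q by rewrite divr_ge0 ?mulr_ge0 ?powR_ge0 // ltW.
have MN : M%:R / N%:R <= L by rewrite ler_pdivrMr // MKL mulrC ler_wpM2l // ltW.
have S_le : T2 + n.+1%:R + A2 * n%:R + C0 * (2 * n%:R + T1) <= CS * n%:R.
  have : C0 * (2 * n%:R + T1) <= C0 * (2 * n%:R + 4 * m * n%:R).
    by rewrite ler_wpM2l ?(ltW C0_gt0) // lerD2l.
  by rewrite /CS -natr1; lra.
have T3_le : T3 <= 4 * n%:R * expR (- (w / 2)).
  apply: (le_trans typ3); rewrite ler_wpM2r ?expR_ge0 // -natr1; lra.
(* M / N is at most L and Q is of order h ^ - (1 + delta), with h >= L / (2 H); the product is of
   order L ^ - delta. *)
have Q_le : 20 * (M%:R / N%:R) * Q * CS <= CQ * L `^ (- delta).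
  have LQ : L * (4 / h%:R) `^ (1 + delta) <= (8 * H) `^ (1 + delta) * L `^ (- delta).
    have -> : L `^ (- delta) = L * L^-1 `^ (1 + delta).
      rewrite -powR_inv1 ?(ltW L0) // -powRrM -[X in X * _](powRr1 (ltW L0)) -powRD.
        by congr (_ `^ _); lra.
      by rewrite [L == 0]gt_eqF ?implybT.
    rewrite mulrCA -powRM ?invr_ge0 ?mulr_ge0 ?(ltW L0) ?(ltW H_gt0) //.
    rewrite ler_wpM2l ?(ltW L0) //.
    apply: ge0_ler_powR; rewrite ?nnegrE ?divr_ge0 ?mulr_ge0 ?invr_ge0 ?(ltW L0) ?(ltW H_gt0) ?(ltW hR) //.
      by rewrite addr_ge0 // ltW.
    rewrite ler_pdivrMr // -ler_pdivrMl ?divr_gt0 ?mulr_gt0 ?invr_gt0 //.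
    apply: le_trans h_ge; rewrite le_eqVlt; apply/orP; left; apply/eqP; field.
    by rewrite !gt_eqF.
  apply: (@le_trans _ _ (20 * L * Q * CS)).
    rewrite !(ler_wpM2r CS_ge0) // ler_wpM2r // ler_wpM2l //.
  rewrite [leLHS](_ : _ = 40 * (L * (4 / h%:R) `^ (1 + delta)) / c0 * CS); last by rewrite /Q; ring.
  rewrite /CQ [leRHS](_ : _ = 40 * ((8 * H) `^ (1 + delta) * L `^ (- delta)) / c0 * CS);
    last by ring.
  rewrite ler_wpM2r // ler_wpM2r ?invr_ge0 ?(ltW c0_gt0) // ler_wpM2l //.
have E_le : expR (- (w / 2)) <= CE * L `^ (- delta).
  have b48 : 0 < 48^-1 :> R by rewrite invr_gt0.
  have := powR_le_expR L0 d_gt0 b48.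
  by rewrite (_ : w / 2 = 48^-1 * L) //; rewrite /w; lra.
have n_le : 2 * M%:R <= n%:R * L `^ (- delta).
  rewrite powRN ler_pdivlMr ?powR_gt0 //; apply: ltW.
  by apply: lt_le_trans (truncnS_gt _) _; rewrite ler_nat.
have /andP[r_gt0 r_lt1] := r01.
(* The base is in ]0, 1[, so lowering the exponent from N to K / 3 increases the power; and C1 <= C
   increases the base. *)
have pow_le : (1 - r) ^+ N <= (1 - expR (- (C * L * G))) `^ (K / 3).
  rewrite -powR_mulrn ?subr_ge0 ?(ltW r_lt1) //.
  apply: (@le_trans _ _ ((1 - r) `^ (K / 3))).
    apply: ger_powR; last by lra.
    by rewrite subr_gt0 r_lt1 /= lerBlDr lerDl ltW.
  have CC : C1 * L * G <= C * L * G.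
    by rewrite !ler_wpM2r ?(ltW L0) ?(ltW G_gt0) // /C; lra.
  apply: ge0_ler_powR; rewrite ?nnegrE ?subr_ge0 ?(ltW r_lt1) //.
  - by rewrite divr_ge0 // ltW.
  - by rewrite -[leRHS]expR0 ler_expR oppr_le0 (le_trans (ltW C1LG)).
  - by rewrite lerD2l lerN2 ler_expR lerN2.
set P := (_ `^ (K / 3)) in pow_le *.
have P_ge0 : 0 <= P by exact: powR_ge0.
set D := L `^ (- delta) in n_le E_le Q_le *.
have D_ge0 : 0 <= D by exact: powR_ge0.
rewrite -(ler_pM2l nR); apply: (le_trans main).
have b3 : 20 * (M%:R / N%:R) * Q * (T2 + n.+1%:R + A2 * n%:R + C0 * (2 * n%:R + T1)) <=
    n%:R * (CQ * D).
  apply: (@le_trans _ _ (20 * (M%:R / N%:R) * Q * (CS * n%:R))).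
    apply: ler_wpM2l S_le.
    by do ?[exact: Q_ge0 | exact: ler0n | apply: mulr_ge0 | apply: divr_ge0].
  rewrite [leLHS](_ : _ = n%:R * (20 * (M%:R / N%:R) * Q * CS)); last by ring.
  by rewrite ler_wpM2l.
have b2 : 6 * T3 <= n%:R * (24 * CE * D).
  apply: (@le_trans _ _ (n%:R * (24 * expR (- (w / 2))))); first by lra.
  by rewrite ler_wpM2l // -[leRHS]mulrA ler_wpM2l.
have b1 : 2 * n%:R * (1 - r) ^+ N <= n%:R * (2 * P).
  rewrite [leLHS](_ : _ = n%:R * (2 * (1 - r) ^+ N)); last by ring.
  by rewrite ler_wpM2l // ler_wpM2l.
apply: (@le_trans _ _ (n%:R * (D + 2 * P + 24 * CE * D + CQ * D))).
  by rewrite !mulrDr; lra.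
rewrite ler_wpM2l //.
have h1 : (1 + 24 * CE + CQ) * D <= C * D by rewrite ler_wpM2r // /C; lra.
have h2 : 2 * P <= C * P by rewrite ler_wpM2r // /C; lra.
lra.
Qed.

(** * Measurability *)

Section FiniteValued.
Context {R : realType} {d : measure_display} {Omega : measurableType d}.
Local Open Scope classical_set_scope.

Definition finite_measurable (T : finType) (h : Omega -> T) : Prop :=
  forall v, measurable [set w | h w = v].

Lemma finite_measurable_pair (T U : finType) (h : Omega -> T) (k : Omega -> U) :
  finite_measurable h -> finite_measurable k ->
  finite_measurable (fun w => (h w, k w)).
Proof.
move=> mh mk [a b].
have -> : [set w | (h w, k w) = (a, b)] = [set w | h w = a] `&` [set w | k w = b].
  apply/seteqP; split=> w /=; first by case=> -> ->.
  by case=> -> ->.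
exact: measurableI.
Qed.

Lemma finite_measurable_bool (b : Omega -> bool) :
  measurable [set w | b w] -> finite_measurable b.
Proof.
move=> mb [] //; have -> : [set w | b w = false] = ~` [set w | b w].
  by apply/seteqP; split=> [w /= ->//|w /=/negP/negbTE].
exact: measurableC.
Qed.

Lemma finite_measurable_ffun (I T : finType) (h : I -> Omega -> T) :
  (forall i, finite_measurable (h i)) ->
  finite_measurable (fun w => [ffun i => h i w]).
Proof.
move=> mh f; have -> : [set w | [ffun i => h i w] = f] =
    \bigcap_(i in [set: I]) [set w | h i w = f i].
  apply/seteqP; split=> [w /= <- i _|w hw] /=; first by rewrite ffunE.
  by apply/ffunP => i; rewrite ffunE; exact: hw.
by apply: fin_bigcap_measurable => [|i _]; [exact: finite_finset|exact: mh].
Qed.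

Lemma finite_measurable_le (T : finType) (h : Omega -> T) (F : T -> Omega -> R) (c : R) :
  finite_measurable h -> (forall v, measurable_fun setT (F v)) ->
  measurable [set w | F (h w) w <= c].
Proof.
move=> mh mF; have -> : [set w | F (h w) w <= c] =
    \bigcup_(v in [set: T]) ([set w | h w = v] `&` [set w | F v w <= c]).
  by apply/seteqP; split=> [w Fw|w [v _ [/= -> //]]]; exists (h w).
apply: fin_bigcup_measurable => [|v _]; first exact: finite_finset.
apply: measurableI; first exact: mh.
rewrite -[X in measurable X]setTI.
have -> : [set w | F v w <= c] = F v @^-1` `]-oo, c].
  by apply/seteqP; split=> w /=; rewrite in_itv.
exact: mF.
Qed.

End FiniteValued.

Section Measurability.
Context {R : realType} {d : measure_display} {Omega : measurableType d}.
Context {n : nat}.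

(** Sorting depends on the data only through finitely many comparisons; this makes it a
    finite-valued measurable function. *)
Definition sort_of_order (b : {ffun 'I_n * 'I_n -> bool}) : {perm 'I_n} :=
  odflt 1%g [pick s : {perm 'I_n} |
    [forall i : 'I_n, forall j : 'I_n, (i < j)%N ==> b (s i, s j)]].

Lemma sorting_perm_order (X : 'I_n -> R) :
  sorting_perm X = sort_of_order [ffun u => X u.1 < X u.2].
Proof.
rewrite /sorting_perm /sort_of_order; congr (odflt _ _); apply: eq_pick => s /=.
by apply: eq_forallb => i; apply: eq_forallb => j; rewrite ffunE.
Qed.

Lemma measurable_gibbs (c : Omega -> 'I_n -> 'I_n -> R) (W : {set 'I_n}) p :
  (forall k l, measurable_fun setT (fun w => c w k l)) ->
  measurable_fun setT (fun w => gibbs (c w) W p).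
Proof.
move=> mc.
have mw q : measurable_fun setT (fun w => gibbs_weight (c w) W q).
  apply: measurableT_comp; first exact: measurable_expR.
  apply: measurableT_comp; first exact: oppr_measurable.
  under eq_fun do rewrite big_mkcond; apply: measurable_sum => k.
  by case: (k \in W).
have mm : measurable_fun setT (fun w => gibbs_mass (c w) W).
  under eq_fun do rewrite /gibbs_mass big_mkcond; apply: measurable_sum => q.
  by case: (perm_on W q).
rewrite /gibbs; apply: measurable_funM; first exact: mw.
(* The mass is positive, so its inverse is exp (- ln), a composition of measurable functions. *)
under eq_fun do rewrite -[gibbs_mass _ _]lnK ?posrE ?gibbs_mass_gt0 // -expRN.
apply: measurableT_comp; first exact: measurable_expR.
apply: measurableT_comp; first exact: oppr_measurable.
by apply: measurableT_comp; first exact: measurable_ln.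
Qed.

Lemma measurable_TV_marginal (c : Omega -> 'I_n -> 'I_n -> R) (W1 W2 : {set 'I_n}) k :
  (forall i j, measurable_fun setT (fun w => c w i j)) ->
  measurable_fun setT (fun w => TV (marginal (c w) W1 k) (marginal (c w) W2 k)).
Proof.
move=> mc.
have mm W l : measurable_fun setT (fun w => marginal (c w) W k l).
  under eq_fun do rewrite /marginal big_mkcond; apply: measurable_sum => p.
  by case: (perm_on W p && (p k == l)) => //; exact: measurable_gibbs.
rewrite /TV; apply: measurable_funM; first exact: measurable_cst.
apply: measurable_sum => l; apply: measurableT_comp; first exact: normr_measurable.
by apply: measurable_funB; exact: mm.
Qed.

Local Open Scope classical_set_scope.

(** Once [pistar] and the two orders are fixed, the mean is a measurable expression in the
    coordinates; the event is a finite union over these values. *)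
Lemma measurable_mean_TV_le (V : R -> R) (Xb Yb : 'I_n -> Omega -> R)
    (pistar : Omega -> {perm 'I_n}) (M : nat) (c : R) :
  measurable_fun setT V ->
  (forall i, measurable_fun setT (Xb i)) -> (forall i, measurable_fun setT (Yb i)) ->
  (forall s, measurable [set w | pistar w = s]) ->
  measurable [set w | (mean_TV V (observedX Xb pistar w) (observedY Yb w) M <= c)%R].
Proof.
move=> mV mX mY mpi.
pose ox w := [ffun u : 'I_n * 'I_n => Xb u.1 w < Xb u.2 w].
pose oy w := [ffun u : 'I_n * 'I_n => Yb u.1 w < Yb u.2 w].
have mo (Z : 'I_n -> Omega -> R) : (forall i, measurable_fun setT (Z i)) ->
    finite_measurable (fun w => [ffun u : 'I_n * 'I_n => Z u.1 w < Z u.2 w]).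
  move=> mZ; apply: finite_measurable_ffun => u; apply: finite_measurable_bool.
  have := measurable_fun_ltr (mZ u.1) (mZ u.2).
  move=> /(_ measurableT [set true] I); rewrite setTI.
  by congr measurable; apply/seteqP; split=> w.
pose h w := (pistar w, (ox w, oy w)).
have mh : finite_measurable h.
  by apply: finite_measurable_pair => //; apply: finite_measurable_pair; exact: mo.
pose T := ({perm 'I_n} * ({ffun 'I_n * 'I_n -> bool} * {ffun 'I_n * 'I_n -> bool}))%type.
pose sx (v : T) :=
  sort_of_order [ffun u => v.2.1 (v.1 u.1, v.1 u.2)].
(* The shift of [sorted_cost] is arbitrary here, and 0 is taken; [- 0] keeps the two expressions
   convertible. *)
pose cost (v : T) w (k l : 'I_n) : R :=
  V (n%:R * (Xb (v.1 (sx v k)) w - Yb (sort_of_order v.2.2 l) w)) - 0.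
pose F (v : T) w : R := n%:R^-1 * \sum_k
  TV (marginal (cost v w) finset.setT k) (marginal (cost v w) (window M k) k).
have -> : [set w | (mean_TV V (observedX Xb pistar w) (observedY Yb w) M <= c)%R] =
    [set w | F (h w) w <= c].
  congr mkset; apply/funext => w; congr (is_true (_ <= c)).
  rewrite (mean_TV_sorted V _ _ 0) /F; congr (_ * _); apply: eq_bigr => k _.
  have -> : sorted_cost V (observedX Xb pistar w) (observedY Yb w) 0 = cost (h w) w; last by [].
  apply/funext => i; apply/funext => j; rewrite /sorted_cost /cost.
  rewrite !sorting_perm_order /sx /=.
  have -> : [ffun u => observedX Xb pistar w u.1 < observedX Xb pistar w u.2] =
      [ffun u => ox w (pistar w u.1, pistar w u.2)].
    by apply/ffunP => u; rewrite !ffunE.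
  by [].
apply: finite_measurable_le => // v.
apply: measurable_funM; first exact: measurable_cst.
apply: measurable_sum => k; apply: measurable_TV_marginal => i j.
apply: measurable_funB; last exact: measurable_cst.
apply: measurableT_comp => //; apply: measurable_funM; first exact: measurable_cst.
by apply: measurable_funB.
Qed.

End Measurability.

(** * The density of a pair *)

(* The integral of a nonnegative function is a supremum over simple functions
   below it, so monotonicity needs no measurability. *)
Lemma ge0_integral_mono (d : measure_display) (T : measurableType d) (R : realType)
    (mu : {measure set T -> \bar R}) (D E : set T) (f g : T -> \bar R) :
  (forall x, D x -> 0 <= f x)%E -> (forall x, E x -> 0 <= g x)%E ->
  (forall x, D x -> E x /\ (f x <= g x)%E) ->
  (\int[mu]_(x in D) f x <= \int[mu]_(x in E) g x)%E.
Proof.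
move=> f0 g0 fg; rewrite !ge0_integralE //; apply: ereal_sup_le => _ [h hf <-].
exists h => // x /=; apply: (le_trans (hf x)); rewrite /patch.
case: ifPn => [|_]; first by rewrite inE => /fg[Ex fgx]; rewrite mem_set.
by case: ifPn => // /set_mem /g0.
Qed.

Section UnitSquare.
Context {R : realType}.
Local Open Scope classical_set_scope.

Definition cell (m i : nat) : set R := `[i%:R / m%:R, i.+1%:R / m%:R[.

Lemma measurable_cell m i : measurable (cell m i).
Proof. exact: measurable_itv. Qed.

Lemma cell_truncn m i (x : R) : (0 < m)%N -> cell m i x ->
  0 <= x /\ Num.truncn (m%:R * x) = i.
Proof.
move=> m0; rewrite /cell /= in_itv /= => /andP[lo hi].
have mR : 0 < m%:R :> R by rewrite ltr0n.
split; first by apply: le_trans lo; rewrite divr_ge0.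
by apply: truncn_def; rewrite mulrC -ler_pdivrMr // lo -ltr_pdivlMr.
Qed.

Lemma mem_cell m (x : R) : (0 < m)%N -> 0 <= x -> cell m (Num.truncn (m%:R * x)) x.
Proof.
move=> m0 x0; have mR : 0 < m%:R :> R by rewrite ltr0n.
have mx0 : 0 <= m%:R * x by rewrite mulr_ge0.
have /andP[lo hi] := truncn_itv mx0.
by rewrite /cell /= in_itv /= ler_pdivrMr // ltr_pdivlMr // [x * _]mulrC lo.
Qed.

Lemma measure_cell m i : (0 < m)%N -> lebesgue_measure (cell m i) = (m%:R^-1)%:E.
Proof.
move=> m0; have mR : 0 < m%:R :> R by rewrite ltr0n.
rewrite lebesgue_measure_itv /= lte_fin ltr_pM2r ?invr_gt0 // ltr_nat leqnn.
by rewrite -EFinB -mulrBl -natrB // subSnn mul1r.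
Qed.

Lemma measurable_unit_square : measurable (unit_square : set (R * R)).
Proof. by apply: measurableX; exact: measurable_itv. Qed.

Lemma measure_unit_square :
  ((@lebesgue_measure R) \x (@lebesgue_measure R))%E unit_square = 1%E.
Proof.
have m01 : measurable (`[0, 1] : set R) by exact: measurable_itv.
have /= -> := product_measure1E (@lebesgue_measure R) (@lebesgue_measure R) m01 m01.
by rewrite lebesgue_measure_itv /= lte_fin ltr01 -!EFinB -!EFinM subr0 mul1r.
Qed.

Lemma measure_bigsetU_fin (d : measure_display) (T : measurableType d)
    (mu : {measure set T -> \bar R}) (I : choiceType) (s : seq I) (F : I -> set T) :
  uniq s -> (forall i, measurable (F i)) ->
  (forall i j x, F i x -> F j x -> i = j) ->
  mu (\big[setU/set0]_(i <- s) F i) = (\sum_(i <- s) mu (F i))%E.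
Proof.
move=> + mF disj; elim: s => [_|i s IH /= /andP[is_ us]].
  by rewrite !big_nil measure0.
have mB : measurable (\big[setU/set0]_(j <- s) F j) by apply: bigsetU_measurable => j _.
have dis : F i `&` \big[setU/set0]_(j <- s) F j = set0.
  apply/seteqP; split=> [x [Fi]|//]; rewrite -bigcup_seq => -[j /= js Fj].
  by move: is_; rewrite (disj _ _ _ Fi Fj) js.
rewrite !big_cons (measureU mu (mF i) mB dis); congr (_ + _)%E; exact: IH.
Qed.

End UnitSquare.

Section PairDensity.
Context {R : realType}.
Variables (Lambda V : R -> R) (Lmin Lmax Vmin : R) (g : R -> R) (n : nat).
Hypotheses (Lmin_gt0 : 0 < Lmin).
Hypothesis Lambda_bounds : forall x : R, 0 <= x <= 1 -> Lmin <= Lambda x <= Lmax.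
Hypothesis g_incr : forall u v : R, 0 <= u -> u <= v -> g u <= g v.
Hypothesis V_le : forall e : R, V e - Vmin <= g `|e|.
Hypothesis V_ge : forall e : R, Vmin <= V e.
Hypothesis n_gt0 : (0 < n)%N.
Local Open Scope classical_set_scope.

Let nR : 0 < n%:R :> R. Proof. by rewrite ltr0n. Qed.

Let mu2 := ((@lebesgue_measure R) \x (@lebesgue_measure R))%E.

Let Lmax_ge : Lmin <= Lmax.
Proof.
have /Lambda_bounds/andP[a b] : 0 <= (0 : R) <= 1 by rewrite lexx ler01.
exact: le_trans b.
Qed.

Let Lmax_gt0 : 0 < Lmax. Proof. exact: lt_le_trans Lmax_ge. Qed.

Let unit_squareP (z : R * R) : unit_square z -> 0 <= z.1 <= 1 /\ 0 <= z.2 <= 1.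
Proof. by case=> /=; rewrite !in_itv. Qed.

Lemma sqrt_Lambda_bounds (z : R * R) : unit_square z ->
  Lmin <= Num.sqrt (Lambda z.1 * Lambda z.2) <= Lmax.
Proof.
move=> /unit_squareP[/Lambda_bounds/andP[a b] /Lambda_bounds/andP[a' b']].
have l1 : 0 < Lambda z.1 by exact: lt_le_trans a.
have l2 : 0 < Lambda z.2 by exact: lt_le_trans a'.
rewrite -[Lmin]ger0_norm ?(ltW Lmin_gt0) // -[Lmax]ger0_norm ?(ltW Lmax_gt0) //.
rewrite -!sqrtr_sqr !ler_sqrt ?exprn_ge0 ?mulr_ge0 ?(ltW l1) ?(ltW l2) ?(ltW Lmax_gt0) //.
by rewrite !expr2 !ler_pM // ?ltW.
Qed.

Lemma unnorm_density_ge0 (z : R * R) : 0 <= unnorm_density Lambda V n z.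
Proof. by rewrite mulr_ge0 ?sqrtr_ge0 ?expR_ge0. Qed.

Lemma integral_unnorm_le (D : set (R * R)) (b : R) : measurable D -> 0 <= b ->
  (forall z, D z -> unit_square z -> expR (- V (n%:R * (z.1 - z.2))) <= b) ->
  (\int[mu2]_(z in D `&` unit_square) (unnorm_density Lambda V n z)%:E
    <= (Lmax * b)%:E * mu2 D)%E.
Proof.
move=> mD b0 hb; rewrite -integral_cst //; apply: ge0_integral_mono.
- by move=> z _; rewrite lee_fin unnorm_density_ge0.
- by move=> z _; rewrite lee_fin mulr_ge0 // ltW.
- move=> z [Dz sz]; split=> //; rewrite lee_fin /unnorm_density.
  have /andP[_ s] := sqrt_Lambda_bounds sz.
  by rewrite ler_pM ?sqrtr_ge0 ?expR_ge0 // hb.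
Qed.

Let diag_cell i : set (R * R) := cell n i `*` cell n i.

(** On the n diagonal cells, of total area 1 / n, the argument of V is at most 1 in absolute
    value. *)
Lemma integral_unnorm_ge :
  ((Lmin * expR (- (Vmin + g 1)) / n%:R)%:E <=
   \int[mu2]_(z in unit_square) (unnorm_density Lambda V n z)%:E)%E.
Proof.
set c := Lmin * _; have c0 : 0 <= c by rewrite mulr_ge0 ?expR_ge0 // ltW.
pose S := \big[setU/set0]_(i <- iota 0 n) diag_cell i.
have mdiag i : measurable (diag_cell i).
  by apply: measurableX; exact: measurable_cell.
have mS : measurable S by apply: bigsetU_measurable => i _.
have muS : mu2 S = (n%:R^-1)%:E.
  rewrite /mu2 /S measure_bigsetU_fin ?iota_uniq //; last first.
    move=> i j [x y] [/= xi _] [/= xj _].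
    by have [_ <-] := cell_truncn n_gt0 xi; have [_ <-] := cell_truncn n_gt0 xj.
  rewrite (eq_bigr (fun=> (n%:R^-1 * n%:R^-1)%:E)) => [|i _].
    rewrite sumEFin big_const_seq count_predT size_iota iter_addr_0.
    by rewrite -[_ *+ n]mulr_natl mulrA mulfV ?mul1r // gt_eqF.
  have /= -> := product_measure1E (@lebesgue_measure R) (@lebesgue_measure R)
    (measurable_cell n i) (measurable_cell n i).
  by rewrite !measure_cell.
have -> : (c / n%:R)%:E = ((c)%:E * mu2 S)%E by rewrite muS -EFinM.
rewrite -integral_cst //; apply: ge0_integral_mono.
- by move=> z _; rewrite lee_fin.
- by move=> z _; rewrite lee_fin unnorm_density_ge0.
- move=> z; rewrite /S -bigcup_seq => -[i /=]; rewrite mem_iota add0n => iN [zx zy].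
  have sub (x : R) : cell n i x -> 0 <= x <= 1.
    rewrite /cell /= in_itv /= => /andP[lo hi]; apply/andP; split.
      by apply: le_trans lo; rewrite divr_ge0.
    by apply: (le_trans (ltW hi)); rewrite ler_pdivrMr // mul1r ler_nat.
  have sz : unit_square z by split; rewrite /= in_itv; exact: sub.
  split=> //; rewrite lee_fin /unnorm_density /c.
  have /andP[s _] := sqrt_Lambda_bounds sz.
  apply: ler_pM => //; rewrite ?expR_ge0 ?(ltW Lmin_gt0) // ler_expR lerN2.
  suff : g `|n%:R * (z.1 - z.2)| <= g 1 by have := V_le (n%:R * (z.1 - z.2)); lra.
  apply: g_incr => //; rewrite normrM ger0_norm ?(ltW nR) //.
  move: zx zy; rewrite /cell /= !in_itv /= => /andP[x1 x2] /andP[y1 y2].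
  rewrite -ler_pdivlMl // mulr1 ler_norml.
  have e : i.+1%:R / n%:R = i%:R / n%:R + n%:R^-1 :> R.
    by rewrite -natr1 mulrDl mul1r.
  by rewrite e in x2 y2; apply/andP; split; lra.
Qed.

(** Times n, this is Lmax divided by the lower bound of the normalizer. *)
Definition density_constant : R := Lmax / Lmin * expR (Vmin + g 1).

Lemma density_constant_gt0 : 0 < density_constant.
Proof. by rewrite mulr_gt0 ?expR_gt0 // divr_gt0. Qed.

Lemma integral_match_density_le (D : set (R * R)) (b : R) : measurable D -> 0 <= b ->
  (forall z, D z -> unit_square z -> expR (- V (n%:R * (z.1 - z.2))) <= b) ->
  (\int[mu2]_(z in D `&` unit_square) (match_density Lambda V n z)%:E
    <= (n%:R * density_constant * b)%:E * mu2 D)%E.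
Proof.
move=> mD b0 hb.
set Zn := normalizer Lambda V n.
have ZI : Zn = fine (\int[mu2]_(z in unit_square) (unnorm_density Lambda V n z)%:E) by [].
(* Finiteness matters: [fine] would send an infinite integral to 0. *)
have Iub : (\int[mu2]_(z in unit_square) (unnorm_density Lambda V n z)%:E < +oo)%E.
  have := @integral_unnorm_le unit_square (expR (- Vmin)) measurable_unit_square
    (expR_ge0 _); rewrite setIid => /(_ _)/le_lt_trans; apply.
    by move=> z _ _; rewrite ler_expR lerN2.
  by rewrite /mu2 measure_unit_square -EFinM ltry.
have Ige := integral_unnorm_ge.
have Zge : Lmin * expR (- (Vmin + g 1)) / n%:R <= Zn.
  rewrite ZI -lee_fin fineK // ge0_fin_numE //.
  by apply: le_trans Ige; rewrite lee_fin divr_ge0 ?mulr_ge0 ?expR_ge0 // ltW.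
have lb0 : 0 < Lmin * expR (- (Vmin + g 1)) / n%:R.
  by rewrite divr_gt0 // mulr_gt0 // expR_gt0.
have Z0 : 0 < Zn by exact: lt_le_trans Zge.
rewrite -integral_cst //; apply: ge0_integral_mono.
- by move=> z _; rewrite lee_fin mulr_ge0 ?unnorm_density_ge0 // invr_ge0 ltW.
- move=> z _; rewrite lee_fin mulr_ge0 // mulr_ge0 // ltW //.
  exact: density_constant_gt0.
- move=> z [Dz sz]; split=> //; rewrite lee_fin /match_density /unnorm_density -/Zn.
  have /andP[_ s] := sqrt_Lambda_bounds sz.
  have -> : n%:R * density_constant * b =
      (Lmin * expR (- (Vmin + g 1)) / n%:R)^-1 * (Lmax * b).
    rewrite /density_constant expRN; field.
    by rewrite !gt_eqF ?expR_gt0.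
  apply: ler_pM; rewrite ?invr_ge0 ?(ltW Z0) ?mulr_ge0 ?sqrtr_ge0 ?expR_ge0 //.
    by rewrite lef_pV2 ?posrE.
  by rewrite ler_pM ?sqrtr_ge0 ?expR_ge0 // hb.
Qed.

End PairDensity.

(** * The exact matching model and its discretization *)

Section Model.
Context {R : realType}.
Variables (Lambda V : R -> R) (Lmin Lmax C0 c0 delta Vmin : R) (f g : R -> R).
Hypothesis HA : assumptionA Lambda V Lmin Lmax C0 c0 delta Vmin f g.
Local Open Scope classical_set_scope.

Let V_le (e : R) : V e - Vmin <= g `|e|. Proof. by case: (V_growth HA e). Qed.

Let V_growth_ge (e : R) : c0 * `|e| `^ (1 + delta) <= V e - Vmin.
Proof. by case: (V_growth HA e) => _ _; move=> /[swap]; exact: le_trans. Qed.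

Let V_ge (e : R) : Vmin <= V e.
Proof.
by rewrite -subr_ge0; apply: le_trans (V_growth_ge e); rewrite mulr_ge0 ?powR_ge0 // ltW // (c0_gt0 HA).
Qed.

Let g_incr (u v : R) : 0 <= u -> u <= v -> g u <= g v.
Proof. exact: g_nondecreasing HA u v. Qed.

Let D : R := density_constant Lmin Lmax Vmin g.

Let D_gt0 : 0 < D.
Proof. exact: density_constant_gt0 (Lmin_gt0 HA) (Lambda_bounds HA). Qed.

(** For integer parts d apart, V >= Vmin + c0 (d - 2): one unit is lost to rounding, one to the
    linear lower bound of the power. *)
Definition cell_constant : R := D * expR (2 * c0 - Vmin).

Lemma cell_constant_gt0 : 0 < cell_constant.
Proof. by rewrite mulr_gt0 ?expR_gt0. Qed.

Context {n : nat}.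
Hypothesis n_gt0 : (0 < n)%N.

Let nR : 0 < n%:R :> R. Proof. by rewrite ltr0n. Qed.

Context {d : measure_display} {Omega : measurableType d}.
Variables (P : probability Omega R) (Xbar Ybar : 'I_n -> {RV P >-> R}).
Variable pistar : Omega -> {perm 'I_n}.
Hypothesis model : exact_matching_model Lambda V Xbar Ybar pistar.

Let pair i w : R * R := (Xbar i w, Ybar i w).

Lemma measurable_pair i (A : set (R * R)) : measurable A ->
  measurable [set w | A (pair i w)].
Proof.
move=> mA; rewrite -[X in measurable X]setTI.
have mp : measurable_fun setT (pair i) by apply: measurable_fun_pair.
exact: mp.
Qed.

Let density_le (S : set (R * R)) (b : R) := @integral_match_density_le R Lambda V
  Lmin Lmax Vmin g n (Lmin_gt0 HA) (Lambda_bounds HA) g_incr V_le V_ge n_gt0 S b.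

(** The cell of index n lies beyond the square except for the coordinate 1; the intersection keeps
    only that part. *)
Definition block (z : 'I_n.+1 * 'I_n.+1) : set (R * R) :=
  (cell n z.1 `*` cell n z.2) `&` unit_square.

Lemma measurable_block z : measurable (block z).
Proof.
apply: measurableI measurable_unit_square.
by apply: measurableX; exact: measurable_cell.
Qed.

Definition block_prob (z : 'I_n.+1 * 'I_n.+1) : R :=
  fine (\int[lebesgue2]_(u in block z) (match_density Lambda V n u)%:E)%E.

Lemma pair_block i z : P [set w | block z (pair i w)] = (block_prob z)%:E.
Proof.
have e : P [set w | block z (pair i w)] =
    (\int[lebesgue2]_(u in block z) (match_density Lambda V n u)%:E)%E.
  rewrite (pair_law model i (measurable_block z)).
  by rewrite /block -setIA setIid.
rewrite /block_prob -e fineK // fin_num_measure //.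
by apply: measurable_pair; exact: measurable_block.
Qed.

Lemma block_prob_ge0 z : 0 <= block_prob z.
Proof. by rewrite -lee_fin -(pair_block (Ordinal n_gt0)) measure_ge0. Qed.

Lemma block_prob_le z :
  block_prob z <= cell_constant / n%:R * expR (- (c0 * (ndist z.1 z.2)%:R)).
Proof.
rewrite -lee_fin -(pair_block (Ordinal n_gt0)) (pair_law model _ (measurable_block z)).
have mC : measurable (cell n z.1 `*` cell n z.2 : set (R * R)).
  by apply: measurableX; exact: measurable_cell.
pose b : R := expR (2 * c0 - Vmin) * expR (- (c0 * (ndist z.1 z.2)%:R)).
have b0 : 0 <= b by rewrite mulr_ge0 ?expR_ge0.
rewrite /block -setIA setIid; apply: (le_trans (density_le mC b0 _)).
  move=> u [/= ux uy] _; rewrite /b -expRD ler_expR.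
  have [x0 ex] := cell_truncn n_gt0 ux; have [y0 ey] := cell_truncn n_gt0 uy.
  have /andP[dx _] := truncn_dist (mulr_ge0 (ltW nR) x0) (mulr_ge0 (ltW nR) y0).
  rewrite ex ey -mulrBr in dx.
  have d1 : 1 <= 1 + delta by rewrite lerDl ltW // (delta_gt0 HA).
  have := powR_ge_sub1 (normr_ge0 (n%:R * (u.1 - u.2))) d1.
  have := V_growth_ge (n%:R * (u.1 - u.2)).
  set N := `|_|; set W := V _; set T := N `^ _ => VT T1.
  have : c0 * ((ndist z.1 z.2)%:R - 2) <= c0 * T.
    by rewrite ler_pM2l ?(c0_gt0 HA) //; move: dx T1; rewrite -/N; lra.
  by move: VT; lra.
have /= -> := product_measure1E (@lebesgue_measure R) (@lebesgue_measure R)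
  (measurable_cell n z.1) (measurable_cell n z.2).
rewrite !measure_cell // -!EFinM lee_fin /b /cell_constant -/D.
set N := n%:R; set e1 := expR _; set e2 := expR _.
have -> : N * D * (e1 * e2) * (N^-1 / N) = D * e1 / N * e2 by field; exact: lt0r_neq0.
by [].
Qed.

Lemma block_inj z z' u : block z u -> block z' u -> z = z'.
Proof.
move=> [[/= x y] _] [[/= x' y'] _].
have [_ e] := cell_truncn n_gt0 x; have [_ e'] := cell_truncn n_gt0 x'.
have [_ h] := cell_truncn n_gt0 y; have [_ h'] := cell_truncn n_gt0 y'.
case: z z' e e' h h' {x x' y y'} => [a b] [a' b'] /= e e' h h'.
by congr (_, _); apply: val_inj; rewrite /= -?e' -?h'.
Qed.

Let truncn_leq m (x : R) : 0 <= x <= 1 -> (Num.truncn (m%:R * x) < m.+1)%N.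
Proof.
move=> /andP[x0 x1]; rewrite truncn_lt_nat ?mulr_ge0 //.
apply: (@le_lt_trans _ _ m%:R); first by rewrite ler_piMr.
by rewrite ltr_nat.
Qed.

Lemma square_block u : unit_square u -> exists z, block z u.
Proof.
move=> su; have [/= ] := su; rewrite !in_itv /= => h1 h2.
exists (Ordinal (truncn_leq n h1), Ordinal (truncn_leq n h2)).
have /andP[x0 _] := h1; have /andP[y0 _] := h2.
by split=> //; split; apply: mem_cell.
Qed.

(** The law assigns the same integral to the square and to the whole plane, and the plane has
    probability 1. *)
Lemma pair_square i : P [set w | unit_square (pair i w)] = 1%E.
Proof.
rewrite (pair_law model i measurable_unit_square) setIid.
rewrite -(setTI unit_square) -(pair_law model i measurableT).
by rewrite -[RHS](probability_setT P); congr (P _); apply/seteqP.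
Qed.

Lemma sum_block_prob : \sum_z block_prob z = 1.
Proof.
pose i := Ordinal n_gt0; apply: EFin_inj.
rewrite -sumEFin (eq_bigr _ (fun z _ => esym (pair_block i z))).
rewrite -[RHS](pair_square i) -measure_bigsetU_fin ?index_enum_uniq //; first last.
- by move=> z z' w /block_inj; apply.
- by move=> z; apply: measurable_pair; exact: measurable_block.
congr (P _); rewrite -bigcup_seq; apply/seteqP; split=> w /=.
  by case=> z _ [].
by move=> /square_block[z zw]; exists z => //; rewrite /= mem_index_enum.
Qed.

Definition cylinder (a : {ffun 'I_n -> 'I_n.+1 * 'I_n.+1}) : set Omega :=
  [set w | forall i, block (a i) (pair i w)].

Lemma measurable_cylinder a : measurable (cylinder a).
Proof.
have -> : cylinder a = \bigcap_(i in [set: 'I_n]) [set w | block (a i) (pair i w)].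
  by apply/seteqP; split=> w /= h i => [_|]; exact: h.
apply: fin_bigcap_measurable => [|i _]; first exact: finite_finset.
by apply: measurable_pair; exact: measurable_block.
Qed.

Lemma cylinder_prob a : P (cylinder a) = (\prod_i block_prob (a i))%:E.
Proof.
rewrite /cylinder (pairs_indep model (fun i => measurable_block (a i))) -prodEFin.
by apply: eq_bigr => i _; exact: pair_block.
Qed.

(** * Coincident coordinates have probability zero *)

Section Ties.
Variables (h : R * R -> R) (strip : nat -> nat -> set (R * R)).
Hypothesis mh : measurable_fun setT h.
Hypothesis mstrip : forall m q, measurable (strip m q).
Hypothesis strip_measure : forall m q, (0 < m)%N ->
  ((@lebesgue_measure R) \x (@lebesgue_measure R))%E (strip m q) = (m%:R^-1)%:E.
Hypothesis strip_cover : forall m u, (0 < m)%N -> unit_square u ->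
  exists2 q, (q < m.+1)%N & forall v, unit_square v -> h v = h u -> strip m q v.

Definition tie i j : set Omega := [set w | [/\ unit_square (pair i w),
  unit_square (pair j w) & h (pair i w) = h (pair j w)]].

Lemma measurable_tie i j : measurable (tie i j).
Proof.
have mp k : measurable_fun setT (fun w => h (pair k w)).
  by apply: measurableT_comp => //; apply: measurable_fun_pair.
have -> : tie i j = [set w | unit_square (pair i w)] `&`
    ([set w | unit_square (pair j w)] `&` [set w | h (pair i w) == h (pair j w)]).
  by apply/seteqP; split=> w /=; [case=> a b /eqP c|case=> a [b /eqP c]].
do 2![apply: measurableI; first exact: measurable_pair measurable_unit_square].
rewrite -[X in measurable X]setTI.
exact: (measurable_fun_eqr (mp i) (mp j)).
Qed.

Lemma strip_prob m q i : (0 < m)%N ->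
  (P [set w | (strip m q `&` unit_square) (pair i w)] <=
   (n%:R * D * expR (- Vmin) / m%:R)%:E)%E.
Proof.
move=> m0; rewrite (pair_law model); last first.
  by apply: measurableI measurable_unit_square.
rewrite -setIA setIid.
apply: (le_trans (density_le (mstrip m q) (expR_ge0 (- Vmin)) _)).
  by move=> u _ _; rewrite ler_expR lerN2.
by rewrite strip_measure.
Qed.

(** Equal values fall into the same of m + 1 strips, the last one for the coordinate 1. By
    independence a strip contains both points with probability O(1 / m ^ 2), so the union is O(1 /
    m). *)
Lemma tie_le m i j : (0 < m)%N -> i != j ->
  (P (tie i j) <= (m.+1%:R * (n%:R * D * expR (- Vmin) / m%:R) ^+ 2)%:E)%E.
Proof.
move=> m0 ij; set b := n%:R * D * expR (- Vmin) / m%:R.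
pose A q k := if (k == i) || (k == j) then strip m q `&` unit_square else setT.
have mA q k : measurable (A q k).
  rewrite /A; case: ifP => _ //.
  by apply: measurableI measurable_unit_square.
pose F q := [set w | forall k, A q k (pair k w)].
have mF q : measurable (F q).
  have -> : F q = \bigcap_(k in [set: 'I_n]) [set w | A q k (pair k w)].
    by apply/seteqP; split=> w /= H k => [_|]; exact: H.
  apply: fin_bigcap_measurable => [|k _]; first exact: finite_finset.
  exact: measurable_pair.
have PF q : (P (F q) <= (b ^+ 2)%:E)%E.
  rewrite /F (pairs_indep model (mA q)) (bigD1 i) //= (bigD1 j) //=; last by rewrite eq_sym.
  rewrite big1 => [|k /andP[ki kj]]; last first.
    rewrite /A (negbTE ki) (negbTE kj) /= -[RHS](probability_setT P).
    by congr (P _); apply/seteqP.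
  rewrite mule1 /A !eqxx orbT /= expr2 EFinM.
  by apply: lee_pmul => //; exact: strip_prob.
have sub : tie i j `<=` \big[setU/set0]_(q < m.+1) F q.
  move=> w [si sj e]; have [q qm hq] := strip_cover m0 si.
  rewrite -bigcup_mkord; exists q => //= k; rewrite /A; case: ifP => // /orP[]/eqP->.
    by split=> //; exact: hq.
  by split=> //; apply: hq.
have mU : measurable (\big[setU/set0]_(q < m.+1) F q) by apply: bigsetU_measurable.
apply: (le_trans (le_measure P (mem_set (measurable_tie i j)) (mem_set mU) sub)).
apply: (le_trans (Boole_inequality P (fun q _ => mF q))).
apply: (@le_trans _ _ (\sum_(q < m.+1) (b ^+ 2)%:E)%E).
  by apply: lee_sum => q _; exact: PF.
by rewrite sumEFin sumr_const card_ord mulr_natl.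
Qed.

Lemma tie_null i j : i != j -> P (tie i j) = 0%E.
Proof.
move=> ij; have mt := measurable_tie i j.
have fin : P (tie i j) \is a fin_num by rewrite fin_num_measure.
set r := fine (P (tie i j)).
have r0 : 0 <= r by rewrite fine_ge0.
set K := n%:R * D * expR (- Vmin).
have bound m : (0 < m)%N -> r * m%:R <= 2 * K ^+ 2.
  move=> m0; have mR : 0 < m%:R :> R by rewrite ltr0n.
  have := tie_le m0 ij; rewrite -(fineK fin) lee_fin -/r -/K => rm.
  have m2 : m.+1%:R <= 2 * m%:R :> R by rewrite -natrM ler_nat; move: m0; clear; lia.
  rewrite -ler_pdivlMr //; apply: (le_trans rm).
  have -> : 2 * K ^+ 2 / m%:R = 2 * m%:R * (K / m%:R) ^+ 2 by field; exact: lt0r_neq0.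
  by apply: ler_wpM2r => //; exact: sqr_ge0.
rewrite -(fineK fin) -/r; congr (_%:E); apply/eqP; rewrite eq_le r0 andbT leNgt.
apply/negP => rp.
(* A mesh m > 2 K ^ 2 / r contradicts the bound on r m. *)
have := bound (Num.truncn (2 * K ^+ 2 / r)).+1 isT.
rewrite mulrC -ler_pdivlMr // leNgt.
have /truncn_itv/andP[_ ->] : 0 <= 2 * K ^+ 2 / r by rewrite divr_ge0 // mulr_ge0 // sqr_ge0.
by [].
Qed.

End Ties.

Let measurable01 : measurable (`[0, 1] : set R). Proof. exact: measurable_itv. Qed.

Let measure01 : lebesgue_measure (`[0, 1] : set R) = 1%E.
Proof. by rewrite lebesgue_measure_itv /= lte_fin ltr01 -EFinB subr0. Qed.

Lemma tie_fst_null i j : i != j -> P (tie fst i j) = 0%E.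
Proof.
apply: (tie_null (strip := fun m q => cell m q `*` `[0, 1])).
- exact: measurable_fst.
- by move=> m q; apply: measurableX => //; exact: measurable_cell.
- move=> m q m0.
  have /= -> := product_measure1E (@lebesgue_measure R) (@lebesgue_measure R)
    (measurable_cell m q) measurable01.
  by rewrite measure_cell // measure01 mule1.
- move=> m u m0 [/= u1 u2]; exists (Num.truncn (m%:R * u.1)).
    by apply: truncn_leq; move: u1; rewrite in_itv.
  move=> v [v1 v2] e; split=> //=; rewrite e; apply: mem_cell => //.
  by move: u1; rewrite in_itv /= => /andP[].
Qed.

Lemma tie_snd_null i j : i != j -> P (tie snd i j) = 0%E.
Proof.
apply: (tie_null (strip := fun m q => `[0, 1] `*` cell m q)).
- exact: measurable_snd.
- by move=> m q; apply: measurableX => //; exact: measurable_cell.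
- move=> m q m0.
  have /= -> := product_measure1E (@lebesgue_measure R) (@lebesgue_measure R)
    measurable01 (measurable_cell m q).
  by rewrite measure_cell // measure01 mul1e.
- move=> m u m0 [/= u1 u2]; exists (Num.truncn (m%:R * u.2)).
    by apply: truncn_leq; move: u2; rewrite in_itv.
  move=> v [v1 v2] e; split=> //=; rewrite e; apply: mem_cell => //.
  by move: u2; rewrite in_itv /= => /andP[].
Qed.

(** The cylinders are disjoint with product probabilities, so the discrete sum is the probability of
    their union; off the null set of ties this union lies in E. *)
Lemma cylinders_prob_le (Q : pred {ffun 'I_n -> 'I_n.+1 * 'I_n.+1}) (E : set Omega) :
  measurable E ->
  (forall a w, Q a -> cylinder a w ->
     injective (fun i => Xbar i w) -> injective (fun i => Ybar i w) -> E w) ->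
  ((\sum_(a | Q a) \prod_i block_prob (a i))%:E <= P E)%E.
Proof.
move=> mE QE; rewrite -sumEFin.
rewrite (eq_bigr _ (fun a _ => esym (cylinder_prob a))) -big_filter.
rewrite -measure_bigsetU_fin ?filter_uniq ?index_enum_uniq //; first last.
- move=> a b w ha hb; apply/ffunP => i; exact: block_inj (ha i) (hb i).
- exact: measurable_cylinder.
set S := \big[_/_]_(_ <- _) _.
pose T := \big[setU/set0]_(u : 'I_n * 'I_n | u.1 != u.2)
  (tie fst u.1 u.2 `|` tie snd u.1 u.2).
have [mT PT] : measurable T /\ P T = 0%E.
  apply: (big_ind (fun A : set Omega => measurable A /\ P A = 0%E)) => [|A B [mA PA] [mB PB]|u u12].
  - by split; [exact: measurable0|exact: measure0].
  - by split; [exact: measurableU|exact: null_set_setU].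
  - have m1 : measurable (tie fst u.1 u.2) by apply: measurable_tie; exact: measurable_fst.
    have m2 : measurable (tie snd u.1 u.2) by apply: measurable_tie; exact: measurable_snd.
    split; first exact: measurableU.
    by apply: null_set_setU => //; [exact: tie_fst_null|exact: tie_snd_null].
have mS : measurable S by apply: bigsetU_measurable => a _; exact: measurable_cylinder.
rewrite -(measureU0 mE mT PT); apply: le_measure.
- exact: mem_set.
- by apply/mem_set/measurableU.
rewrite /S -bigcup_seq => w [a /=]; rewrite mem_filter => /andP[Qa _] aw.
have sq i : unit_square (pair i w) by case: (aw i).
have [Tw|nTw] := pselect (T w); [by right|left].
have tieF i j h : h = fst \/ h = snd -> i != j -> h (pair i w) = h (pair j w) -> False.
  move=> hh ij e; apply: nTw; rewrite /T -big_filter -bigcup_seq; exists (i, j).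
    by rewrite /= mem_filter mem_index_enum ij.
  by case: hh e => -> e; [left|right]; split.
apply: (QE a w Qa aw) => i j e; apply/eqP/negP => /negP ij.
- exact: (tieF i j fst (or_introl erefl) ij e).
- exact: (tieF i j snd (or_intror erefl) ij e).
Qed.

End Model.

Local Open Scope classical_set_scope.
Local Open Scope ring_scope.

Theorem theorem2p9 (R : realType) (Lambda V : R -> R)
    (Lmin Lmax C0 c0 delta Vmin : R) (f g : R -> R)
    (HA : assumptionA Lambda V Lmin Lmax C0 c0 delta Vmin f g) :
  exists C : R, 0 < C /\
  forall (K L : R) (M : nat), 1 <= K -> 1 <= L -> M%:R = K * L ->
  forall kappa : R, 1 < kappa ->
  exists n0 : nat, forall n : nat, (1 <= n)%N -> (n0 <= n)%N ->
  forall (d : measure_display) (Omega : measurableType d)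
    (P : probability Omega R) (Xbar Ybar : 'I_n -> {RV P >-> R})
    (pistar : Omega -> {perm 'I_n}),
  exact_matching_model Lambda V Xbar Ybar pistar ->
  ((1 - expR (- (ln n%:R) `^ kappa))%:E <=
   P [set w | (mean_TV V (observedX Xbar pistar w) (observedY Ybar w) M <=
       C * L `^ (- delta)
       + C * (1 - expR (- (C * L * g (4 * L / Lmin)))) `^ (K / 3))%R])%E.
Proof.
pose B := cell_constant Lmin Lmax c0 Vmin g.
have B0 : 0 < B := cell_constant_gt0 HA.
have g_poly (e : R) : g `|e| <= C0 * (1 + `|e| `^ C0) by case: (V_growth HA e).
have V_le (e : R) : V e - Vmin <= g `|e| by case: (V_growth HA e).
have V_ge (e : R) : c0 * `|e| `^ (1 + delta) <= V e - Vmin.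
  by case: (V_growth HA e) => _ _; move=> /[swap]; exact: le_trans.
have [C [H [Cgt0 Hgt0 small large]]] := mean_TV_typical (C0_gt0 HA) (c0_gt0 HA)
  (delta_gt0 HA) (Lmin_gt0 HA) B0 (g_nondecreasing HA) g_poly V_le V_ge.
exists C; split=> // K L M K1 L1 ML kappa kappa1.
(* For L < H the right-hand side is at least 1, so the event is certain. *)
have [LH|HL] := ltP L H.
  exists 0%N => n _ _ d Omega P Xbar Ybar pistar model.
  rewrite [X in P X](_ : _ = setT); last first.
    apply/seteqP; split=> w //= _; apply: (le_trans (mean_TV_le1 _ _ _ Vmin _)).
    apply: (le_trans (small L L1 LH)); rewrite lerDl; apply: mulr_ge0; first exact: ltW.
    exact: powR_ge0.
  by rewrite probability_setT lee_fin gerBl expR_ge0.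
have [h0 hw [n1 Hn1]] := large K L M K1 L1 ML HL.
have [n2 Hn2] := typical_prob (L / 24) B0 (c0_gt0 HA) (ltn0Sn (Num.truncn C0)) kappa1.
exists (maxn n1 n2) => n n_gt0; rewrite geq_max => /andP[n1n n2n].
move=> d Omega P Xbar Ybar pistar model.
have := Hn2 n n_gt0 n2n (block_prob Lambda V) (Num.truncn (L / H))
  (block_prob_ge0 n_gt0 model) (sum_block_prob n_gt0 model)
  (block_prob_le HA n_gt0 model) h0 hw.
rewrite -lee_fin => /le_trans; apply.
apply: (cylinders_prob_le HA n_gt0 model).
  apply: measurable_mean_TV_le; [exact: measV HA|by []|by []|].
  exact: pistar_measurable model.
move=> a w ta aw Xinj Yinj /=.
have sq i : unit_square (Xbar i w, Ybar i w) by case: (aw i).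
apply: (Hn1 n n_gt0 n1n (fun i => Xbar i w) (fun i => Ybar i w) (pistar w) a) => //.
- by move=> i; case: (sq i) => /=; rewrite in_itv.
- by move=> i; case: (sq i) => /= _; rewrite in_itv.
- by move=> i; case: (aw i) => -[/= /(cell_truncn n_gt0)[_ ->]].
- by move=> i; case: (aw i) => -[/= _ /(cell_truncn n_gt0)[_ ->]].
Qed.
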